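(* In the Bayesian probit linear mixed model described in the context, suppose that for each $j=1,\dots,r$ either ($a_j<0$ and $b_j=0$) or $b_j>0$, and suppose: (A1) $\bm W=(\bm X,\bm Z)$ has full column rank $p+q$; (A2) there exists a vector $\bm e\in\mathbb{R}^n$ with all entries strictly positive such that $\bm e^T\bm W^*=\bm 0$; (A3) $2a_j+q_j>0$ for $j=1,\dots,r$. Then the Markov chain $\{(\bm\eta^{(m)},\bm v^{(m)},\bm\tau^{(m)})\}_{m\ge0}$ of the two-block Gibbs sampler (equivalently its $\bm\eta$-marginal chain) is geometrically ergodic with respect to the (proper) posterior.
   Context: Model: $y_i\in\{0,1\}$, $\bm x_i\in\mathbb{R}^p$, $\bm z_i\in\mathbb{R}^q$ known, $\bm X$ ($n\times p$) has rows $\bm x_i^T$, $\bm Z$ ($n\times q$) has rows $\bm z_i^T$, $\bm W=(\bm X,\bm Z)$ with $i$th row $\bm w_i^T$. $\bm\beta\in\mathbb{R}^p$, $\bm u=(\bm u_1^T,\dots,\bm u_r^T)^T$, $\bm u_j\in\mathbb{R}^{q_j}$, $q_j>0$, $q=\sum q_j$, $\bm\eta=(\bm\beta^T,\bm u^T)^T$. $Y_i\mid\bm\beta,\bm u\overset{ind}{\sim}\mathrm{Bern}(\Phi(\bm x_i^T\bm\beta+\bm z_i^T\bm u))$ with $\Phi$ the standard normal cdf, $\bm u_j\overset{ind}{\sim}N(\bm0,\tau_j^{-1}\bm I_{q_j})$. Priors: $\pi(\bm\beta)\propto1$, $\pi(\tau_j)\propto e^{-b_j\tau_j}\tau_j^{a_j-1}$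 independently on $(0,\infty)$. $c_i=1-2y_i$; $\bm W^*$ has $i$th row $c_i\bm w_i^T$. $\bm D(\bm\tau)=\oplus_{j=1}^r\tau_j\bm I_{q_j}$ and $\bm\Sigma=\bm\Sigma(\bm\tau)=\begin{pmatrix}\bm X^T\bm X&\bm X^T\bm Z\\ \bm Z^T\bm X&\bm Z^T\bm Z+\bm D(\bm\tau)\end{pmatrix}$. Two-block Gibbs sampler: given $\bm\eta^{(m)}=(\bm\beta^{(m)},\bm u^{(m)})$, (1) draw independently $\tau_j^{(m+1)}\sim\mathrm{Gamma}(a_j+q_j/2,\ b_j+\bm u_j^{(m)T}\bm u_j^{(m)}/2)$ (shape, rate), $j=1,\dots,r$, and $v_i^{(m+1)}\sim\mathrm{TN}(\bm w_i^T\bm\eta^{(m)},1,y_i)$, $i=1,\dots,n$, where $\mathrm{TN}(\mu,1,1)$ (resp. $\mathrm{TN}(\mu,1,0)$) is the $N(\mu,1)$ distribution truncated to $(0,\infty)$ (resp. $(-\infty,0]$); (2) draw $\bm\eta^{(m+1)}\sim N_{p+q}(\bm\Sigma^{-1}\bm W^T\bm v^{(m+1)},\bm\Sigma^{-1})$ with $\bm\Sigma$ evaluated at $\bm\tau^{(m+1)}$. (On the null set where some $\bm u_j=\bm 0$ with $b_j=0$, the $\tau$-update may be defined arbitrarily, e.g. as Gamma(1,1).) A Markov chain with transition kernel $K$ and stationary distribution $\Pi$ is geometrically ergodic if there are $t\in(0,1)$ and $J:\text{state space}\to(0,\infty)$ with $\sup_O|K^m(x,O)-\Pi(O)|\le J(x)t^m$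 for all states $x$ and all $m$. *)

(* Defs.v *)
From HB Require Import structures.
From mathcomp Require Import all_boot all_order all_algebra.
From mathcomp Require Import all_classical all_reals all_analysis.
Set Implicit Arguments.
Unset Strict Implicit.
Unset Printing Implicit Defensive.
Import Order.TTheory GRing.Theory Num.Theory.
Import numFieldNormedType.Exports.
Local Open Scope classical_set_scope.
Local Open Scope ring_scope.

Section ProbitGibbs.
Variable R : realType.

(* lebint k f = \int_{R^k} f d(Lebesgue), written as an iterated one-dimensional
   Lebesgue integral (Tonelli; only used for nonnegative integrands). *)
Fixpoint lebint (k : nat) : (k.-tuple R -> \bar R) -> \bar R :=
  match k with
  | 0 => fun f => f [tuple]
  | k'.+1 => fun f =>
      (\int[@lebesgue_measure R]_x lebint (fun t : k'.-tuple R => f (cons_tuple x t)))%E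
  end.

Definition tcol (k : nat) (t : k.-tuple R) : 'cV[R]_k := \col_(i < k) tnth t i.

Definition phi (x : R) : R := expR (- (x ^+ 2) / 2) / Num.sqrt (2 * pi).
Definition Phi (x : R) : R :=
  fine (\int[@lebesgue_measure R]_(t in `]-oo, x]) (phi t)%:E)%E.

Definition gamma_un (al be x : R) : R :=
  if 0 < x then x `^ (al - 1) * expR (- (be * x)) else 0.
Definition gamma_pdf (al be x : R) : R :=
  gamma_un al be x / fine (\int[@lebesgue_measure R]_t (gamma_un al be t)%:E)%E.

Definition tn_set (y : bool) (t : R) : bool := if y then 0 < t else t <= 0.
Definition tn_pdf (mu : R) (y : bool) (x : R) : R :=
  (tn_set y x)%:R * phi (x - mu) /
  fine (\int[@lebesgue_measure R]_t ((tn_set y t)%:R * phi (t - mu))%:E)%E.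

(* N_k(m, S^{-1}) density, parametrized by the precision matrix S *)
Definition mvn_pdf (k : nat) (S : 'M[R]_k) (m x : 'cV[R]_k) : R :=
  Num.sqrt (\det S) / Num.sqrt (2 * pi) ^+ k *
  expR (- (((x - m)^T *m S *m (x - m)) 0 0) / 2).

Variables (n p r : nat) (qj : 'I_r -> nat).
Definition qsum : nat := (\sum_(j < r) qj j)%N.
Local Notation q := qsum.
Local Notation d := (p + q)%N.
Variables (X : 'M[R]_(n, p)) (Z : 'M[R]_(n, q)) (y : 'I_n -> bool) (a b : 'I_r -> R).

Definition W : 'M[R]_(n, d) := row_mx X Z.
Definition cc (i : 'I_n) : R := 1 - 2 * (y i)%:R.
Definition Wstar : 'M[R]_(n, d) := \matrix_(i, k) (cc i * W i k).

Definition inblk (j : 'I_r) (k : 'I_q) : bool :=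
  ((\sum_(l < r | (l < j)%N) qj l)%N <= k < (\sum_(l < r | (l <= j)%N) qj l)%N)%N.

Definition ucoord (eta : d.-tuple R) (k : 'I_q) : R := tnth eta (rshift p k).
Definition usq (eta : d.-tuple R) (j : 'I_r) : R :=
  \sum_(k < q | inblk j k) ucoord eta k ^+ 2.

(* D(tau) = oplus_j tau_j I_{q_j} and Sigma(tau) *)
Definition Dmx (tau : r.-tuple R) : 'M[R]_q :=
  \matrix_(k, l) ((k == l)%:R * \sum_(j < r | inblk j k) tnth tau j).
Definition Sigma (tau : r.-tuple R) : 'M[R]_d :=
  W^T *m W + block_mx (0 : 'M[R]_(p, p)) 0 0 (Dmx tau).

Definition lin (eta : d.-tuple R) (i : 'I_n) : R := (W *m tcol eta) i 0.

(* step (1): density of tau^{(m+1)} given eta^{(m)}; rate 0 (u_j = 0, b_j = 0) is a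
   null set on which Gamma(1,1) is used *)
Definition tau_cond (eta : d.-tuple R) (tau : r.-tuple R) : R :=
  \prod_(j < r)
    (let rate := b j + usq eta j / 2 in
     if 0 < rate then gamma_pdf (a j + (qj j)%:R / 2) rate (tnth tau j)
     else gamma_pdf 1 1 (tnth tau j)).
Definition v_cond (eta : d.-tuple R) (v : n.-tuple R) : R :=
  \prod_(i < n) tn_pdf (lin eta i) (y i) (tnth v i).
Definition kden (eta eta' : d.-tuple R) : \bar R :=
  lebint (fun tau : r.-tuple R => lebint (fun v : n.-tuple R =>
    (tau_cond eta tau * v_cond eta v *
     mvn_pdf (Sigma tau) (invmx (Sigma tau) *m (W^T *m tcol v)) (tcol eta'))%:E)).

Fixpoint Kpow (m : nat) (eta : d.-tuple R) (O : set (d.-tuple R)) : \bar R :=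
  match m with
  | 0 => (\1_O eta)%:E
  | m'.+1 => lebint (fun eta' : d.-tuple R => (kden eta eta' * Kpow m' eta' O)%E)
  end.

Definition lik (eta : d.-tuple R) : R :=
  \prod_(i < n) (if y i then Phi (lin eta i) else 1 - Phi (lin eta i)).
(* prior pi(tau_j) propto e^{-b_j tau_j} tau_j^{a_j - 1} on (0,oo), times the
   N(0, tau_j^{-1} I_{q_j}) density of u_j; flat prior on beta *)
Definition prior_u_tau (eta : d.-tuple R) (tau : r.-tuple R) : R :=
  \prod_(j < r)
    (let t := tnth tau j in
     if 0 < t then
       expR (- (b j * t)) * t `^ (a j - 1) *
       ((t / (2 * pi)) `^ ((qj j)%:R / 2) * expR (- (t * usq eta j) / 2))
     else 0).
Definition post_un (eta : d.-tuple R) (tau : r.-tuple R) : R :=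
  lik eta * prior_u_tau eta tau.
Definition post_norm : \bar R :=
  lebint (fun eta : d.-tuple R => lebint (fun tau : r.-tuple R => (post_un eta tau)%:E)).
Definition posterior (O : set (d.-tuple R)) : \bar R :=
  (lebint (fun eta : d.-tuple R =>
     ((\1_O eta)%:E * lebint (fun tau : r.-tuple R => (post_un eta tau)%:E)))
   * ((fine post_norm)^-1)%:E)%E.

End ProbitGibbs.

(* Main.v *)
Require Import Defs.
From HB Require Import structures.
From mathcomp Require Import all_boot all_order all_algebra.
From mathcomp Require Import all_classical all_reals all_analysis.
From mathcomp Require Import ring lra measurable_realfun.
Import Order.TTheory GRing.Theory Num.Theory.
Import numFieldNormedType.Exports.
Set Implicit Arguments.
Unset Strict Implicit.
Unset Printing Implicit Defensive.
Local Open Scope classical_set_scope.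
Local Open Scope ring_scope.

(** With [W] the design matrix, take the Lyapunov function
    [V eta = |W eta|^2 + sum_(j | b_j = 0) |u_j|^(a_j)].  The mean of the new
    [eta] is a [W]-contraction of the latent vector [v], whose conditional second
    moment exceeds a constant only through the correctly classified coordinates of
    [W eta]; by (A2) these carry at most a fraction [lam < 1] of [|W eta|^2].
    For the negative powers, writing [u^-c] as a Gamma mixture of exponentials and
    using the Gaussian Laplace transform gives the drift factor
    [Gamma(m)^2 / (Gamma(q/2) Gamma(a + q/2))] with [m = (q + a)/2] the midpoint of
    the two arguments in the denominator, so it is [< 1] by strict log-convexity of
    [Gamma].  On a sublevel set of [V] the conditional densities of [tau] and [v]
    are bounded below on a fixed box, which yields a minorization, and the
    Hairer-Mattingly argument turns drift and minorization into a geometric rate.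
    The posterior density times [1 + V] is dominated, by (A2) again, by a product of
    one-dimensional functions [(1 + |x|^-g) exp(- k x^2)] with [g < 1], and it is
    invariant because prior times latent likelihood factors through the conditional
    density of [eta]. *)

(** * Integrals and measurability *)

(** The bound must hold from every starting point, including states with [u_j = 0] and [b j = 0]:
    there [tau] is drawn from the default Gamma(1,1), and drift and minorization are checked for
    that law too. The two kinds of terms in [V] answer the two ways in which the Gamma rate
    [b j + |u_j|^2 / 2] can degenerate: by full column rank [|W eta|^2] bounds [|u_j|^2] and keeps
    the rate from growing, while the negative powers keep it away from 0 when [b j = 0]. Nothing has
    to control [tau] itself, because the contraction of the conditional mean is uniform in [tau].
    Each term is averaged through one latent block only, [v] for [|W eta|^2] and [tau] for the
    powers, so the drift bounds do not interact and can be added. The exponent of [|u_j|] is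
    dictated by the drift factor: up to arbitrarily small slack, exponent [-2c] gives [Gamma(q/2 -
    c) Gamma(a + q/2 + c) / (Gamma(q/2) Gamma(a + q/2))]. The two arguments of the numerator have a
    fixed sum, so by log-convexity their product is least when they agree, that is for
    [c = - a / 2]. *)

Section Integral.
Variable R : realType.

Lemma ge0_integral_mono d (T : measurableType d) (m : {measure set T -> \bar R})
    (f g : T -> \bar R) :
  (forall x, 0 <= f x)%E -> (forall x, f x <= g x)%E ->
  (\int[m]_x f x <= \int[m]_x g x)%E.
Proof.
move=> f0 fg; have g0 x : (0 <= g x)%E by exact: le_trans (f0 x) (fg x).
rewrite !ge0_integralTE//; apply: ereal_sup_le => _ [h hf <-].
by exists h => // x; exact: le_trans (hf x) (fg x).
Qed.

Lemma measurable_invr : measurable_fun [set: R] (@GRing.inv R).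
Proof.
(* [powR] is measurable and agrees with inversion on nonnegative bases, so the inverse is read as
   [x] times the inverse of [x ^+ 2]; both sides are 0 at 0. *)
rewrite (_ : @GRing.inv R = fun x : R => x * (x ^+ 2) `^ (-1)).
  apply: measurable_funM => //.
  apply: (@measurableT_comp _ _ _ _ _ _ (@powR R ^~ (-1))).
    exact: measurable_powR.
  exact: measurable_funX.
apply/funext => x; rewrite powR_inv1 ?sqr_ge0//.
by have [->|x0] := eqVneq x 0; rewrite ?invr0 ?mul0r// expr2 invfM mulVKf.
Qed.

Lemma measurable_sqrt : measurable_fun [set: R] (@Num.sqrt R).
Proof. by apply: continuous_measurable_fun; exact: sqrt_continuous. Qed.

Lemma measurable_sumT d (T : measurableType d) I (s : seq I) (P : pred I)
    (h : I -> T -> R) : (forall i, measurable_fun setT (h i)) ->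
  measurable_fun setT (fun x => \sum_(i <- s | P i) h i x).
Proof.
move=> mh; under eq_fun do rewrite -big_filter.
exact: measurable_sum.
Qed.

Lemma measurable_prodT d (T : measurableType d) (I : eqType) (s : seq I) (P : pred I)
    (h : I -> T -> R) : (forall i, measurable_fun setT (h i)) ->
  measurable_fun setT (fun x => \prod_(i <- s | P i) h i x).
Proof.
move=> mh; under eq_fun do rewrite -big_filter.
exact: measurable_prod.
Qed.

Section MeasurableRules.
Context d (T : measurableType d).
Implicit Types f g : T -> R.
Notation mfun := (measurable_fun [set: T]).

Lemma mfun_eq d' (T' : measurableType d') (f g : T -> T') : f =1 g -> mfun f -> mfun g.
Proof. by move=> /funext ->. Qed.
Lemma mfun_D f g : mfun f -> mfun g -> mfun (fun x => f x + g x).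
Proof. exact: measurable_funD. Qed.
Lemma mfun_N f : mfun f -> mfun (fun x => - f x).
Proof. by move=> mf; exact: measurable_funN. Qed.
Lemma mfun_M f g : mfun f -> mfun g -> mfun (fun x => f x * g x).
Proof. exact: measurable_funM. Qed.
Lemma mfun_X n f : mfun f -> mfun (fun x => f x ^+ n).
Proof. exact: measurable_funX. Qed.
Lemma mfun_V f : mfun f -> mfun (fun x => (f x)^-1).
Proof. exact: (measurableT_comp measurable_invr). Qed.
Lemma mfun_sqrt f : mfun f -> mfun (fun x => Num.sqrt (f x)).
Proof. exact: (measurableT_comp measurable_sqrt). Qed.
Lemma mfun_expR f : mfun f -> mfun (fun x => expR (f x)).
Proof. exact: (measurableT_comp (@measurable_expR R)). Qed.
Lemma mfun_powR a f : mfun f -> mfun (fun x => f x `^ a).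
Proof. exact: (measurableT_comp (@measurable_powR R a)). Qed.
Lemma mfun_EFin f : mfun f -> mfun (fun x => (f x)%:E).
Proof. by move=> mf; apply/measurable_EFinP. Qed.
Lemma mfun_fst d1 d2 (T1 : measurableType d1) (T2 : measurableType d2) (h : T -> T1 * T2) :
  mfun h -> mfun (fun x => (h x).1).
Proof. exact: (measurableT_comp measurable_fst). Qed.
Lemma mfun_snd d1 d2 (T1 : measurableType d1) (T2 : measurableType d2) (h : T -> T1 * T2) :
  mfun h -> mfun (fun x => (h x).2).
Proof. exact: (measurableT_comp measurable_snd). Qed.
Lemma mfun_tnth k (h : T -> k.-tuple R) i : mfun h -> mfun (fun x => tnth (h x) i).
Proof. exact: (measurableT_comp (measurable_tnth i)). Qed.
Lemma mfun_cons k f (g : T -> k.-tuple R) : mfun f -> mfun g ->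
  mfun (fun x => cons_tuple (f x) (g x) : k.+1.-tuple R).
Proof.
move=> mf mg; rewrite (_ : (fun _ => _) =
  (fun x => [the k.+1.-tuple R of f x :: g x])); first exact: measurable_cons.
by apply/funext => x; apply/val_inj.
Qed.
Lemma mfun_eM (f g : T -> \bar R) : mfun f -> mfun g -> mfun (fun x => f x * g x)%E.
Proof. exact: emeasurable_funM. Qed.
Lemma mfun_eD (f g : T -> \bar R) : mfun f -> mfun g -> mfun (fun x => f x + g x)%E.
Proof. exact: emeasurable_funD. Qed.

End MeasurableRules.

(** Uniqueness of Lebesgue measure: [c] times its image under [x |-> c x] gives every half-open
    interval its length, hence is Lebesgue measure itself. *)
Lemma integral_scale (c : R) (f : R -> \bar R) : 0 < c ->
  measurable_fun setT f -> (forall x, 0 <= f x)%E ->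
  (\int[@lebesgue_measure R]_x f (c * x)%R = c^-1%:E * \int[@lebesgue_measure R]_x f x)%E.
Proof.
move=> c0 mf f0.
have mc : measurable_fun setT (fun x : measurableTypeR R => c * x : measurableTypeR R).
  by apply: measurable_funM.
have c0' : (0 <= c) by exact: ltW.
pose nu : {measure set _ -> \bar R} :=
  mscale (NngNum c0') (pushforward (@lebesgue_measure R) (fun x : measurableTypeR R => c * x : measurableTypeR R)).
pose nu0 := nu mc.
have E : forall A, measurable A -> lebesgue_measure A = nu0 A.
  apply: lebesgue_measure_unique => _ [[a b] _ <-] /=.
  rewrite /nu0/nu/= /mscale/= /pushforward.
  have -> : (fun x : R => c * x) @^-1` [set` Interval (BRight a) (BRight b)]
    = [set` Interval (BRight (c^-1 * a)) (BRight (c^-1 * b))].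
    apply/seteqP; split => x /=; rewrite !in_itv/=.
      by rewrite mulrC [_^-1 * _]mulrC ltr_pdivrMr// mulrC [_^-1 * _]mulrC ler_pdivlMr// [c * x]mulrC.
    by rewrite [_^-1 * _]mulrC ltr_pdivrMr// [_^-1 * _]mulrC ler_pdivlMr// [c * x]mulrC.
  rewrite !lebesgue_measure_itv/= !lte_fin ltr_pM2l ?invr_gt0//.
  case: ifP; rewrite ?mule0// => _.
  by rewrite -!EFinB -EFinM -mulrBr mulrA divff ?mul1r// gt_eqF.
rewrite [in RHS](eq_measure_integral nu0); last by move=> A mA _; exact: E.
rewrite (@ge0_integral_mscale _ _ _ _ _ measurableT (NngNum c0'))//=.
rewrite muleA -EFinM mulVf ?gt_eqF// mul1e.
by rewrite (ge0_integral_pushforward mc)// preimage_setT.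
Qed.

End Integral.

Lemma integral_sub_left (R : realType) (c : R) (f : R -> \bar R) :
  measurable_fun setT f -> (forall x, 0 <= f x)%E ->
  (\int[@lebesgue_measure R]_x f (c - x)%R = \int[@lebesgue_measure R]_x f x)%E.
Proof.
move=> mf f0.
have mc : measurable_fun setT (fun x : measurableTypeR R => c - x : measurableTypeR R).
  by apply: measurable_funB.
have E : forall A, measurable A ->
    lebesgue_measure A = pushforward (@lebesgue_measure R) (fun x : measurableTypeR R => c - x : measurableTypeR R) A.
  apply: lebesgue_measure_unique => _ [[a b] _ <-] /=.
  rewrite /pushforward.
  (* The reflection exchanges the open and the closed end; the length is the same. *)
  have -> : (fun x : R => c - x) @^-1` [set` Interval (BRight a) (BRight b)]
    = [set` Interval (BLeft (c - b)) (BLeft (c - a))].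
    by apply/seteqP; split => x /=; rewrite !in_itv/= => /andP[? ?]; apply/andP; split; lra.
  rewrite !lebesgue_measure_itv/= !lte_fin ltrD2l ltrN2.
  by case: ifP => // _; rewrite -!EFinB; congr _%:E; ring.
rewrite [in RHS](eq_measure_integral (pushforward (@lebesgue_measure R) (fun x : measurableTypeR R => c - x : measurableTypeR R))); last by move=> A mA _; exact: E.
by rewrite (ge0_integral_pushforward mc)// preimage_setT.
Qed.

Lemma integral_opp (R : realType) (f : R -> \bar R) :
  measurable_fun setT f -> (forall x, 0 <= f x)%E ->
  (\int[@lebesgue_measure R]_x f (- x)%R = \int[@lebesgue_measure R]_x f x)%E.
Proof.
move=> mf f0; rewrite -[RHS](integral_sub_left 0)//.
by apply: eq_integral => x _; rewrite sub0r.
Qed.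

#[global] Opaque integral.

Ltac mfun_eta := match goal with
 | |- @measurable_fun ?d1 ?d2 ?T1 ?T2 ?D ?f => lazymatch f with
   | (fun _ => _) => idtac
   | _ => change (@measurable_fun d1 d2 T1 T2 D (fun x => f x)) end
 | |- _ => idtac
 end.
(* Extension points: [mfun_user] and [nneg_user] are redefined as further closure
   rules become available. *)
Ltac mfun_user := fail.
Ltac mfun_step := mfun_eta; cbv beta; match goal with
 | |- forall _, _ => move=> ?
 | |- measurable_fun _ (fun x => x) => exact: measurable_id
 | |- measurable_fun _ (fun _ => ?c) => exact: measurable_cst
 | |- measurable_fun _ (fun x => (@?f x)%:E) => apply: mfun_EFin
 | |- measurable_fun _ (fun x => (@?f x * @?g x)%E) => apply: mfun_eM
 | |- measurable_fun _ (fun x => (@?f x + @?g x)%E) => apply: mfun_eD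
 | |- measurable_fun _ (fun x => (@?f x + @?g x)%R) => apply: mfun_D
 | |- measurable_fun _ (fun x => (@?f x * @?g x)%R) => apply: mfun_M
 | |- measurable_fun _ (fun x => (- @?f x)%R) => apply: mfun_N
 | |- measurable_fun _ (fun x => (@?f x ^+ _)%R) => apply: mfun_X
 | |- measurable_fun _ (fun x => ((@?f x)^-1)%R) => apply: mfun_V
 | |- measurable_fun _ (fun x => Num.sqrt (@?f x)) => apply: mfun_sqrt
 | |- measurable_fun _ (fun x => expR (@?f x)) => apply: mfun_expR
 | |- measurable_fun _ (fun x => @?f x `^ _) => apply: mfun_powR
 | |- measurable_fun _ (fun x => bigop _ _ (@?F x)) =>
     first [apply: measurable_sumT | apply: measurable_prodT]
 | |- measurable_fun _ (fun x => tnth (@?f x) _) => apply: mfun_tnth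
 | |- measurable_fun _ (fun x => cons_tuple (@?f x) (@?g x)) => apply: mfun_cons
 | |- measurable_fun _ (fun x => (@?f x, @?g x)) => apply: measurable_fun_pair
 | |- measurable_fun _ (fun x => (@?f x).1) => apply: mfun_fst
 | |- measurable_fun _ (fun x => (@?f x).2) => apply: mfun_snd
 | |- measurable_fun _ (fun x => (@?f x < @?g x)%R) => apply: measurable_fun_ltr
 | |- measurable_fun _ (fun x => (@?f x <= @?g x)%R) => apply: measurable_fun_ler
 | |- measurable_fun _ _ => assumption
 | |- measurable_fun _ _ => mfun_user
 | |- measurable_fun _ _ => apply: measurable_fun_ifT
 end.
Ltac mfun := repeat mfun_step.

Ltac nneg_user := fail.
Ltac nneg_base := first [ done | exact: expR_ge0 | exact: sqr_ge0 | exact: powR_ge0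
  | exact: sqrtr_ge0 | exact: normr_ge0 | by apply: ltW | nneg_user ].
Ltac nneg_step := first [ nneg_base | apply: addr_ge0 | apply: mulr_ge0
  | rewrite invr_ge0 | apply: exprn_ge0 | apply: prodr_ge0 => ? ? | apply: sumr_ge0 => ? ?
  | apply: mule_ge0 | apply: adde_ge0 | rewrite lee_fin | move=> ? ].
Ltac nneg := repeat nneg_step.

(** * Iterated Lebesgue integrals *)

Section Lebint.
Variable R : realType.
Notation mu := (@lebesgue_measure R).

Lemma eq_lebint k (f g : k.-tuple R -> \bar R) : f =1 g -> lebint f = lebint g.
Proof. by move=> /funext ->. Qed.

Lemma lebint_ge0 k (f : k.-tuple R -> \bar R) :
  (forall t, 0 <= f t)%E -> (0 <= lebint f)%E.
Proof.
elim: k f => [|k IH] f f0 /=; first exact: f0.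
by apply: integral_ge0 => x _; apply: IH.
Qed.

Lemma lebint_le k (f g : k.-tuple R -> \bar R) :
  (forall t, 0 <= f t)%E -> (forall t, f t <= g t)%E -> (lebint f <= lebint g)%E.
Proof.
elim: k f g => [|k IH] f g f0 fg /=; first exact: fg.
apply: ge0_integral_mono => x; first exact: lebint_ge0.
exact: IH.
Qed.

Lemma mfun_comp2 d1 d2 d3 d4 (T1 : measurableType d1) (T2 : measurableType d2)
    (T3 : measurableType d3) (T : measurableType d4)
    (f : T1 -> T2 -> T3) (g : T -> T1) (h : T -> T2) :
  measurable_fun setT (fun z : T1 * T2 => f z.1 z.2) ->
  measurable_fun setT g -> measurable_fun setT h ->
  measurable_fun setT (fun x => f (g x) (h x)).
Proof.
move=> mf mg mh; apply: (measurableT_comp mf (g := fun x => (g x, h x))).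
exact: measurable_fun_pair.
Qed.

(** The parameter lives in an arbitrary measurable space, so that the induction can move one
    coordinate of the tuple into it and apply the one-dimensional Tonelli theorem. *)
Lemma measurable_lebint d (T : measurableType d) k (f : T -> k.-tuple R -> \bar R) :
  measurable_fun setT (fun z : T * k.-tuple R => f z.1 z.2) ->
  (forall x t, 0 <= f x t)%E ->
  measurable_fun setT (fun x => lebint (f x)).
Proof.
elim: k d T f => [|k IH] d T f mf f0 /=.
  by apply: (mfun_comp2 mf) => //; exact: (@measurable_cst _ _ T (0.-tuple R) setT [tuple]).
apply: (@measurable_fun_fubini_tonelli_F _ _ _ _ _ mu
  (fun z : T * R => lebint (fun t => f z.1 (cons_tuple z.2 t)))).
  apply: (IH _ _ (fun (z : T * R) (t : k.-tuple R) => f z.1 (cons_tuple z.2 t))) => //.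
  by apply: (mfun_comp2 mf); mfun.
by move=> z; exact: lebint_ge0.
Qed.

Lemma measurable_lebint_cons k (f : k.+1.-tuple R -> \bar R) :
  measurable_fun setT f -> (forall t, 0 <= f t)%E ->
  measurable_fun setT (fun x : R => lebint (fun t => f (cons_tuple x t))).
Proof.
move=> mf f0; apply: (@measurable_lebint _ _ _ (fun (x : R) t => f (cons_tuple x t))) => //.
by apply: (measurableT_comp mf); mfun.
Qed.

Lemma measurable_cons_pair k (f : k.+1.-tuple R -> \bar R) (x : R) :
  measurable_fun setT f -> measurable_fun setT (fun t => f (cons_tuple x t)).
Proof.
move=> mf; apply: (measurableT_comp mf); mfun.
Qed.

Lemma lebintD k (f g : k.-tuple R -> \bar R) :
  measurable_fun setT f -> (forall t, 0 <= f t)%E ->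
  measurable_fun setT g -> (forall t, 0 <= g t)%E ->
  lebint (fun t => f t + g t)%E = (lebint f + lebint g)%E.
Proof.
elim: k f g => [|k IH] f g mf f0 mg g0 //=.
rewrite -ge0_integralD//; last 4 first.
- by move=> x _; exact: lebint_ge0.
- exact: measurable_lebint_cons.
- by move=> x _; exact: lebint_ge0.
- exact: measurable_lebint_cons.
by apply: eq_integral => x _; apply: IH => //; exact: measurable_cons_pair.
Qed.

Lemma lebintZl k (c : \bar R) (f : k.-tuple R -> \bar R) :
  (0 <= c)%E -> measurable_fun setT f -> (forall t, 0 <= f t)%E ->
  lebint (fun t => c * f t)%E = (c * lebint f)%E.
Proof.
move=> c0; elim: k f => [|k IH] f mf f0 //=.
rewrite -ge0_integralZl//; last 2 first.
- exact: measurable_lebint_cons.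
- by move=> x _; exact: lebint_ge0.
by apply: eq_integral => x _; apply: IH => //; exact: measurable_cons_pair.
Qed.

Lemma lebintZr k (c : \bar R) (f : k.-tuple R -> \bar R) :
  (0 <= c)%E -> measurable_fun setT f -> (forall t, 0 <= f t)%E ->
  lebint (fun t => f t * c)%E = (lebint f * c)%E.
Proof.
move=> c0 mf f0; rewrite muleC -lebintZl//.
by apply: eq_lebint => t; rewrite muleC.
Qed.

(** Tonelli past the iterated integral, one coordinate at a time; with Lebesgue measure for [m] it
    is the induction step of [lebint_swap]. *)
Lemma integral_lebint d (T : measurableType d)
    (m : {sigma_finite_measure set T -> \bar R}) k (f : T -> k.-tuple R -> \bar R) :
  measurable_fun setT (fun z : T * k.-tuple R => f z.1 z.2) ->
  (forall x t, 0 <= f x t)%E ->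
  (\int[m]_x lebint (f x) = lebint (fun t => \int[m]_x f x t))%E.
Proof.
elim: k f => [|k IH] f mf f0 //=.
have mf' : measurable_fun setT (fun z : (T * R) * k.-tuple R =>
    f z.1.1 (cons_tuple z.1.2 z.2)).
  by apply: (mfun_comp2 mf); mfun.
rewrite (@fubini_tonelli _ _ _ _ _ m mu
  (fun z : T * R => lebint (fun t => f z.1 (cons_tuple z.2 t)))); first last.
- by move=> z; exact: lebint_ge0.
- exact: (@measurable_lebint _ _ _ (fun z : T * R => fun t => f z.1 (cons_tuple z.2 t))).
apply: eq_integral => x _ /=.
apply: (IH (fun y t => f y (cons_tuple x t))) => //.
by apply: (mfun_comp2 mf); mfun.
Qed.

Lemma lebint_swap k l (f : k.-tuple R -> l.-tuple R -> \bar R) :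
  measurable_fun setT (fun z : k.-tuple R * l.-tuple R => f z.1 z.2) ->
  (forall x t, 0 <= f x t)%E ->
  lebint (fun x => lebint (f x)) = lebint (fun t => lebint (fun x => f x t)).
Proof.
elim: k f => [|k IH] f mf f0 //=.
rewrite -(@integral_lebint _ _ mu _ (fun x t => lebint (fun u => f (cons_tuple x u) t))) //=; last 2 first.
- apply: (@measurable_lebint _ _ _ (fun (z : R * l.-tuple R) u => f (cons_tuple z.1 u) z.2)) => //.
  by apply: (mfun_comp2 mf); mfun.
- by move=> x t; exact: lebint_ge0.
apply: eq_integral => x _; apply: (IH (fun u t => f (cons_tuple x u) t)) => //.
by apply: (mfun_comp2 mf); mfun.
Qed.

Lemma lebint_prod k (f : 'I_k -> R -> R) (c : 'I_k -> R) :
  (forall i, measurable_fun setT (f i)) -> (forall i x, 0 <= f i x) ->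
  (forall i, \int[mu]_x (f i x)%:E = (c i)%:E)%E ->
  lebint (fun t : k.-tuple R => (\prod_i f i (tnth t i))%:E) = (\prod_i c i)%:E.
Proof.
elim: k f c => [|k IH] f c mf f0 cE /=; first by rewrite !big_ord0.
have c0 i : 0 <= c i.
  by rewrite -lee_fin -cE; apply: integral_ge0 => x _; rewrite lee_fin.
rewrite big_ord_recl EFinM -cE -ge0_integralZr//; last 3 first.
- by apply: mfun_EFin; exact: mf.
- by move=> x _; rewrite lee_fin.
- by rewrite lee_fin prodr_ge0.
apply: eq_integral => x _ /=.
rewrite -(IH (fun i => f (lift ord0 i)) (fun i => c (lift ord0 i)))//.
rewrite -lebintZl ?lee_fin//; last 2 first.
- apply/measurable_EFinP; apply: measurable_prodT => i.
  exact: (measurableT_comp (mf _) (measurable_tnth i)).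
- by move=> t; rewrite lee_fin prodr_ge0.
apply: eq_lebint => t; rewrite big_ord_recl EFinM; congr (_ * _%:E)%E.
by apply: eq_bigr => i _; rewrite tnthS.
Qed.

(** At each level of the iterated integral the value 0 of one coordinate is a null set. The
    hyperplanes discarded here contain the states with some [u_j = 0], where the posterior bounds
    and the conditional law of [tau] can break down. *)
Lemma lebint_le_nz k (f g : k.-tuple R -> \bar R) :
  measurable_fun setT f -> (forall t, 0 <= f t)%E ->
  measurable_fun setT g -> (forall t, 0 <= g t)%E ->
  (forall t, (forall i, tnth t i != 0) -> (f t <= g t)%E) -> (lebint f <= lebint g)%E.
Proof.
elim: k f g => [|k IH] f g mf f0 mg g0 fg /=; first by apply: fg => -[].
apply: ae_ge0_le_integral => //.
- by move=> x _; exact: lebint_ge0.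
- exact: measurable_lebint_cons.
- by move=> x _; exact: lebint_ge0.
- exact: measurable_lebint_cons.
exists [set 0]; split => //; first exact: lebesgue_measure_set1.
move=> x /=; apply: contra_notP => /eqP x0 _.
apply: IH => //; do ?exact: measurable_cons_pair.
move=> t t0; apply: fg => i; case: (unliftP ord0 i) => [j ->|->//].
by rewrite tnthS.
Qed.

Lemma lebint_eq_nz k (f g : k.-tuple R -> \bar R) :
  measurable_fun setT f -> (forall t, 0 <= f t)%E ->
  measurable_fun setT g -> (forall t, 0 <= g t)%E ->
  (forall t, (forall i, tnth t i != 0) -> f t = g t) -> lebint f = lebint g.
Proof.
move=> mf f0 mg g0 fg; apply/eqP; rewrite eq_le; apply/andP.
by split; apply: lebint_le_nz => // t /fg ->.
Qed.

Lemma integral_pos_gt0 (x0 : R) (f : R -> \bar R) : measurable_fun setT f ->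
  (forall x, 0 <= f x)%E -> (forall x : R, x0 < x -> (0 < f x)%E) -> (0 < \int[mu]_x f x)%E.
Proof.
move=> mf f0 fp; rewrite lt0e integral_ge0 ?andbT//; apply/eqP => I0.
have : (\int[mu]_x `|f x| = 0)%E by under eq_integral do rewrite gee0_abs//.
move/(ae_eq_integral_abs mu measurableT mf) => [N [mN N0 sub]].
have : (mu `]x0, (x0 + 1)%R[ <= mu N)%E.
  apply: le_measure; rewrite ?inE// => x /=; rewrite in_itv/= => /andP[xx0 _].
  by apply: sub => /= /(_ I) /= fx0; have := fp _ xx0; rewrite fx0 ltxx.
rewrite N0 lebesgue_measure_itv/= lte_fin ltrDl ltr01 -EFinB lee_fin.
by rewrite addrAC subrr add0r ler10.
Qed.

Lemma lebint_gt0 k (f : k.-tuple R -> \bar R) :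
  measurable_fun setT f -> (forall t, 0 <= f t)%E ->
  (forall t, (forall i, 0 < tnth t i) -> (0 < f t)%E) -> (0 < lebint f)%E.
Proof.
elim: k f => [|k IH] f mf f0 fp /=; first by apply: fp => -[].
apply: (@integral_pos_gt0 0); first exact: measurable_lebint_cons.
  by move=> x; exact: lebint_ge0.
move=> x x0; apply: IH; [exact: measurable_cons_pair|by []|].
move=> t t0; apply: fp => i; case: (unliftP ord0 i) => [j ->|->//].
by rewrite tnthS.
Qed.

End Lebint.

(** * The Gamma integral *)

Section Gamma.
Variable R : realType.
Notation mu := (@lebesgue_measure R).

Lemma continuous_powR (a x : R) : 0 < x -> {for x, continuous (@powR R ^~ a)}.
Proof.
move=> x0; apply: differentiable_continuous; apply/derivable1_diffP.
by apply: derivable_powR; rewrite in_itv/= x0.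
Qed.

(** [x ^ s / s] is a primitive away from 0. The fundamental theorem is applied on closed intervals
    inside the positive axis, and these exhaust []0, 1]]. *)
Lemma integral_powR_near0 (s : R) : 0 < s ->
  (\int[mu]_(x in `]0%R, 1%R]) (x `^ (s - 1))%:E <= (s^-1)%:E)%E.
Proof.
move=> s0.
have mf (A : set R) : measurable_fun A (fun x : R => (x `^ (s - 1))%:E).
  by apply: measurable_funTS; mfun.
have H (e : R) : 0 < e -> e < 1 ->
    (\int[mu]_(x in `[e, 1%R]) (x `^ (s - 1))%:E <= (s^-1)%:E)%E.
  move=> e0 e1.
  have pos x : x \in `]e, 1[ -> 0 < x.
    by rewrite in_itv/= => /andP[ex _]; exact: lt_trans ex.
  rewrite (@continuous_FTC2 _ _ (fun x => s^-1 * x `^ s))//.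
  - by rewrite powR1 mulr1 -EFinB lee_fin lerBlDr lerDl mulr_ge0 ?powR_ge0 ?invr_ge0 ?ltW.
  - apply: continuous_in_subspaceT => x; rewrite inE/= in_itv/= => /andP[ex _].
    by apply: continuous_powR; exact: lt_le_trans ex.
  - have c (x : R) : 0 < x -> {for x, continuous (fun x : R => s^-1 * x `^ s)}.
      by move=> x0; apply: continuousM; [exact: cst_continuous|exact: continuous_powR].
    split.
    + move=> x /pos x0; apply: derivableM => //; apply: derivable_powR.
      by rewrite in_itv/= x0.
    + by apply: cvg_at_right_filter; apply: c.
    + by apply: cvg_at_left_filter; apply: c.
  - move=> x /pos x0.
    rewrite (@derive1Ml _ (fun x => x `^ s)); last first.
      by apply: derivable_powR; rewrite in_itv/= x0.
    by rewrite powR_derive1 ?in_itv/= ?x0// mulrA mulVf ?mul1r// gt_eqF.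
(* The shift by 2 makes the left end strictly less than 1 for every [i]. *)
pose F (i : nat) := `[(i.+2%:R : R)^-1, 1]%classic.
have i2 i : 1 < i.+2%:R :> R by rewrite ltr1n.
have iF : \bigcup_i F i = `]0%R, 1%R]%classic.
  apply/seteqP; split => x /=.
    move=> [i _]; rewrite /F/= !in_itv/= => /andP[ix ->]; rewrite andbT.
    by apply: lt_le_trans ix; rewrite invr_gt0.
  rewrite in_itv/= => /andP[x0 x1]; exists (Num.truncn x^-1) => //.
  rewrite /F/= in_itv/= x1 andbT invf_ple ?posrE//.
  by rewrite (le_trans (ltW (truncnS_gt _)))// ler_nat.
have cvgF : (\int[mu]_(x in F i) (x `^ (s - 1))%:E @[i --> \oo] -->
    \int[mu]_(x in `]0%R, 1%R]) (x `^ (s - 1))%:E)%E.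
  rewrite -iF; apply: ge0_nondecreasing_set_cvg_integral => //.
  - apply/nondecreasing_seqP => n; rewrite subsetEset => x /=.
    rewrite /F/= !in_itv/= => /andP[nx ->]; rewrite andbT.
    by apply: le_trans nx; rewrite lef_pV2 ?posrE// ler_nat.
  - by move=> i; exact: measurable_itv.
  - by move=> i; exact: mf.
  - by move=> i x Fx; rewrite lee_fin powR_ge0.
rewrite -(cvg_lim _ cvgF)//; apply: lime_le; first by apply/cvg_ex; eexists; exact: cvgF.
near=> n; apply: H; first by rewrite invr_gt0.
by rewrite invf_lt1.
Unshelve. end_near. Qed.

Lemma gamma_un_ge0 (al be x : R) : 0 <= gamma_un al be x.
Proof. by rewrite /gamma_un; case: ifP => // _; rewrite mulr_ge0 ?powR_ge0 ?expR_ge0. Qed.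

Lemma measurable_gamma_un d (T : measurableType d) (al : R) (f g : T -> R) :
  measurable_fun setT f -> measurable_fun setT g ->
  measurable_fun setT (fun x => gamma_un al (f x) (g x)).
Proof. by move=> mf mg; rewrite /gamma_un; mfun. Qed.

(** A single term of the exponential series, of degree above [|a|], dominates the power. The rate
    1/2 leaves another [expR (- x / 2)] for integrability. *)
Lemma powR_expR_bound (a : R) : exists2 C : R, 0 <= C &
  forall x, 1 <= x -> x `^ a <= C * expR (x / 2).
Proof.
pose n := Num.truncn `|a|; exists (2 ^+ n.+1 * n.+1`!%:R).
  by rewrite mulr_ge0 ?exprn_ge0.
move=> x x1; have x0 : 0 <= x by exact: le_trans x1.
apply: (@le_trans _ _ (x `^ n.+1%:R)).
  apply: ler_powR => //; apply: le_trans (ler_norm a) _.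
  exact: ltW (truncnS_gt _).
rewrite powR_mulrn//.
have x20 : 0 <= x / 2 by rewrite divr_ge0.
have := expR_ge1Dxn n x20; rewrite -lerBrDl => H.
have {}H : (x / 2) ^+ n.+1 / n.+1`!%:R <= expR (x / 2).
  by apply: le_trans H _; rewrite gerBl.
have f0 : n.+1`!%:R != 0 :> R by rewrite pnatr_eq0 -lt0n fact_gt0.
have -> : x ^+ n.+1 = 2 ^+ n.+1 * n.+1`!%:R * ((x / 2) ^+ n.+1 / n.+1`!%:R).
  by rewrite expr_div_n; field; rewrite f0 expf_neq0.
by apply: ler_wpM2l => //; rewrite mulr_ge0 ?exprn_ge0.
Qed.

Lemma gamma_un_lty (s : R) : 0 < s -> (\int[mu]_x (gamma_un s 1 x)%:E < +oo)%E.
Proof.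
move=> s0; have [C C0 HC] := powR_expR_bound (s - 1).
pose h1 : R -> \bar R := (fun x : R => (x `^ (s - 1))%:E) \_ `]0%R, 1%R].
have mh1 : measurable_fun setT h1.
  by apply/measurable_restrict => //; apply: measurable_funTS; mfun.
have h10 x : (0 <= h1 x)%E by apply: erestrict_ge0 => y _; rewrite lee_fin powR_ge0.
pose h2 : R -> \bar R := fun x => ((2 * C) * exponential_pdf 2^-1 x)%:E.
have mh2 : measurable_fun setT h2.
  apply: mfun_EFin; apply: mfun_M; first exact: measurable_cst.
  exact: measurable_exponential_pdf.
have e0 x : 0 <= exponential_pdf 2^-1 x :> R by rewrite exponential_pdf_ge0.
have h20 x : (0 <= h2 x)%E by rewrite lee_fin !mulr_ge0.
apply: (@le_lt_trans _ _ (\int[mu]_x (h1 x + h2 x))%E).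
  apply: ge0_integral_mono => x; first by rewrite lee_fin gamma_un_ge0.
  rewrite /gamma_un; case: ifPn => [x0|_]; last by rewrite adde_ge0.
  rewrite mul1r; have [x1|x1] := lerP x 1.
    rewrite -[leLHS]adde0 leeD//.
    rewrite /h1 patchE mem_set/= ?in_itv/= ?x0// lee_fin ler_piMr ?powR_ge0//.
    by rewrite expR_le1 oppr_le0 ltW.
  have E : 2 * C * exponential_pdf 2^-1 x = C * expR (- 2^-1 * x).
    by rewrite exponential_pdfE ?ltW//; field.
  rewrite -[leLHS]add0e leeD// lee_fin E.
  apply: le_trans (ler_wpM2r (expR_ge0 _) (HC _ (ltW x1))) _.
  by rewrite -mulrA -expRD; apply: ler_wpM2l => //; rewrite ler_expR; lra.
rewrite ge0_integralD// lte_add_pinfty//.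
  rewrite /h1 -integral_mkcond; apply: le_lt_trans (integral_powR_near0 s0) _.
  exact: ltry.
under eq_integral do rewrite /h2 EFinM.
rewrite ge0_integralZl_EFin//.
- by rewrite integral_exponential_pdf// mule1 ltry.
- by move=> x _; rewrite lee_fin.
- by apply: mfun_EFin; exact: measurable_exponential_pdf.
- by rewrite mulr_ge0.
Qed.

(** Euler's Gamma function on [s > 0]. *)
Definition Gam (s : R) : R := fine (\int[mu]_x (gamma_un s 1 x)%:E)%E.

Lemma GamE (s : R) : 0 < s -> (\int[mu]_x (gamma_un s 1 x)%:E = (Gam s)%:E)%E.
Proof.
move=> s0; rewrite fineK// ge0_fin_numE ?gamma_un_lty//.
by apply: integral_ge0 => x _; rewrite lee_fin gamma_un_ge0.
Qed.

Lemma Gam_gt0 (s : R) : 0 < s -> 0 < Gam s.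
Proof.
move=> s0; rewrite -lte_fin -GamE//; apply: (@integral_pos_gt0 _ 0).
- by apply: mfun_EFin; apply: measurable_gamma_un; mfun.
- by move=> x; rewrite lee_fin gamma_un_ge0.
- by move=> x x0; rewrite lte_fin /gamma_un x0 mulr_gt0 ?powR_gt0 ?expR_gt0.
Qed.

Opaque Gam.

Lemma integral_gamma_un (s b : R) : 0 < s -> 0 < b ->
  (\int[mu]_x (gamma_un s b x)%:E = (Gam s * b `^ (- s))%:E)%E.
Proof.
move=> s0 b0.
transitivity (\int[mu]_x ((b `^ (1 - s))%:E * (gamma_un s 1 (b * x))%:E))%E.
  apply: eq_integral => x _; rewrite -EFinM; congr _%:E.
  rewrite /gamma_un pmulr_rgt0//; case: ifP => x0; last by rewrite mulr0.
  rewrite powRM ?ltW// mul1r !mulrA -powRD ?(gt_eqF b0) ?implybT//.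
  by rewrite addrA subrK subrr powRr0 mul1r.
have mg : measurable_fun setT (gamma_un s 1).
  by apply: measurable_gamma_un; mfun.
rewrite ge0_integralZl_EFin ?powR_ge0//; last 2 first.
- by move=> x _; rewrite lee_fin gamma_un_ge0.
- by apply: mfun_EFin; apply: measurable_gamma_un; mfun.
rewrite (@integral_scale _ b (fun x => (gamma_un s 1 x)%:E))//; last 2 first.
- by apply: mfun_EFin.
- by move=> x; rewrite lee_fin gamma_un_ge0.
rewrite GamE// -!EFinM mulrA mulrC; congr (_ * _)%:E.
rewrite -powR_inv1 ?ltW// -powRD ?(gt_eqF b0) ?implybT//.
by congr powR; ring.
Qed.

(** At [s = sqrt (v / u)] the two terms on the right are equal and the hypothesis reads [s w < v];
    squaring and dividing by [s ^+ 2 = v / u] gives the claim. *)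
Lemma discr_lt (u v w : R) : 0 < u -> 0 < v -> 0 <= w ->
  (forall s, 0 < s -> 2 * s * w < s ^+ 2 * u + v) -> w ^+ 2 < u * v.
Proof.
move=> u0 v0 w0; pose s := Num.sqrt (v / u).
have s0 : 0 < s by rewrite sqrtr_gt0 divr_gt0.
have s2 : s ^+ 2 * u = v by rewrite sqr_sqrtr ?divr_ge0 ?ltW// divfK// gt_eqF.
move=> /(_ s s0); rewrite s2 => E.
have H : s * w < v by lra.
have {}H : (s * w) ^+ 2 < v ^+ 2.
  rewrite ltr_pXn2r// nnegrE; last by rewrite ltW.
  by rewrite mulr_ge0// ltW.
rewrite exprMn in H.
have s2p : 0 < s ^+ 2 by rewrite exprn_gt0.
rewrite -(ltr_pM2l s2p); apply: lt_le_trans H _.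
by rewrite mulrA s2 expr2.
Qed.

(* Strict log-convexity at the midpoint: the quadratic
   [s |-> \int (s t^((A-1)/2) - t^((B-1)/2))^2 e^-t dt] has no positive root. *)
Lemma Gam_midpoint (A B : R) : 0 < A -> A < B ->
  Gam ((A + B) / 2) ^+ 2 < Gam A * Gam B.
Proof.
move=> A0 AB; have B0 : 0 < B by exact: lt_trans AB.
set M := (A + B) / 2; have M0 : 0 < M by rewrite /M; lra.
apply: discr_lt; [exact: Gam_gt0|exact: Gam_gt0|by apply: ltW; exact: Gam_gt0|].
move=> s s0.
pose D (x : R) : R := if 0 < x then (s * x `^ ((A - 1) / 2) - x `^ ((B - 1) / 2)) ^+ 2 * expR (- (1 * x)) else 0.
have mD : measurable_fun setT D by rewrite /D; mfun.
have D0 x : 0 <= D x by rewrite /D; case: ifP => // _; rewrite mulr_ge0 ?sqr_ge0 ?expR_ge0.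
have mg (a : R) : measurable_fun setT (fun x : R => gamma_un a 1 x).
  by apply: measurable_gamma_un; mfun.
have I : (0 < \int[mu]_x (D x)%:E)%E.
  (* This threshold is the only positive zero of the integrand, so [D] is positive beyond it. This
     is where [A < B] makes the inequality strict. *)
  apply: (@integral_pos_gt0 _ (s `^ ((B - A) / 2)^-1)).
  - exact: mfun_EFin.
  - by move=> x; rewrite lee_fin.
  - move=> x sx; have x0 : 0 < x by apply: lt_trans sx; rewrite powR_gt0.
    rewrite lte_fin /D x0 mulr_gt0 ?expR_gt0// exprn_even_gt0//= subr_eq0.
    apply: contraTN sx => /eqP E.
    have -> : s = x `^ ((B - A) / 2).
      apply: (@mulIf _ (x `^ ((A - 1) / 2))); first by rewrite gt_eqF// powR_gt0.
      rewrite E -powRD ?(gt_eqF x0) ?implybT//; congr powR; lra.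
    by rewrite -powRrM mulfV ?powRr1 ?ltxx ?ltW// gt_eqF//; lra.
have E : (\int[mu]_x ((s ^+ 2 * gamma_un A 1 x)%:E + (gamma_un B 1 x)%:E) =
    \int[mu]_x ((2 * s * gamma_un M 1 x)%:E + (D x)%:E))%E.
  apply: eq_integral => x _; rewrite -!EFinD; congr _%:E.
  rewrite /gamma_un /D; case: ifP => x0; last by rewrite !mulr0 !addr0.
  have p2 t : x `^ (t - 1) = x `^ ((t - 1) / 2) ^+ 2.
    by rewrite expr2 -powRD ?(gt_eqF x0) ?implybT//; congr powR; lra.
  have -> : x `^ (M - 1) = x `^ ((A - 1) / 2) * x `^ ((B - 1) / 2).
    by rewrite -powRD ?(gt_eqF x0) ?implybT//; congr powR; rewrite /M; lra.
  by rewrite !p2; ring.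
have s00 : 0 <= s by exact: ltW.
have f0 (c a x : R) : 0 <= c -> (0 <= (c * gamma_un a 1 x)%:E)%E.
  by move=> c0; rewrite lee_fin mulr_ge0 ?gamma_un_ge0.
have mf (c a : R) : measurable_fun setT (fun x : R => (c * gamma_un a 1 x)%:E).
  by apply: mfun_EFin; apply: mfun_M => //; mfun.
have mf1 (a : R) : measurable_fun setT (fun x : R => (gamma_un a 1 x)%:E).
  exact: mfun_EFin.
have mf2 : measurable_fun setT (fun x : R => (D x)%:E) by exact: mfun_EFin.
have s200 : 0 <= s ^+ 2 by rewrite sqr_ge0.
have s220 : 0 <= 2 * s by rewrite mulr_ge0.
move: E; rewrite !ge0_integralD//; try by [move=> x _; exact: f0|
  move=> x _; rewrite lee_fin gamma_un_ge0|exact: mf|exact: mf1|move=> x _; rewrite lee_fin].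
under eq_integral do rewrite EFinM.
under [X in _ = (X + _)%E -> _]eq_integral do rewrite EFinM.
rewrite !ge0_integralZl_EFin//; try by [move=> x _; rewrite lee_fin gamma_un_ge0|exact: mf1].
rewrite !GamE// -!EFinM => E.
have : ((2 * s * Gam M)%:E < (2 * s * Gam M)%:E + \int[mu]_x (D x)%:E)%E.
  by rewrite lteDl.
by rewrite -E -EFinD lte_fin.
Qed.

Lemma integral_gauss_sigma (s m : R) : 0 < s ->
  (\int[mu]_x (Num.sqrt s / Num.sqrt (2 * pi) * expR (- (s * (x - m) ^+ 2) / 2))%:E = 1)%E.
Proof.
move=> s0; rewrite -(@integral_normal_pdf R m (Num.sqrt s)^-1).
have ss0 : 0 < Num.sqrt s by rewrite sqrtr_gt0.
apply: eq_integral => x _; congr _%:E.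
rewrite normal_pdfE ?gt_eqF ?invr_gt0//; congr (_ * expR _).
  rewrite /normal_peak -mulrnAr [in RHS]sqrtrM ?sqr_ge0// sqrtr_sqr gtr0_norm ?invr_gt0//.
  by rewrite invfM invrK mulr_natl.
rewrite exprVn sqr_sqrtr ?ltW// -mulr_natr; field.
by rewrite gt_eqF.
Qed.

(** For [|x| <= 1] the Gaussian factor is at most 1 and the power is integrable because [g < 1]; for
    [|x| > 1] the power is at most 1, so the weight is at most 2. The power is handled on the
    positive axis and reflected. *)
Lemma integral_powN_gauss_lty (g c : R) : 0 <= g -> g < 1 -> 0 < c ->
  (\int[mu]_x ((1 + `|x| `^ (- g)) * expR (- (c * x ^+ 2)))%:E < +oo)%E.
Proof.
move=> g0 g1 c0.
pose h1 : R -> \bar R := (fun x : R => (x `^ ((1 - g) - 1))%:E) \_ `]0%R, 1%R].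
have mh1 : measurable_fun setT h1.
  by apply/measurable_restrict => //; apply: measurable_funTS; mfun.
have h10 x : (0 <= h1 x)%E by apply: erestrict_ge0 => y _; rewrite lee_fin powR_ge0.
have h1N x : x <= 0 -> h1 x = 0%E.
  move=> x0; rewrite /h1 patchE memNset//= in_itv/=; apply/negP.
  by rewrite negb_and -leNgt x0.
have mh1N : measurable_fun setT (fun x : R => h1 (- x)).
  by apply: (measurableT_comp mh1); mfun.
have Ih1 : (\int[mu]_x h1 x < +oo)%E.
  rewrite /h1 -integral_mkcond; apply: le_lt_trans (integral_powR_near0 _) _.
    by rewrite subr_gt0.
  exact: ltry.
pose e x := expR (- (c * x ^+ 2)) : R.
have me : measurable_fun setT e by rewrite /e; mfun.
have Ie : (\int[mu]_x (e x)%:E < +oo)%E.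
  have c20 : 0 < 2 * c by rewrite mulr_gt0.
  pose K := Num.sqrt (2 * c) / Num.sqrt (2 * pi) : R.
  have K0 : 0 < K by rewrite divr_gt0 ?sqrtr_gt0 ?mulr_gt0 ?pi_gt0.
  have -> : (\int[mu]_x (e x)%:E = \int[mu]_x
      ((K^-1)%:E * (K * expR (- ((2 * c) * (x - 0) ^+ 2) / 2))%:E))%E.
    apply: eq_integral => x _; rewrite -EFinM; congr _%:E.
    by rewrite mulKf ?gt_eqF// /e; congr expR; field.
  rewrite ge0_integralZl_EFin ?invr_ge0 ?(ltW K0)//.
  - by rewrite integral_gauss_sigma// mule1 ltry.
  - by move=> x _; rewrite lee_fin mulr_ge0 ?expR_ge0 ?(ltW K0).
  - by mfun.
apply: (@le_lt_trans _ _ (\int[mu]_x ((h1 x + h1 (- x)%R) + (2 * e x)%:E))%E).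
  apply: ge0_integral_mono => x.
    by rewrite lee_fin mulr_ge0 ?expR_ge0// addr_ge0 ?powR_ge0.
  have e1 : e x <= 1 by rewrite expR_le1 oppr_le0 mulr_ge0 ?sqr_ge0 ?ltW.
  have e0 : 0 <= e x by rewrite expR_ge0.
  rewrite -/(e x); have [x1|x1] := lerP `|x| 1; last first.
    rewrite -[leLHS]add0e leeD ?adde_ge0// lee_fin ler_wpM2r//.
    have -> : (2 : R) = 1 + 1 by ring.
    have x0 : 0 < `|x| by apply: lt_trans x1.
    rewrite lerD2l powRN invf_le1 ?powR_gt0//.
    have := @ge0_ler_powR R g g0 1 `|x|.
    by rewrite powR1; apply; rewrite ?nnegrE ?ltW.
  have E (y : R) : 0 < y -> y <= 1 -> h1 y = (y `^ (- g))%:E.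
    move=> y0 y1; rewrite /h1 patchE mem_set/= ?in_itv/= ?y0//; congr (_ `^ _)%:E; ring.
  have le1 (y : R) : 0 <= y -> (1 + y) * e x <= y + 2 * e x by nra.
  have key : x != 0 -> (h1 x + h1 (- x)%R = (`|x| `^ (- g))%:E)%E.
    move=> xn0; have [x0|x0] := ltP 0 x.
      rewrite gtr0_norm// in x1 *; rewrite (E x)// h1N ?adde0//.
      by rewrite oppr_le0 ltW.
    have {}x0 : x < 0 by rewrite lt_neqAle xn0.
    rewrite ltr0_norm// in x1 *; rewrite h1N ?(ltW x0)// add0e E//.
    by rewrite oppr_gt0.
  have [x0|x0] := eqVneq x 0; last first.
    by rewrite key// -EFinD lee_fin; apply: le1; rewrite powR_ge0.
  (* At [x = 0] the power equals 1 if [g = 0] and 0 otherwise, so the weight is at most 2 and the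
     Gaussian term covers it. *)
  - rewrite x0 oppr0 !h1N// !add0e normr0 lee_fin ler_wpM2r ?expR_ge0//.
    have [->|gn0] := eqVneq g 0; first by rewrite oppr0 powRr0.
    by rewrite powR0 ?oppr_eq0//; lra.
rewrite ge0_integralD//; first last.
- by apply: mfun_EFin; apply: mfun_M => //; mfun.
- by move=> x _; rewrite lee_fin mulr_ge0 ?expR_ge0.
- exact: emeasurable_funD.
- by move=> x _; rewrite adde_ge0.
rewrite ge0_integralD// integral_opp//.
apply: lte_add_pinfty; first exact: lte_add_pinfty.
under eq_integral do rewrite EFinM.
rewrite ge0_integralZl_EFin//.
- by rewrite lte_mul_pinfty.
- by move=> x _; rewrite lee_fin expR_ge0.
- by mfun.
Qed.

End Gamma.

(** * Positive definite matrices and Gaussian densities *)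

Section PosDef.
Variable R : realType.

Definition qf k (S : 'M[R]_k) (x : 'cV[R]_k) : R := (x^T *m S *m x) 0 0.

Definition posdef k (S : 'M[R]_k) :=
  S^T = S /\ forall x : 'cV[R]_k, x != 0 -> 0 < qf S x.

Lemma qf_ge0 k (S : 'M[R]_k) x : posdef S -> 0 <= qf S x.
Proof.
move=> [_ Sp]; have [->|/Sp/ltW//] := eqVneq x 0.
by rewrite /qf mulmx0 mxE.
Qed.

Lemma posdef_unit k (S : 'M[R]_k) : posdef S -> S \in unitmx.
Proof.
move=> [_ Sp]; rewrite -row_free_unit -kermx_eq0; apply/eqP/row_matrixP => i.
rewrite row0; apply/eqP; apply/negP => /negP ri.
have := Sp (row i (kermx S))^T; rewrite trmx_eq0 => /(_ ri).
by rewrite /qf trmxK -row_mul mulmx_ker row0 mul0mx mxE ltxx.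
Qed.

Lemma bilin_sym k (S : 'M[R]_k) (x y : 'cV[R]_k) : S^T = S ->
  (x^T *m S *m y) 0 0 = (y^T *m S *m x) 0 0.
Proof.
have e (M : 'M[R]_1) : M 0 0 = M^T 0 0 by rewrite mxE.
by move=> SE; rewrite e !trmx_mul trmxK SE mulmxA.
Qed.

Lemma qfD k (S : 'M[R]_k) (x y : 'cV[R]_k) : S^T = S ->
  qf S (x + y) = qf S x + 2 * (x^T *m S *m y) 0 0 + qf S y.
Proof.
move=> SE; have e (M N : 'M[R]_1) : (M + N) 0 0 = M 0 0 + N 0 0 by rewrite mxE.
rewrite /qf [(x + y)^T]linearD/= !mulmxDl !mulmxDr !e (bilin_sym y x SE).
by ring.
Qed.

Lemma qfZ k (S : 'M[R]_k) (a : R) (x : 'cV[R]_k) : qf S (a *: x) = a ^+ 2 * qf S x.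
Proof.
rewrite /qf [(a *: x)^T]linearZ/= -!scalemxAl -scalemxAr scalerA.
by rewrite [LHS]mxE expr2.
Qed.

Lemma qfZS k (S : 'M[R]_k) (a : R) (x : 'cV[R]_k) : qf (a *: S) x = a * qf S x.
Proof. by rewrite /qf -scalemxAr -scalemxAl mxE. Qed.

Lemma qfDS k (S S' : 'M[R]_k) (x : 'cV[R]_k) : qf (S + S') x = qf S x + qf S' x.
Proof. by rewrite /qf mulmxDr mulmxDl mxE. Qed.

Lemma qfN k (S : 'M[R]_k) (x : 'cV[R]_k) : qf S (- x) = qf S x.
Proof. by rewrite /qf [(- x)^T]linearN/= mulNmx mulNmx mulmxN opprK. Qed.

Lemma complete_square k (S : 'M[R]_k) (x h : 'cV[R]_k) : posdef S ->
  qf S x - 2 * (x^T *m h) 0 0 = qf S (x - invmx S *m h) - qf S (invmx S *m h).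
Proof.
move=> SP; have SU := posdef_unit SP; have [SE _] := SP.
rewrite qfD// qfN mulmxN !mulmxA mulmxK//.
have -> (M : 'M[R]_1) : (- M) 0 0 = - M 0 0 by rewrite mxE.
by ring.
Qed.

Lemma posdefZ k (S : 'M[R]_k) (a : R) : 0 < a -> posdef S -> posdef (a *: S).
Proof.
move=> a0 [SE Sp]; split; first by rewrite linearZ/= SE.
by move=> x x0; rewrite qfZS mulr_gt0// Sp.
Qed.

Section Block.
Variables (k : nat) (s : R) (B : 'cV[R]_k) (S2 : 'M[R]_k).
Let S : 'M[R]_(1 + k) := block_mx s%:M B^T B S2.
Hypothesis SP : posdef S.
Let g := invmx S2 *m B.
Let sig := s - (B^T *m g) 0 0.

Let qfS (a : R) (u : 'cV[R]_k) :
  qf S (col_mx a%:M u) = s * a ^+ 2 + 2 * a * (u^T *m B) 0 0 + qf S2 u.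
Proof.
have e (M N : 'M[R]_1) : (M + N) 0 0 = M 0 0 + N 0 0 by rewrite mxE.
have e1 (M : 'M[R]_1) : M 0 0 = M^T 0 0 by rewrite mxE.
have e2 (c : R) (M : 'M[R]_1) : (c *: M) 0 0 = c * M 0 0 by rewrite mxE.
rewrite /qf /S tr_col_mx tr_scalar_mx mul_row_block mul_row_col.
rewrite !mulmxDl !e !mul_scalar_mx !mul_mx_scalar -scalemxAl !e2.
rewrite (e1 (B^T *m u)) trmx_mul trmxK.
rewrite mxE eqxx mulr1n; ring.
Qed.

Let S2P : posdef S2.
Proof.
have [SE Sp] := SP; split.
  by move: SE; rewrite /S tr_block_mx => /eq_block_mx[].
move=> u u0; have := Sp (col_mx (0 : R)%:M u).
rewrite qfS mulr0 mul0r expr0n/= mulr0 !add0r; apply.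
by apply: contraNneq u0 => /eqP; rewrite col_mx_eq0 => /andP[].
Qed.

Let S2g : S2 *m g = B. Proof. by rewrite mulmxA mulmxV ?mul1mx// posdef_unit. Qed.

(** Completing the square in the trailing block: since [S2 *m g = B], the cross term is that of [u]
    with [a *: g]. *)
Let qfSE (a : R) (u : 'cV[R]_k) :
  qf S (col_mx a%:M u) = sig * a ^+ 2 + qf S2 (u + a *: g).
Proof.
have e2 (c : R) (M : 'M[R]_1) : (c *: M) 0 0 = c * M 0 0 by rewrite mxE.
have [SE _] := S2P.
rewrite qfS qfD// qfZ -scalemxAr e2 -mulmxA S2g /sig.
have -> : qf S2 g = (B^T *m g) 0 0.
  by rewrite /qf -{1}SE -trmx_mul S2g.
by ring.
Qed.

Let sig_gt0 : 0 < sig.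
Proof.
have [_ Sp] := SP; have := Sp (col_mx (1 : R)%:M (- g)).
rewrite qfSE scale1r addNr expr1n mulr1.
have -> : qf S2 0 = 0 by rewrite /qf mulmx0 mxE.
rewrite addr0; apply; apply/negP; rewrite col_mx_eq0 => /andP[/eqP/matrixP/(_ 0 0)].
by rewrite !mxE/= => /eqP; rewrite oner_eq0.
Qed.

Let detS : \det S = sig * \det S2.
Proof.
have gS : g^T *m S2 = B^T by rewrite -[LHS]trmxK trmx_mul trmxK; have [-> _] := S2P; rewrite S2g.
(* The left factor is unitriangular, so the determinant is the Schur complement [sig] times
   [\det S2]. *)
have -> : S = block_mx 1%:M g^T 0 1%:M *m block_mx (sig%:M : 'M[R]_1) 0 B S2.
  rewrite mulmx_block !mul1mx !mul0mx !add0r gS /S; congr block_mx.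
  have em (c : R) : (c%:M : 'M[R]_1) 0 0 = c by rewrite mxE eqxx mulr1n.
  have sg : (g^T *m B) 0 0 = (B^T *m g) 0 0.
    by rewrite !mxE; apply: eq_bigr => l _; rewrite !mxE mulrC.
  by apply/matrixP => i j; rewrite !ord1 [RHS]mxE sg !em subrK.
by rewrite det_mulmx det_ublock !det1 !mul1r det_lblock det_scalar1.
Qed.

Lemma posdef_block : [/\ posdef S2, 0 < sig, \det S = sig * \det S2 &
  forall (a : R) (u : 'cV[R]_k),
    qf S (col_mx a%:M u) = sig * a ^+ 2 + qf S2 (u + a *: g)].
Proof. by split. Qed.

End Block.

(* The Schur complement of the trailing block; splitting off one coordinate at a
   time matches the iterated integral [lebint]. *)
Lemma posdef_split k (S : 'M[R]_(1 + k)) : posdef S -> exists (S2 : 'M[R]_k) (sig : R) (g : 'cV[R]_k),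
  [/\ posdef S2, 0 < sig, \det S = sig * \det S2 &
  forall (a : R) (u : 'cV[R]_k),
    qf S (col_mx a%:M u) = sig * a ^+ 2 + qf S2 (u + a *: g)].
Proof.
move=> SP; have [SE _] := SP.
have E : S = block_mx (S 0 0)%:M (dlsubmx S)^T (dlsubmx S) (drsubmx S).
  rewrite -[LHS]submxK; congr block_mx.
    apply/matrixP => i j; rewrite !ord1 !mxE eqxx mulr1n.
    by congr (S _ _); apply/val_inj.
  by rewrite -{1}SE; apply/matrixP => i j; rewrite !mxE.
rewrite E in SP *; have := posdef_block SP.
by move=> H; do 3 eexists; exact: H.
Qed.

Lemma posdef_det_gt0 k (S : 'M[R]_k) : posdef S -> 0 < \det S.
Proof.
elim: k S => [|k IH] S SP; first by rewrite det_mx00.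
have [S2 [sig [g [S2P sg -> _]]]] := @posdef_split k S SP.
by rewrite mulr_gt0// IH.
Qed.

Lemma mvn_pdfE k (S : 'M[R]_k) (m x : 'cV[R]_k) :
  mvn_pdf S m x = Num.sqrt (\det S) / Num.sqrt (2 * pi) ^+ k * expR (- qf S (x - m) / 2).
Proof. by []. Qed.

Lemma mvn_pdf_ge0 k (S : 'M[R]_k) (m x : 'cV[R]_k) : 0 <= mvn_pdf S m x.
Proof. by rewrite mulr_ge0 ?expR_ge0// divr_ge0 ?sqrtr_ge0// exprn_ge0 ?sqrtr_ge0. Qed.

Lemma mvn_pdf_gt0 k (S : 'M[R]_k) (m x : 'cV[R]_k) : posdef S -> 0 < mvn_pdf S m x.
Proof.
move=> SP; rewrite mulr_gt0 ?expR_gt0// divr_gt0 ?sqrtr_gt0 ?posdef_det_gt0//.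
by rewrite exprn_gt0// sqrtr_gt0 mulr_gt0 ?pi_gt0.
Qed.

Definition mmx d (T : measurableType d) k l (F : T -> 'M[R]_(k, l)) :=
  forall i j, measurable_fun [set: T] (fun x => F x i j).

Section MeasurableMatrix.
Context d (T : measurableType d).

Lemma mmx_cst k l (M : 'M[R]_(k, l)) : mmx (fun _ : T => M).
Proof. by move=> i j; mfun. Qed.

Lemma mmx_mul k l h (F : T -> 'M[R]_(k, l)) (G : T -> 'M[R]_(l, h)) :
  mmx F -> mmx G -> mmx (fun x => F x *m G x).
Proof.
move=> mF mG i j.
apply: (mfun_eq (f := fun x => \sum_l F x i l * G x l j)) => [x|]; first by rewrite mxE.
by mfun; [exact: mF|exact: mG].
Qed.

Lemma mmx_D k l (F G : T -> 'M[R]_(k, l)) : mmx F -> mmx G -> mmx (fun x => F x + G x).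
Proof.
move=> mF mG i j.
apply: (mfun_eq (f := fun x => F x i j + G x i j)) => [x|]; first by rewrite mxE.
by mfun; [exact: mF|exact: mG].
Qed.

Lemma mmx_N k l (F : T -> 'M[R]_(k, l)) : mmx F -> mmx (fun x => - F x).
Proof.
move=> mF i j; apply: (mfun_eq (f := fun x => - F x i j)) => [x|]; first by rewrite mxE.
by mfun; exact: mF.
Qed.

Lemma mmx_tr k l (F : T -> 'M[R]_(k, l)) : mmx F -> mmx (fun x => (F x)^T).
Proof.
move=> mF i j; apply: (mfun_eq (f := fun x => F x j i)) => [x|]; first by rewrite mxE.
exact: mF.
Qed.

Lemma mmx_tcol k (f : T -> k.-tuple R) : measurable_fun setT f -> mmx (fun x => tcol (f x)).
Proof.
move=> mf i j; apply: (mfun_eq (f := fun x => tnth (f x) i)) => [x|]; first by rewrite mxE.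
by mfun.
Qed.

Lemma mmx_det k (F : T -> 'M[R]_k) : mmx F -> measurable_fun setT (fun x => \det (F x)).
Proof.
move=> mF; rewrite /determinant; mfun; exact: mF.
Qed.

Lemma mmx_inv k (F : T -> 'M[R]_k) : mmx F -> mmx (fun x => invmx (F x)).
Proof.
move=> mF i j.
(* [invmx] returns a singular matrix unchanged; elsewhere it is given by Cramer's rule, and both
   branches are polynomial up to division by the determinant. *)
rewrite (_ : (fun _ => _) = (fun x => if \det (F x) == 0 then F x i j else
    (\det (F x))^-1 * ((-1) ^+ (j + i) * \det (row' j (col' i (F x)))))).
  mfun; [|exact: mF|exact: mmx_det|].
    by apply: measurable_fun_eqr; mfun; exact: mmx_det.
  apply: mmx_det => a b.
  apply: (mfun_eq (f := fun x => F x (lift j a) (lift i b))) => [x|]; first by rewrite !mxE.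
  exact: mF.
apply/funext => x; rewrite /invmx unitmxE unitfE.
by case: eqP => //= _; rewrite !mxE.
Qed.

Lemma measurable_mvn_pdf k (S : T -> 'M[R]_k) (m x : T -> 'cV[R]_k) :
  mmx S -> mmx m -> mmx x -> measurable_fun setT (fun t => mvn_pdf (S t) (m t) (x t)).
Proof.
move=> mS mm mx; rewrite /mvn_pdf; mfun; first exact: mmx_det.
have mxm : mmx (fun t => x t - m t) by apply: mmx_D => //; exact: mmx_N.
by apply: mmx_mul => //; apply: mmx_mul => //; exact: mmx_tr.
Qed.

End MeasurableMatrix.

(** For a fixed first coordinate the rest is a Gaussian density of precision [S2], of integral 1 by
    induction; what is left is a one-dimensional density whose precision is the Schur complement. *)
Lemma lebint_mvn_pdf k (S : 'M[R]_k) (m : 'cV[R]_k) : posdef S ->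
  lebint (fun t : k.-tuple R => (mvn_pdf S m (tcol t))%:E) = 1%E.
Proof.
elim: k S m => [|k IH] S m SP.
  by rewrite /= mvn_pdfE det_mx00 sqrtr1 expr0 /qf mxE big_ord0 oppr0 mul0r expR0 mulr1 divr1.
have [S2 [sig [g [S2P sg dS qS]]]] := @posdef_split k S SP.
rewrite /= -(@integral_gauss_sigma R sig (m 0 0))//; apply: eq_integral => x _.
(* The conditional mean of the remaining coordinates given that the first one is [x]. *)
pose m2 : 'cV[R]_k := dsubmx (m : 'cV[R]_(1 + k)) - (x - m 0 0) *: g.
rewrite -[RHS]mule1 -(IH S2 m2 S2P) -lebintZl; first last.
- by move=> t; rewrite lee_fin mvn_pdf_ge0.
- by mfun; apply: measurable_mvn_pdf; [exact: mmx_cst|exact: mmx_cst|exact: mmx_tcol].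
- by rewrite lee_fin mulr_ge0 ?expR_ge0// divr_ge0 ?sqrtr_ge0.
apply: eq_lebint => t; rewrite -EFinM; congr _%:E.
rewrite !mvn_pdfE dS sqrtrM ?(ltW sg)// exprS.
have -> : tcol (cons_tuple x t) - m =
    col_mx (x - m 0 0)%:M (tcol t - dsubmx (m : 'cV[R]_(1 + k))).
  apply/matrixP => i j; rewrite ord1.
  case: (split_ordP (i : 'I_(1 + k))) => l ->.
    apply: etrans (esym (@col_mxEu _ 1 k 1 _ _ l 0)).
    rewrite !mxE ord1 eqxx mulr1n/=.
    by have -> : lshift k (0 : 'I_1) = ord0 :> 'I_(1 + k) by exact/val_inj.
  apply: etrans (esym (@col_mxEd _ 1 k 1 _ _ l 0)).
  rewrite !mxE; congr (_ - _).
  have -> : rshift 1 l = lift ord0 l by exact/val_inj.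
  by rewrite tnthS.
rewrite qS.
have -> : tcol t - dsubmx (m : 'cV[R]_(1 + k)) + (x - m 0 0) *: g = tcol t - m2.
  by rewrite /m2 opprB addrA addrAC.
have e (A B : R) : - (A + B) / 2 = - A / 2 + - B / 2 by ring.
rewrite e expRD.
set e1 := expR _; set e2 := expR _.
have : Num.sqrt (2 * pi) != 0 :> R by rewrite gt_eqF// sqrtr_gt0 mulr_gt0 ?pi_gt0.
set c := Num.sqrt (2 * pi) => c0.
by field; rewrite c0 expf_neq0.
Qed.

End PosDef.

(** * Second moments, determinants and Laplace transforms of Gaussian densities *)

Section GaussianBounds.
Variable R : realType.

Lemma measurable_mvn_pdf_x k (S : 'M[R]_k) (m : 'cV[R]_k) :
  measurable_fun setT (fun t : k.-tuple R => mvn_pdf S m (tcol t)).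
Proof. by apply: measurable_mvn_pdf; [exact: mmx_cst|exact: mmx_cst|apply: mmx_tcol; mfun]. Qed.

(** Half of the exponent absorbs the quadratic form, as [q <= 4 expR (q / 4)]; the other half is a
    Gaussian of precision [S / 2], whose normalization costs [sqrt (2 ^ k)]. What matters is that
    the bound depends neither on [S] nor on [m]. *)
Lemma lebint_mvn_pdf_qf k (S : 'M[R]_k) (m : 'cV[R]_k) : posdef S ->
  (lebint (fun t : k.-tuple R => (mvn_pdf S m (tcol t) * qf S (tcol t - m))%:E) <=
   (4 * Num.sqrt (2 ^+ k))%:E)%E.
Proof.
move=> SP.
have S2P : posdef (2^-1 *: S) by apply: posdefZ.
rewrite -[leRHS]mule1 -(lebint_mvn_pdf m S2P) -lebintZl; first last.
- by move=> t; rewrite lee_fin mvn_pdf_ge0.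
- by apply: mfun_EFin; exact: measurable_mvn_pdf_x.
- by rewrite lee_fin mulr_ge0 ?sqrtr_ge0.
apply: lebint_le => t.
  by rewrite lee_fin mulr_ge0 ?mvn_pdf_ge0 ?qf_ge0.
rewrite -EFinM lee_fin !mvn_pdfE qfZS detZ.
have d0 := posdef_det_gt0 SP.
set q := qf _ _; have q0 : 0 <= q by rewrite qf_ge0.
have -> : 4 * Num.sqrt (2 ^+ k) *
   (Num.sqrt (2^-1 ^+ k * \det S) / Num.sqrt (2 * pi) ^+ k * expR (- (2^-1 * q) / 2)) =
   Num.sqrt (\det S) / Num.sqrt (2 * pi) ^+ k * (4 * expR (- (2^-1 * q) / 2)).
  have s1 : Num.sqrt (2 ^+ k) * Num.sqrt (2^-1 ^+ k) = 1 :> R.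
    by rewrite -sqrtrM ?exprn_ge0// -exprMn mulfV// expr1n sqrtr1.
  rewrite [Num.sqrt (_ ^+ k * _)]sqrtrM ?exprn_ge0 ?invr_ge0//.
  set A := Num.sqrt (2 ^+ k) in s1 *; set B := Num.sqrt (2^-1 ^+ k) in s1 *.
  set D := Num.sqrt (\det S); set N := (Num.sqrt (2 * pi) ^+ k)^-1; set E := expR _.
  have e4 (x1 x2 x3 x4 x5 : R) : 4 * x1 * (x2 * x3 * x4 * x5) = (x1 * x2) * (x3 * x4 * (4 * x5)) by ring.
  by rewrite e4 s1 mul1r.
set K := _ / _ ^+ k; have K0 : 0 <= K by rewrite divr_ge0 ?sqrtr_ge0// exprn_ge0 ?sqrtr_ge0.
rewrite -[leLHS](mulrA K); apply: ler_wpM2l => //.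
have -> : - q / 2 = - (2^-1 * q) / 2 + - (q / 4) by field.
rewrite expRD -mulrA mulrC -subr_ge0.
set e := expR (- (2^-1 * q) / 2); have e0 : 0 <= e by exact: expR_ge0.
have H : expR (- (q / 4)) * q <= 4.
  rewrite expRN mulrC ler_pdivrMr ?expR_gt0//.
  have := expR_ge1Dx (q / 4); lra.
nra.
Qed.

Lemma posdef_diag_gt0 k (S : 'M[R]_k) i : posdef S -> 0 < S i i.
Proof.
move=> [_ Sp]; have := Sp (delta_mx i 0).
rewrite /qf trmx_delta -rowE -colE !mxE; apply.
by apply/negP => /eqP/matrixP/(_ i 0); rewrite !mxE !eqxx => /eqP; rewrite oner_eq0.
Qed.

(** Expand the nonnegative form of [S] at the vector [e - S_ii S^-1 e], where [e] is the [i]-th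
    basis vector. *)
Lemma posdef_invmx_diag k (S : 'M[R]_k) i : posdef S -> (S i i)^-1 <= (invmx S) i i.
Proof.
move=> SP; have Sii := posdef_diag_gt0 i SP; have SU := posdef_unit SP.
have [SE _] := SP.
pose e : 'cV[R]_k := delta_mx i 0.
have eM (M : 'M[R]_k) : (e^T *m M *m e) 0 0 = M i i.
  by rewrite /e trmx_delta -rowE -colE !mxE.
pose x := e - (S i i) *: (invmx S *m e).
have := qf_ge0 x SP; rewrite /x qfD// qfN qfZ.
have -> : qf S (invmx S *m e) = invmx S i i.
  by rewrite /qf trmx_mul trmx_inv SE -!mulmxA (mulmxA S) mulmxV// mul1mx mulmxA eM.
rewrite mulmxN -scalemxAr mulmxA mulmxK//.
have -> : (- (S i i *: (e^T *m e))) 0 0 = - S i i.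
  by rewrite mxE [X in - X]mxE -[e^T]mulmx1 eM mxE eqxx mulr1.
rewrite /qf eM -[invmx S i i]mulr1 => H.
rewrite -(ler_pM2l Sii) mulfV ?gt_eqF//.
rewrite -(ler_pM2l Sii); nra.
Qed.

(** Only row [i] changes, so its cofactors do not, and expanding along that row adds [c] times one
    cofactor, which is [c] times the determinant times a diagonal entry of the inverse. *)
Lemma det_add_delta k (S : 'M[R]_k) i (c : R) : posdef S ->
  \det (S + c *: delta_mx i i) = \det S * (1 + c * (invmx S) i i).
Proof.
move=> SP; have SU := posdef_unit SP.
rewrite mulrDr mulr1.
have -> : \det S * (c * (invmx S) i i) = c * cofactor S i i.
  rewrite /invmx SU !mxE mulrCA; congr (_ * _).
  by rewrite mulrA mulfV ?mul1r// gt_eqF// posdef_det_gt0.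
rewrite (expand_det_row _ i) (expand_det_row S i).
have cE j : cofactor (S + c *: delta_mx i i) i j = cofactor S i j.
  rewrite /cofactor; congr (_ * \det _); apply/matrixP => a b.
  by rewrite !mxE [lift i _ == i]eq_sym (negbTE (neq_lift i _)) mulr0 addr0.
have -> : c * cofactor S i i = \sum_j c * (delta_mx i i) i j * cofactor S i j.
  rewrite (bigD1 i)//= big1 => [|j ji]; first by rewrite mxE !eqxx mulr1 addr0.
  by rewrite mxE (negbTE ji) andbF mulr0 mul0r.
rewrite -big_split; apply: eq_bigr => j _.
by rewrite cE !mxE mulrDl.
Qed.

Lemma qf_delta k i (x : 'cV[R]_k) : qf (delta_mx i i) x = x i 0 ^+ 2.
Proof.
rewrite /qf -[delta_mx i i](mul_delta_mx (0 : 'I_1)) !mulmxA -mulmxA.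
by rewrite [LHS]mxE big_ord1 -rowE -colE !mxE expr2.
Qed.

Lemma posdef_add_delta k (S : 'M[R]_k) i (c : R) : posdef S -> 0 <= c ->
  posdef (S + c *: delta_mx i i).
Proof.
move=> [SE Sp] c0; split; first by rewrite linearD linearZ/= trmx_delta SE.
move=> x x0; rewrite qfDS qfZS qf_delta.
by rewrite ltr_pwDl// ?Sp// mulr_ge0 ?sqr_ge0.
Qed.

(** Diagonal entries are increased one at a time. The last clause carries the induction: the entry
    about to change is still that of [S], so each factor can be bounded through [S i i]. *)
Lemma det_add_diag k (S : 'M[R]_k) (c : R) (s : seq 'I_k) : posdef S -> 0 <= c -> uniq s ->
  let S' := S + c *: \sum_(i <- s) delta_mx i i in
  [/\ posdef S', \det S * \prod_(i <- s) (1 + c / S i i) <= \det S' &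
    forall i, i \notin s -> S' i i = S i i].
Proof.
move=> SP c0; elim: s => [_|i s IH /= /andP[si us]] /=.
  by rewrite !big_nil scaler0 addr0 mulr1; split.
have [S'P detS' S'i] := IH us.
rewrite !big_cons.
have -> : S + c *: (delta_mx i i + \sum_(j <- s) delta_mx j j) =
    (S + c *: \sum_(i <- s) delta_mx i i) + c *: delta_mx i i.
  by rewrite scalerDr addrCA [RHS]addrC.
set S' := S + _ in S'P detS' S'i *.
split.
- exact: posdef_add_delta.
- rewrite det_add_delta// mulrCA mulrC.
  apply: ler_pM => //.
  + rewrite mulr_ge0 ?(ltW (posdef_det_gt0 _))// prodr_ge0// => j _.
    by rewrite addr_ge0// divr_ge0// ltW// posdef_diag_gt0.
  + by rewrite addr_ge0// divr_ge0// ltW// posdef_diag_gt0.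
  + by rewrite lerD2l ler_wpM2l// -(S'i i si) posdef_invmx_diag.
- move=> j; rewrite inE negb_or => /andP[ji js].
  by rewrite mxE S'i// mxE [delta_mx _ _ _ _]mxE (negbTE ji) mulr0 addr0.
Qed.

(* Adding [2 s] to the diagonal entry [i] multiplies the determinant by
   [1 + 2 s (S^-1)_ii], and [(S^-1)_ii >= 1 / S_ii]. *)
Lemma lebint_mvn_pdf_laplace k (S : 'M[R]_k) (m : 'cV[R]_k) (P : pred 'I_k) (s L : R) :
  posdef S -> 0 <= s -> (forall i, P i -> S i i <= L) ->
  (lebint (fun t : k.-tuple R =>
     (mvn_pdf S m (tcol t) * expR (- (s * \sum_(i | P i) tnth t i ^+ 2)))%:E) <=
   ((1 + 2 * s / L) `^ (- (#|P|%:R / 2)))%:E)%E.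
Proof.
move=> SP s0 SL.
pose l := enum P; have ul : uniq l by exact: enum_uniq.
have s20 : 0 <= 2 * s by rewrite mulr_ge0.
have [S'P detS' _] := det_add_diag SP s20 ul.
set S' := S + _ in S'P detS'.
have d0 := posdef_det_gt0 SP; have d'0 := posdef_det_gt0 S'P.
have qS' x : qf S' x = qf S x + 2 * s * \sum_(i | P i) x i 0 ^+ 2.
  rewrite qfDS qfZS; congr (_ + _ * _).
  rewrite [LHS](_ : _ = \sum_(i <- l) x i 0 ^+ 2); last first.
    elim: (l) => [|i l' IH]; first by rewrite !big_nil /qf mulmx0 mul0mx mxE.
    by rewrite !big_cons qfDS IH qf_delta.
  by rewrite /l big_enum.
pose m' := invmx S' *m (S *m m).
have K0 : 0 <= Num.sqrt (\det S) / Num.sqrt (\det S') by rewrite divr_ge0 ?sqrtr_ge0.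
apply: (@le_trans _ _ (Num.sqrt (\det S) / Num.sqrt (\det S'))%:E).
  rewrite -[leRHS]mule1 -(lebint_mvn_pdf m' S'P) -lebintZl; first last.
  - by move=> t; rewrite lee_fin mvn_pdf_ge0.
  - by apply: mfun_EFin; exact: measurable_mvn_pdf_x.
  - by rewrite lee_fin.
  apply: lebint_le => t.
    by rewrite lee_fin mulr_ge0 ?mvn_pdf_ge0 ?expR_ge0.
  rewrite -EFinM lee_fin !mvn_pdfE.
  rewrite (_ : \sum_(i | P i) tnth t i ^+ 2 = \sum_(i | P i) tcol t i 0 ^+ 2); last first.
    by apply: eq_bigr => i _; rewrite mxE.
  set x := tcol t; set N := Num.sqrt (2 * pi) ^+ k.
  have N0 : 0 < N by rewrite exprn_gt0// sqrtr_gt0 mulr_gt0 ?pi_gt0.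
  have -> : Num.sqrt (\det S) / Num.sqrt (\det S') *
    (Num.sqrt (\det S') / N * expR (- qf S' (x - m') / 2)) =
    Num.sqrt (\det S) / N * expR (- qf S' (x - m') / 2).
    have : Num.sqrt (\det S') != 0 by rewrite gt_eqF// sqrtr_gt0.
    by move=> ?; field; rewrite gt_eqF.
  set K := _ / N; have KN0 : 0 <= K by rewrite divr_ge0 ?sqrtr_ge0// ltW.
  rewrite -[leLHS](mulrA K) -expRD; apply: ler_wpM2l => //.
  rewrite ler_expR.
  have key z : qf S (z - m) + 2 * s * \sum_(i | P i) z i 0 ^+ 2 =
     qf S' (z - m') - qf S' m' + qf S m.
    have := complete_square z (S *m m) S'P; rewrite -/m' qS' => <-.
    have [SE _] := SP.
    rewrite qfD// qfN mulmxN -mulmxA.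
    have -> (M : 'M[R]_1) : (- M) 0 0 = - M 0 0 by rewrite mxE.
    by ring.
  have := key m'; rewrite subrr.
  have -> : qf S' 0 = 0 by rewrite /qf mulmx0 mxE.
  have := key x; have := qf_ge0 (m' - m) SP.
  have : 0 <= 2 * s * \sum_(i | P i) m' i 0 ^+ 2.
    by rewrite mulr_ge0// sumr_ge0// => i _; rewrite sqr_ge0.
  lra.
rewrite lee_fin powRN.
have sd' : 0 < Num.sqrt (\det S') by rewrite sqrtr_gt0.
have lP i : i \in l -> P i by rewrite /l mem_enum.
have prod_le : (1 + 2 * s / L) ^+ #|P| <= \prod_(i <- l) (1 + 2 * s / S i i).
  have -> : (1 + 2 * s / L) ^+ #|P| = \prod_(i <- l) (1 + 2 * s / L).
    by rewrite big_const_seq count_predT iter_mulr mulr1 /l -cardE.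
  rewrite big_seq [leRHS]big_seq; apply: ler_prod => i /lP Pi.
  have Si := posdef_diag_gt0 i SP; have SLi := SL i Pi.
  have L0 : 0 < L by exact: lt_le_trans SLi.
  apply/andP; split; first by rewrite addr_ge0// divr_ge0// ltW.
  by rewrite lerD2l ler_wpM2l// lef_pV2.
have pE : (1 + 2 * s / L) `^ (#|P|%:R / 2) = Num.sqrt ((1 + 2 * s / L) ^+ #|P|).
  have [i Pi|P0] := pickP P.
    have L0 : 0 < L by apply: lt_le_trans (SL i Pi); exact: posdef_diag_gt0.
    have a0 : 0 <= 1 + 2 * s / L by rewrite addr_ge0// divr_ge0// ltW.
    by rewrite powRrM powR_mulrn// powR12_sqrt// exprn_ge0.
  by rewrite (eq_card0 P0) mul0r powRr0 expr0 sqrtr1.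
rewrite pE -[leRHS]mul1r ler_pdivrMr// mulrAC mul1r.
rewrite -[Num.sqrt (\det S)]mulr1.
have [q0|q0] := ltP 0 ((1 + 2 * s / L) ^+ #|P|); last first.
  have [i Pi|P0] := pickP P.
    have L0 : 0 < L by apply: lt_le_trans (SL i Pi); exact: posdef_diag_gt0.
    have a0 : 0 < 1 + 2 * s / L by rewrite ltr_pwDl// divr_ge0// ltW.
    by have := exprn_gt0 #|P| a0; rewrite ltNge q0.
  by rewrite (eq_card0 P0) expr0 ler10 in q0.
rewrite mulr1 ler_pdivlMr ?sqrtr_gt0// -sqrtrM ?(ltW d0)// ler_sqrt ?(ltW d'0)//.
by apply: le_trans detS'; rewrite ler_wpM2l// ltW.
Qed.

End GaussianBounds.

(** * Truncated normal distributions *)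

Section TruncatedNormal.
Variable R : realType.
Notation mu := (@lebesgue_measure R).

Lemma mfun_fine_integral d (T : measurableType d) (f : T -> R -> R) :
  measurable_fun setT (fun z : T * R => f z.1 z.2) -> (forall x t, 0 <= f x t) ->
  measurable_fun setT (fun x => fine (\int[mu]_t (f x t)%:E)%E).
Proof.
move=> mf f0; apply: (measurableT_comp (@fine_measurable R _ measurableT)).
apply: (@measurable_fun_fubini_tonelli_F _ _ _ _ _ mu (fun z : T * R => (f z.1 z.2)%:E)).
  by mfun.
by move=> z; rewrite lee_fin.
Qed.

Lemma integral_ge_itv (f : R -> R) (a c : R) : (forall x, 0 <= f x) -> 0 <= c ->
  (forall x, a < x < a + 1 -> c <= f x) -> (c%:E <= \int[mu]_x (f x)%:E)%E.
Proof.
move=> f0 c0 fc.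
apply: (@le_trans _ _ (\int[mu]_x (c%:E * (\1_(`]a, (a + 1)%R[%classic) x)%:E))%E).
  rewrite ge0_integralZl_EFin//; last first.
    by apply: mfun_EFin; exact: measurable_indic.
  rewrite integral_indic//= setIT lebesgue_measure_itv/= lte_fin ltrDl ltr01.
  by rewrite -EFinB addrAC subrr add0r mule1.
apply: ge0_integral_mono => x; first by rewrite mule_ge0 ?lee_fin.
rewrite -EFinM lee_fin indicE; case: (boolP (_ \in _)) => [|_]; last by rewrite mulr0.
by rewrite inE/= in_itv/= mulr1 => /fc.
Qed.

Lemma phi_gt0 (x : R) : 0 < phi x.
Proof. by rewrite divr_gt0 ?expR_gt0// sqrtr_gt0 mulr_gt0 ?pi_gt0. Qed.

Lemma phi_ge0 (x : R) : 0 <= phi x. Proof. by rewrite ltW ?phi_gt0. Qed.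

Lemma mfun_phi d (T : measurableType d) (f : T -> R) :
  measurable_fun setT f -> measurable_fun setT (fun x => phi (f x)).
Proof. by move=> mf; rewrite /phi; mfun. Qed.

Ltac mfun_user ::= apply: mfun_phi.

Lemma integral_phi (m : R) : (\int[mu]_x (phi (x - m))%:E = 1)%E.
Proof.
rewrite -(@integral_gauss_sigma R 1 m)//; apply: eq_integral => x _; congr _%:E.
by rewrite /phi sqrtr1 mul1r !mul1r mulrC.
Qed.

Lemma ler_phi (x y : R) : x ^+ 2 <= y ^+ 2 -> phi y <= phi x.
Proof.
move=> xy; rewrite /phi ler_wpM2r ?invr_ge0 ?sqrtr_ge0// ler_expR; lra.
Qed.

Lemma integral_phi_sqr (m : R) :
  (\int[mu]_x (phi (x - m) * (x - m) ^+ 2)%:E <= (4 * Num.sqrt 2)%:E)%E.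
Proof.
have h0 : (0 : R) < 2^-1 by rewrite invr_gt0.
rewrite -[leRHS]mule1 -(@integral_gauss_sigma R 2^-1 m)//.
rewrite -ge0_integralZl_EFin//; try by nneg.
  2: by mfun.
apply: ge0_integral_mono => x; first by rewrite lee_fin mulr_ge0 ?phi_ge0 ?sqr_ge0.
rewrite -EFinM lee_fin /phi.
set u := (x - m) ^+ 2; have u0 : 0 <= u by rewrite sqr_ge0.
have c0 : 0 < Num.sqrt (2 * pi) :> R by rewrite sqrtr_gt0 mulr_gt0 ?pi_gt0.
have s1 : Num.sqrt 2 * Num.sqrt 2^-1 = 1 :> R by rewrite -sqrtrM// mulfV// sqrtr1.
have e4 (x1 x2 x3 x4 : R) : 4 * x1 * (x2 / x3 * x4) = (x1 * x2) * (4 * x4 / x3) by ring.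
rewrite e4 s1 mul1r mulrAC ler_pM2r ?invr_gt0//.
have -> : - u / 2 = - (2^-1 * u) / 2 + - (u / 4) by field.
rewrite expRD -mulrA mulrC; apply: ler_wpM2r; first exact: expR_ge0.
rewrite expRN mulrC ler_pdivrMr ?expR_gt0//.
have := expR_ge1Dx (u / 4); lra.
Qed.

Definition tnZ (m : R) (y : bool) : R :=
  fine (\int[mu]_t ((tn_set y t)%:R * phi (t - m))%:E)%E.

Lemma mfun_tn_set d (T : measurableType d) y (f : T -> R) :
  measurable_fun setT f -> measurable_fun setT (fun x => (tn_set y (f x))%:R : R).
Proof.
move=> mf; apply: (mfun_eq (f := fun x => if tn_set y (f x) then 1 else 0 : R)).
  by move=> x; case: tn_set.
by case: y => /=; mfun.
Qed.

Lemma tn_dens_ge0 y (m t : R) : 0 <= (tn_set y t)%:R * phi (t - m).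
Proof. by rewrite mulr_ge0 ?phi_ge0. Qed.

Lemma tnZE m y : (\int[mu]_t ((tn_set y t)%:R * phi (t - m))%:E = (tnZ m y)%:E)%E.
Proof.
rewrite /tnZ fineK// ge0_fin_numE; last first.
  by apply: integral_ge0 => x _; rewrite lee_fin tn_dens_ge0.
apply: (@le_lt_trans _ _ 1%E); last exact: ltry.
rewrite -(integral_phi m); apply: ge0_integral_mono => x; rewrite lee_fin ?tn_dens_ge0//.
by case: tn_set; rewrite ?mul1r// mul0r phi_ge0.
Qed.

Lemma tnZ_le1 m y : tnZ m y <= 1.
Proof.
rewrite -lee_fin -tnZE -(integral_phi m).
apply: ge0_integral_mono => x; rewrite lee_fin ?tn_dens_ge0//.
by case: tn_set; rewrite ?mul1r// mul0r phi_ge0.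
Qed.

Lemma tnZ_lb m y (a c : R) : 0 <= c ->
  (forall x, a < x < a + 1 -> tn_set y x /\ c <= phi (x - m)) -> c <= tnZ m y.
Proof.
move=> c0 H; rewrite -lee_fin -tnZE; apply: (@integral_ge_itv _ a) => //.
  by move=> x; exact: tn_dens_ge0.
by move=> x /H[-> ?]; rewrite mul1r.
Qed.

Lemma tnZ_gt0 m y : 0 < tnZ m y.
Proof.
have H := phi_gt0 (1 + `|m|); apply: (lt_le_trans H).
have m0 := normr_ge0 m; have m1 := ler_norm m; have m2 := ler_norm (- m).
rewrite normrN in m2.
apply: (@tnZ_lb _ _ (if y then 0 else -1)); first exact: ltW.
move=> x; case: y => /andP[x0 x1]; split => //=; try (by apply: ltW; lra);
  by apply: ler_phi; nra.
Qed.

Lemma tn_pdfE m y x : tn_pdf m y x = (tn_set y x)%:R * phi (x - m) / tnZ m y.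
Proof. by []. Qed.

Lemma tn_pdf_ge0 m y (x : R) : 0 <= tn_pdf m y x.
Proof. by rewrite divr_ge0 ?tn_dens_ge0// ltW// tnZ_gt0. Qed.

Lemma mfun_tn_pdf d (T : measurableType d) y (f g : T -> R) :
  measurable_fun setT f -> measurable_fun setT g ->
  measurable_fun setT (fun x => tn_pdf (f x) y (g x)).
Proof.
move=> mf mg; rewrite /tn_pdf; mfun.
- exact: mfun_tn_set.
- apply: (@mfun_fine_integral _ _ (fun x t => (tn_set y t)%:R * phi (t - f x))).
    mfun; first by apply: mfun_tn_set; mfun.
    by apply: (measurableT_comp mf); mfun.
  by move=> x t; exact: tn_dens_ge0.
Qed.

Ltac mfun_user ::= first [apply: mfun_phi|apply: mfun_tn_set|apply: mfun_tn_pdf].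
Ltac nneg_user ::= first [exact: phi_ge0|exact: tn_pdf_ge0|exact: gamma_un_ge0
  |exact: mvn_pdf_ge0].

Lemma integral_tn_pdf m y : (\int[mu]_x (tn_pdf m y x)%:E = 1)%E.
Proof.
have Z0 := tnZ_gt0 m y.
under eq_integral do rewrite tn_pdfE EFinM.
rewrite ge0_integralZr//.
- by rewrite tnZE -EFinM mulfV ?gt_eqF.
- by mfun.
- by move=> x _; rewrite lee_fin tn_dens_ge0.
- by rewrite lee_fin invr_ge0 ltW.
Qed.

Lemma tn_pdf_lb m y (x : R) : (tn_set y x)%:R * phi (x - m) <= tn_pdf m y x.
Proof.
rewrite tn_pdfE ler_pdivlMr ?tnZ_gt0// ler_piMr ?tn_dens_ge0//.
exact: tnZ_le1.
Qed.

(** If [m] lies on the side of the truncation set, the normalizing mass is at least [phi 1] and the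
    moment is that of a normal law around [m], up to a constant. If [m] lies on the other side, the
    truncated law is [phi] tilted towards 0, and its second moment is bounded uniformly in [m]: such
    coordinates contribute nothing to the leading term. *)
Lemma tn_pdf_sqr_le (del : R) : 0 < del -> exists2 C : R, 0 <= C & forall m y,
  (\int[mu]_x (tn_pdf m y x * x ^+ 2)%:E <=
    ((1 + del) * Num.max 0 (- ((1 - 2 * y%:R) * m)) ^+ 2 + C)%:E)%E.
Proof.
move=> del0; pose K : R := 4 * Num.sqrt 2.
have K0 : 0 <= K by rewrite mulr_ge0 ?sqrtr_ge0.
have p1 := @phi_gt0 1; set p := phi 1 in p1.
have d0 : 0 < 1 + del^-1 by rewrite addr_gt0 ?invr_gt0.
(* One constant for both cases below, which need [(1 + del^-1) * (K / p)] and [1 + K / p]. *)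
exists (1 + (1 + (1 + del^-1)) * (K / p)).
  by rewrite addr_ge0// mulr_ge0 ?divr_ge0 ?(ltW p1)// addr_ge0// ltW.
move=> m y; have Z0 := tnZ_gt0 m y.
have kp0 : 0 <= K / p by rewrite divr_ge0// ltW.
have mphi : measurable_fun setT (fun x : R => phi (x - m) * (x - m) ^+ 2).
  by mfun.
have mtn : measurable_fun setT (fun x : R => tn_pdf m y x).
  by apply: mfun_tn_pdf; mfun.
have [sm|sm] := leP ((1 - 2 * y%:R) * m) 0.
- have Zp : p <= tnZ m y.
    (* The unit interval next to [m] on the side away from 0 lies in the truncation set, and
       [phi (x - m)] is at least [phi 1] on it. *)
    apply: (@tnZ_lb _ _ (if y then m else m - 1)); first exact: ltW.
    move=> x; case: y sm {Z0 mtn} => /= sm /andP[x0 x1]; split => //=; try (by lra);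
      by apply: ler_phi; nra.
  apply: (@le_trans _ _ (\int[mu]_x (((1 + del) * m ^+ 2)%:E * (tn_pdf m y x)%:E +
      ((1 + del^-1) / p)%:E * (phi (x - m) * (x - m) ^+ 2)%:E))%E).
    apply: ge0_integral_mono => x.
      by rewrite lee_fin mulr_ge0 ?tn_pdf_ge0 ?sqr_ge0.
    rewrite -!EFinM -EFinD lee_fin.
    have x2 : x ^+ 2 <= (1 + del) * m ^+ 2 + (1 + del^-1) * (x - m) ^+ 2.
      rewrite -subr_ge0.
      have -> : (1 + del) * m ^+ 2 + (1 + del^-1) * (x - m) ^+ 2 - x ^+ 2 =
        del^-1 * (del * m - (x - m)) ^+ 2 by field; rewrite gt_eqF.
      by rewrite mulr_ge0 ?sqr_ge0 ?invr_ge0 ?ltW.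
    have := ler_wpM2l (tn_pdf_ge0 m y x) x2; move=> /le_trans; apply.
    rewrite mulrDr [tn_pdf _ _ _ * _]mulrC lerD2l.
    have e1 (c1 c2 c3 c4 : R) : c1 / c2 * (c3 * c4) = c1 * (c2^-1 * c3 * c4) by ring.
    have aux (t c q w : R) : 0 <= c -> 0 <= q -> t <= w -> t * (c * q) <= c * (w * q).
      by move=> ? ? ?; rewrite mulrCA; apply: ler_wpM2l => //; exact: ler_wpM2r.
    rewrite [leRHS]e1; apply: aux; [exact: ltW|exact: sqr_ge0|].
    rewrite tn_pdfE mulrC; apply: ler_pM; rewrite ?invr_ge0 ?tn_dens_ge0 ?(ltW Z0)//.
      by rewrite lef_pV2.
    by case: tn_set; rewrite ?mul1r// mul0r phi_ge0.
  rewrite ge0_integralD//; first last.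
  - by mfun.
  - by nneg.
  - by mfun.
  - by nneg.
  rewrite !ge0_integralZl_EFin//; first last.
  - by nneg.
  - by mfun.
  - by move=> x _; rewrite lee_fin tn_pdf_ge0.
  - by nneg.
  - by mfun.
  - by nneg.
  rewrite integral_tn_pdf mule1.
  apply: (@le_trans _ _ (((1 + del) * m ^+ 2)%:E + ((1 + del^-1) / p)%:E * K%:E)%E).
    by rewrite leeD2l// lee_wpmul2l ?lee_fin ?divr_ge0 ?(ltW d0) ?(ltW p1)//; exact: integral_phi_sqr.
  rewrite -EFinM -EFinD lee_fin.
  have -> : Num.max 0 (- ((1 - 2 * y%:R) * m)) ^+ 2 = m ^+ 2.
    rewrite max_r ?oppr_ge0// sqrrN exprMn.
    by case: (y); rewrite /= ?mulr1 ?mulr0 ?subr0; ring.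
  rewrite lerD2l mulrAC mulrC; nra.
- have phiE (x : R) : phi (x - m) = phi x * expR (- m ^+ 2 / 2) * expR (x * m).
    rewrite /phi.
    have -> : expR (- (x - m) ^+ 2 / 2) = expR (- x ^+ 2 / 2) * expR (- m ^+ 2 / 2) * expR (x * m).
      by rewrite -!expRD; congr expR; field.
    by ring.
  (* The tilting factor [phi (x - m) / phi x] at [|x| = 1]. On the truncation set it is at least [E]
     for [|x| <= 1], which bounds the mass below by [p * E], and at most [E] for [|x| >= 1], so the
     density there is at most [phi x / p]. *)
  pose E := expR (- m ^+ 2 / 2) * expR (- `|m|).
  have E0 : 0 < E by rewrite mulr_gt0 ?expR_gt0.
  have tnx (x : R) : tn_set y x -> x * m = - `|x| * `|m|.
    case: y sm {Z0 mtn} => /= sm xs.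
      have m0 : m < 0 by lra.
      by rewrite gtr0_norm// ltr0_norm//; ring.
    have m0 : 0 < m by lra.
    by rewrite ler0_norm// gtr0_norm//; ring.
  have Zp : p * E <= tnZ m y.
    apply: (@tnZ_lb _ _ (if y then 0 else -1)); first by rewrite mulr_ge0 ?ltW.
    move=> x xx; have tx : tn_set y x.
      by case: y xx {sm Z0 mtn tnx} => /= /andP[? ?]; [|apply: ltW; lra].
    have x1 : `|x| <= 1.
      by rewrite ler_norml; case: y xx {sm Z0 mtn tnx tx} => /= /andP[? ?]; lra.
    split => //; rewrite phiE -mulrA; apply: ler_pM; rewrite ?(ltW p1) ?(ltW E0)//.
      by apply: ler_phi; rewrite expr1n -real_normK ?num_real// expr_le1.
    apply: ler_wpM2l; first exact: expR_ge0.
    by rewrite ler_expR tnx// mulNr lerN2 ler_piMl.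
  apply: (@le_trans _ _ (\int[mu]_x ((tn_pdf m y x)%:E +
      (p^-1)%:E * (phi (x - 0) * (x - 0) ^+ 2)%:E))%E).
    apply: ge0_integral_mono => x.
      by rewrite lee_fin mulr_ge0 ?tn_pdf_ge0 ?sqr_ge0.
    rewrite -EFinM -EFinD lee_fin !subr0.
    have [x1|x1] := leP `|x| 1.
      rewrite -[leLHS]addr0 lerD//.
        by rewrite ler_piMr ?tn_pdf_ge0// -real_normK ?num_real// expr_le1.
      by rewrite mulr_ge0 ?invr_ge0 ?(ltW p1)// mulr_ge0 ?phi_ge0 ?sqr_ge0.
    rewrite -[leLHS]add0r; apply: lerD; first exact: tn_pdf_ge0.
    rewrite [leRHS]mulrA; apply: ler_wpM2r; first exact: sqr_ge0.
    rewrite tn_pdfE ler_pdivrMr//.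
    have [tx|_] := boolP (tn_set y x); last first.
      by rewrite mul0r !mulr_ge0 ?invr_ge0 ?(ltW p1) ?phi_ge0 ?(ltW Z0).
    rewrite mul1r phiE -[leLHS]mulrA.
    have e3 (c1 c2 c3 : R) : c1^-1 * c2 * c3 = c2 * (c3 / c1) by ring.
    rewrite [leRHS]e3; apply: ler_wpM2l; first exact: phi_ge0.
    rewrite ler_pdivlMr// mulrC; apply: le_trans Zp; rewrite ler_pM2l//.
    apply: ler_wpM2l; first exact: expR_ge0.
    by rewrite ler_expR tnx// mulNr lerN2 ler_peMl// ltW.
  rewrite ge0_integralD//; first last.
  - by mfun.
  - by nneg.
  - by mfun.
  - by move=> x _; rewrite lee_fin tn_pdf_ge0.
  rewrite integral_tn_pdf ge0_integralZl_EFin//; first last.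
  - by rewrite invr_ge0 ltW.
  - by mfun.
  - by nneg.
  apply: (@le_trans _ _ (1 + (p^-1)%:E * K%:E)%E).
    by rewrite leeD2l// lee_wpmul2l ?lee_fin ?invr_ge0 ?(ltW p1)//; exact: integral_phi_sqr.
  rewrite -EFinM -EFinD lee_fin.
  rewrite max_l ?oppr_le0 ?(ltW sm)// expr0n/= mulr0 add0r lerD2l mulrC ler_peMl//.
  by rewrite lerDl ltW.
Qed.

End TruncatedNormal.

(** * Geometric ergodicity from drift and minorization *)

Section HarrisArith.
Variables (R : realType) (lam L beta t s : R).
Hypothesis lam1 : lam < 1.
Hypothesis beta0 : 0 < beta.
Hypothesis t_lam : (1 + lam) / 2 <= t.
Hypothesis s0 : 0 <= s.

(** Two points in the small set: minorization gains [2 eps], of which the additive drift constant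
    [2 beta L] uses up at most half. *)
Lemma contraction_near (eps : R) : 2 * beta * L <= eps -> 1 - eps / 2 <= t ->
  2 + beta * (lam * s + 2 * L) - 2 * eps <= t * (2 + beta * s).
Proof.
move=> bL te; have bs : 0 <= beta * s by rewrite mulr_ge0// ltW.
have h3 : (1 + lam) / 2 * (beta * s) <= t * (beta * s) by rewrite ler_wpM2r.
have h6 : lam * (beta * s) <= (1 + lam) / 2 * (beta * s) by rewrite ler_wpM2r//; have := lam1; lra.
lra.
Qed.

(** One of the points is far out: half of the drift gain [(1 - lam) s] exceeds [2 L] by at least 1,
    and the surplus [beta] contracts the constant 2. *)
Lemma contraction_far (M : R) : 2 * (2 * L + 1) <= (1 - lam) * M -> M <= s ->
  1 - beta / 2 <= t -> 2 + beta * (lam * s + 2 * L) <= t * (2 + beta * s).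
Proof.
move=> ML Ms tb; have bs : 0 <= beta * s by rewrite mulr_ge0// ltW.
have h3 : (1 + lam) / 2 * (beta * s) <= t * (beta * s) by rewrite ler_wpM2r.
have h4 : (1 - lam) * M <= (1 - lam) * s by rewrite ler_wpM2l// subr_ge0 ltW.
have h5 : beta * (2 * L + 1) <= beta * ((1 - lam) / 2 * s) by rewrite ler_pM2l//; lra.
lra.
Qed.

End HarrisArith.

Section Harris.
Variables (R : realType) (D : nat).
Notation T := (D.-tuple R).
Variable k : T -> T -> \bar R.
Hypothesis mk : measurable_fun setT (fun z : T * T => k z.1 z.2).
Hypothesis k0 : forall x y, (0 <= k x y)%E.
Hypothesis k1 : forall x, lebint (k x) = 1%E.

Definition opE (w : T -> \bar R) (g : T -> R) : \bar R :=
  lebint (fun y => w y * (g y)%:E)%E.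

Section Weight.
Variable w : T -> \bar R.
Hypothesis mw : measurable_fun setT w.
Hypothesis w0 : forall y, (0 <= w y)%E.
Hypothesis w1 : lebint w = 1%E.
Implicit Types g h : T -> R.

Lemma opE_ge0 g : (forall y, 0 <= g y) -> (0 <= opE w g)%E.
Proof. by move=> g0; apply: lebint_ge0 => y; rewrite mule_ge0 ?lee_fin. Qed.

Lemma opED g h : measurable_fun setT g -> measurable_fun setT h ->
  (forall y, 0 <= g y) -> (forall y, 0 <= h y) ->
  opE w (fun y => g y + h y) = (opE w g + opE w h)%E.
Proof.
move=> mg mh g0 h0; rewrite -lebintD; first last.
- by nneg.
- by mfun.
- by nneg.
- by mfun.
by apply: eq_lebint => y; rewrite EFinD ge0_muleDr// lee_fin.
Qed.

Lemma opEZ c g : measurable_fun setT g -> (forall y, 0 <= g y) -> 0 <= c ->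
  opE w (fun y => c * g y) = (c%:E * opE w g)%E.
Proof.
move=> mg g0 c0; rewrite -lebintZl//; last by nneg.
  by apply: eq_lebint => y; rewrite EFinM muleCA.
by mfun.
Qed.

Lemma opE_cst c : 0 <= c -> opE w (fun=> c) = c%:E.
Proof.
by move=> c0; rewrite /opE lebintZr// ?lee_fin// w1 mul1e.
Qed.

Lemma opE_le g h : (forall y, 0 <= g y) -> (forall y, g y <= h y) -> (opE w g <= opE w h)%E.
Proof.
move=> g0 gh; apply: lebint_le => y; first by rewrite mule_ge0// lee_fin.
by rewrite lee_wpmul2l// lee_fin.
Qed.

Lemma opE_bnd g : (forall y, 0 <= g y <= 1) -> exists2 c, opE w g = c%:E & 0 <= c <= 1.
Proof.
move=> g01; have g0 y : 0 <= g y by have /andP[] := g01 y.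
have h0 := opE_ge0 g0.
have h1 : (opE w g <= 1%:E)%E.
  by rewrite -(@opE_cst 1)//; apply: opE_le => // y; have /andP[] := g01 y.
have fin : opE w g \is a fin_num by rewrite ge0_fin_numE// (le_lt_trans h1)// ltry.
exists (fine (opE w g)); first by rewrite fineK.
by rewrite -!lee_fin fineK// h0 h1.
Qed.

End Weight.

Variables (V : T -> R) (lam L : R).
Hypothesis mV : measurable_fun setT V.
Hypothesis V0 : forall x, 0 <= V x.
Hypothesis lam0 : 0 <= lam.
Hypothesis lam1 : lam < 1.
Hypothesis L0 : 0 <= L.
Hypothesis drift : forall x, (opE (k x) V <= (lam * V x + L)%:E)%E.

Let mkx x : measurable_fun setT (k x).
Proof.
exact: (mfun_comp2 mk (measurable_cst x) (@measurable_id _ _ setT)).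
Qed.

Definition opP (f : T -> R) (x : T) : R := fine (opE (k x) f).

Lemma measurable_opP (f : T -> R) : measurable_fun setT f -> (forall y, 0 <= f y) ->
  measurable_fun setT (opP f).
Proof.
move=> mf f0; apply: (measurableT_comp (@fine_measurable R _ measurableT)).
apply: (@measurable_lebint _ _ _ _ (fun x y => (k x y * (f y)%:E)%E)).
  apply: mfun_eM => //; apply: mfun_EFin.
  by apply: (measurableT_comp mf); mfun.
by nneg.
Qed.

Lemma opP_bnd (f : T -> R) : (forall y, 0 <= f y <= 1) -> forall x, 0 <= opP f x <= 1.
Proof.
by move=> f01 x; have [c cE ?] := opE_bnd (mkx x) (@k0 x) (k1 x) f01; rewrite /opP cE.
Qed.

Section Contraction.
Variables (M eps : R) (N : T -> \bar R).
Hypothesis MlE : 2 * (2 * L + 1) <= (1 - lam) * M.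
Hypothesis eps0 : 0 < eps.
Hypothesis mN : measurable_fun setT N.
Hypothesis N0 : forall y, (0 <= N y)%E.
Hypothesis N1 : lebint N = 1%E.
Hypothesis minor : forall x, V x <= M -> forall y, (eps%:E * N y <= k x y)%E.

Variables beta t : R.
Hypothesis beta0 : 0 < beta.
Hypothesis betaL : 2 * beta * L <= eps.
Hypothesis t_beta : 1 - beta / 2 <= t.
Hypothesis t_eps : 1 - eps / 2 <= t.
Hypothesis t_lam : (1 + lam) / 2 <= t.

Let t_gt0 : 0 < t.
Proof. by apply: lt_le_trans t_lam; rewrite divr_gt0// ltr_pwDl. Qed.

(** The seminorm bound says that [f] stays within [B] of a single constant [c]. Both [c + B - f] and
    [f + B - c] are then nonnegative, so minorization applies to the first under [k x] and to the
    second under [k y]; whatever they integrate to is subtracted from the drift bound. *)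
Lemma contraction_step (f : T -> R) (A : R) : measurable_fun setT f -> (forall y, 0 <= f y <= 1) -> 0 <= A ->
  (forall x y, f x - f y <= A * (2 + beta * (V x + V y))) ->
  forall x y, opP f x - opP f y <= A * t * (2 + beta * (V x + V y)).
Proof.
move=> mf f01 A0 fA x y.
have f0 z : 0 <= f z by have /andP[] := f01 z.
have b0 := ltW beta0.
pose B z := A * (1 + beta * V z).
have B0 z : 0 <= B z by rewrite /B; nneg.
have mB : measurable_fun setT B by rewrite /B; mfun.
pose S := [set f z - B z | z in [set: T]].
have Sub z : ubound S (f z + B z).
  move=> _ [u _ <-]; rewrite -lerBlDr.
  have := fA u z; rewrite /B; have := mulrDr A; move=> E.
  rewrite (_ : A * (2 + beta * (V u + V z)) = A * (1 + beta * V u) + A * (1 + beta * V z)); last by ring.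
  lra.
have S0 : S !=set0 by exists (f x - B x); exists x.
have hS : has_sup S by split => //; exists (f x + B x); exact: Sub.
(* Any value between the supremum of [f - B] and the infimum of [f + B] separates; the maximum with
   0 keeps the constant a nonnegative integrand. *)
pose c := Num.max 0 (sup S).
have c0 : 0 <= c by rewrite /c le_max lexx.
have cu z : c <= f z + B z.
  rewrite /c ge_max addr_ge0//=; exact: ge_sup.
have cl z : f z - B z <= c.
  rewrite /c le_max; apply/orP; right; apply: ub_le_sup; first by case: hS.
  by exists z.
pose g1 z := f z + B z - c.
pose g2 z := c + B z - f z.
have g10 z : 0 <= g1 z by rewrite subr_ge0.
have g20 z : 0 <= g2 z by rewrite subr_ge0 -lerBlDr.
have mg1 : measurable_fun setT g1 by rewrite /g1; mfun.
have mg2 : measurable_fun setT g2 by rewrite /g2; mfun.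
have BE (w : T -> \bar R) : measurable_fun setT w -> (forall y, 0 <= w y)%E -> lebint w = 1%E ->
    opE w B = (A%:E + (A * beta)%:E * opE w V)%E.
  move=> mw w0 w1.
  rewrite -(opE_cst mw w0 w1 A0) -opEZ// ?mulr_ge0// -opED//; try by nneg.
    by apply: eq_lebint => z; rewrite /B mulrDr mulr1 mulrA.
  by mfun.
have vE u : exists2 v, opE (k u) V = v%:E & v <= lam * V u + L.
  have fin : opE (k u) V \is a fin_num.
    rewrite ge0_fin_numE; first by apply: le_lt_trans (drift u) _; exact: ltry.
    exact: opE_ge0.
  by exists (fine (opE (k u) V)); [rewrite fineK|rewrite -lee_fin fineK].
have key u : exists p v G1 G2 : R, [/\ opE (k u) f = p%:E, v <= lam * V u + L,
    opE (k u) g1 = G1%:E, opE (k u) g2 = G2%:E &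
    p + A * (1 + beta * v) = G1 + c /\ p + G2 = c + A * (1 + beta * v)].
  have [p pE _] := opE_bnd (mkx u) (@k0 u) (k1 u) f01.
  have [v vE' vle] := vE u.
  have BEu : opE (k u) B = (A * (1 + beta * v))%:E.
    by rewrite BE// vE' -EFinM -EFinD; congr _%:E; ring.
  have cE : opE (k u) (fun=> c) = c%:E by rewrite opE_cst.
  have e1 : (opE (k u) g1 + c%:E)%E = (p + A * (1 + beta * v))%:E.
    rewrite EFinD -pE -BEu -cE -!opED//.
    by apply: eq_lebint => z; rewrite /g1 subrK.
  have e2 : (p%:E + opE (k u) g2)%E = (c + A * (1 + beta * v))%:E.
    rewrite EFinD -pE -BEu -cE -!opED//.
    by apply: eq_lebint => z; rewrite /g2 addrC subrK.
  have h1 : opE (k u) g1 \is a fin_num.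
    rewrite ge0_fin_numE ?opE_ge0//.
    apply: (@le_lt_trans _ _ (opE (k u) g1 + c%:E)%E); last by rewrite e1 ltry.
    by rewrite leeDl// lee_fin.
  have h2 : opE (k u) g2 \is a fin_num.
    rewrite ge0_fin_numE ?opE_ge0//.
    apply: (@le_lt_trans _ _ (p%:E + opE (k u) g2)%E); last by rewrite e2 ltry.
    by rewrite leeDr// -pE opE_ge0.
  exists p, v, (fine (opE (k u) g1)), (fine (opE (k u) g2)); split => //.
  - by rewrite fineK.
  - by rewrite fineK.
  - rewrite -(fineK h1) -EFinD in e1; rewrite -(fineK h2) -EFinD in e2.
    by split; [case: e1 => ->|case: e2 => ->].
have [p [v [_ [G2 [pE vle _ G2E [_ e2]]]]]] := key x.
have [p' [v' [G1 [_ [p'E v'le G1E _ [e1 _]]]]]] := key y.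
rewrite /opP pE p'E /=.
have G10 : 0 <= G1 by rewrite -lee_fin -G1E opE_ge0.
have G20 : 0 <= G2 by rewrite -lee_fin -G2E opE_ge0.
have d : p - p' = A * (2 + beta * (v + v')) - (G2 + G1).
  have := e1; have := e2; rewrite !mulrDr !mulr1; lra.
have [s sE] : exists s, s = V x + V y by exists (V x + V y).
rewrite -sE; have s0 : 0 <= s by rewrite sE addr_ge0.
have vv : v + v' <= lam * s + 2 * L by rewrite sE; lra.
have h1 : A * (2 + beta * (v + v')) <= A * (2 + beta * (lam * s + 2 * L)).
  by rewrite ler_wpM2l// lerD2l ler_wpM2l.
have bs : 0 <= beta * s by rewrite mulr_ge0.
have h3 : (1 + lam) / 2 * (beta * s) <= t * (beta * s) by rewrite ler_wpM2r.
rewrite -[leRHS]mulrA.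
have [sM|sM] := leP s M.
(* The same density [N] lies below both kernels, so the two integrals combine into that of
   [g2 + g1 = 2 B], which is at least [2 A]. *)
- have GN : 2 * eps * A <= G2 + G1.
    have Vx : V x <= M by apply: le_trans sM; rewrite sE lerDl.
    have Vy : V y <= M by apply: le_trans sM; rewrite sE lerDr.
    have aux u (g : T -> R) G : V u <= M -> measurable_fun setT g -> (forall z, 0 <= g z) ->
        opE (k u) g = G%:E -> (eps%:E * opE N g <= G%:E)%E.
      move=> Vu mg g0 <-; rewrite -lebintZl ?lee_fin ?(ltW eps0)//; last by nneg.
        apply: lebint_le => z; first by nneg.
        by rewrite muleA lee_wpmul2r ?lee_fin//; exact: minor.
      by mfun.
    have a1 := aux y g1 G1 Vy mg1 g10 G1E.
    have a2 := aux x g2 G2 Vx mg2 g20 G2E.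
    have : (eps%:E * opE N g2 + eps%:E * opE N g1 <= (G2 + G1)%:E)%E.
      by rewrite EFinD leeD.
    rewrite -ge0_muleDr ?opE_ge0// -opED//.
    have lb : ((2 * A)%:E <= opE N (fun z => g2 z + g1 z)%R)%E.
      rewrite -(@opE_cst _ mN N0 N1 (2 * A)); last by rewrite mulr_ge0.
      apply: opE_le => // z; first by rewrite mulr_ge0.
      have : 0 <= A * (beta * V z) by nneg.
      rewrite /g1 /g2 /B; lra.
    move=> /(le_trans _) H; rewrite -lee_fin -mulrA mulrCA EFinM; apply: H.
    by rewrite lee_wpmul2l// lee_fin ltW.
  apply: (@le_trans _ _ (A * (2 + beta * (lam * s + 2 * L) - 2 * eps))).
    rewrite d; apply: le_trans (lerB h1 GN) _.
    by rewrite le_eqVlt; apply/orP; left; apply/eqP; ring.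
  rewrite ler_wpM2l//.
  exact: contraction_near.
- apply: (@le_trans _ _ (A * (2 + beta * (lam * s + 2 * L)))).
    by rewrite d; apply: le_trans h1; rewrite gerBl addr_ge0.
  rewrite ler_wpM2l//.
  by apply: (contraction_far lam1 beta0 t_lam s0 MlE) => //; exact: ltW.
Qed.

Lemma contraction_iter (f : T -> R) : measurable_fun setT f -> (forall y, 0 <= f y <= 1) ->
  forall m, [/\ measurable_fun setT (iter m opP f), (forall y, 0 <= iter m opP f y <= 1) &
   forall x y, iter m opP f x - iter m opP f y <= t ^+ m * (2 + beta * (V x + V y))].
Proof.
move=> mf f01; elim=> [|m [IH1 IH2 IH3]].
  split => //= x y; rewrite expr0 mul1r.
  have := f01 x; have := f01 y => /andP[? ?] /andP[? ?].
  have : 0 <= beta * (V x + V y) by rewrite mulr_ge0 ?addr_ge0// ltW.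
  lra.
split => /=.
- by apply: measurable_opP => // y; have /andP[] := IH2 y.
- exact: opP_bnd.
- by move=> x y; rewrite exprSr; apply: contraction_step => //; rewrite exprn_ge0 ?ltW.
Qed.

End Contraction.

Hypothesis minorization : forall M : R, exists eps : R, exists N : T -> \bar R,
  [/\ 0 < eps, measurable_fun setT N, (forall y, 0 <= N y)%E, lebint N = 1%E &
    forall x, V x <= M -> forall y, (eps%:E * N y <= k x y)%E].

Variable w : T -> \bar R.
Hypothesis mw : measurable_fun setT w.
Hypothesis w0 : forall y, (0 <= w y)%E.
Hypothesis w1 : lebint w = 1%E.
Hypothesis w_inv : forall f : T -> R, measurable_fun setT f -> (forall y, 0 <= f y <= 1) ->
  opE w (opP f) = opE w f.
Hypothesis wV : (opE w V < +oo)%E.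

(* Hairer-Mattingly: one step contracts the seminorm
   [sup |f x - f y| / (2 + beta (V x + V y))]. *)
Theorem harris : exists t C : R, [/\ 0 < t < 1, 0 <= C &
  forall f : T -> R, measurable_fun setT f -> (forall y, 0 <= f y <= 1) ->
  forall m x, [/\ (forall y, 0 <= iter m opP f y <= 1) &
    `| iter m opP f x - fine (opE w f) | <= t ^+ m * (C * (1 + V x))]].
Proof.
have M0 : 2 * (2 * L + 1) <= (1 - lam) * (2 * (2 * L + 1) / (1 - lam)).
  by rewrite [leRHS]mulrC divfK// gt_eqF// subr_gt0.
have [eps [N [e0 mN N0 N1 minor]]] := minorization (2 * (2 * L + 1) / (1 - lam)).
have h : 0 < 2 * (L + 1) by rewrite mulr_gt0// ltr_wpDl.
have [beta b0 bL] : exists2 beta, 0 < beta & 2 * beta * L <= eps.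
  (* [L + 1] in place of [L] keeps the denominator positive when [L = 0]. *)
  exists (eps / (2 * (L + 1))); first by rewrite divr_gt0.
  have -> : 2 * (eps / (2 * (L + 1))) * L = eps * (2 * L) / (2 * (L + 1)) by ring.
  by rewrite ler_pdivrMr// ler_pM2l//; lra.
have [t [t_b t_e t_l t1]] : exists t, [/\ 1 - beta / 2 <= t, 1 - eps / 2 <= t,
    (1 + lam) / 2 <= t & t < 1].
  exists (Num.max (Num.max (1 - beta / 2) (1 - eps / 2)) ((1 + lam) / 2)).
  have := lam1.
  by split; rewrite ?le_max ?lexx ?orbT// !gt_max; apply/andP; split; [apply/andP; split|]; lra.
have t0 : 0 < t by apply: lt_le_trans t_l; rewrite divr_gt0// ltr_pwDl.
have H := contraction_iter M0 e0 mN N0 N1 minor b0 bL t_b t_e t_l.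
have t01 : 0 < t < 1 by rewrite t0.
have wVfin : opE w V \is a fin_num by rewrite ge0_fin_numE// opE_ge0.
pose Cv := fine (opE w V).
have Cv0 : 0 <= Cv by rewrite fine_ge0// opE_ge0.
exists t, (2 + beta * Cv + beta); split => //.
  by rewrite !addr_ge0 ?mulr_ge0 ?(ltW b0).
move=> f mf f01 m x; have [mfm fm01 fmc] := H f mf f01 m.
split => //.
have w_iter : opE w (iter m opP f) = opE w f.
  have {mfm fm01 fmc} := H f mf f01; elim: m => [//|m IH] H'.
  by have [mfm fm01 _] := H' m; rewrite iterS w_inv// IH.
have [c cE c01] := opE_bnd mw w0 w1 f01.
rewrite cE/=; set fm := iter m opP f in w_iter mfm fm01 fmc *.
have fm0 y : 0 <= fm y by have /andP[] := fm01 y.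
have tm0 : 0 <= t ^+ m by rewrite exprn_ge0// ltW.
(* The contraction compares two starting points; averaging the second one over the invariant density
   turns it into a distance to equilibrium. This uses that [V] has a finite mean. *)
pose g y := t ^+ m * (2 + beta * V x) + t ^+ m * beta * V y.
have g0 y : 0 <= g y by rewrite /g; have := ltW b0; nneg.
have mg : measurable_fun setT g by rewrite /g; mfun.
have gE : opE w g = (t ^+ m * (2 + beta * V x + beta * Cv))%:E.
  rewrite /g opED//; try by [mfun|nneg; exact: ltW].
  rewrite opE_cst//; last by nneg; exact: ltW.
  rewrite opEZ//; last by nneg; exact: ltW.
  by rewrite -(fineK wVfin) -EFinM -EFinD -/Cv; congr _%:E; ring.
have fmg y : fm x - fm y <= g y /\ fm y - fm x <= g y.
  by have := fmc x y; have := fmc y x; rewrite /g => ? ?; split; lra.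
have up : fm x - c <= t ^+ m * (2 + beta * V x + beta * Cv).
  rewrite lerBlDr -lee_fin EFinD -gE -cE -w_iter -opED//.
  rewrite -(@opE_cst _ mw w0 w1 (fm x))//; apply: opE_le => // y.
  by have [? _] := fmg y; lra.
have dn : c - fm x <= t ^+ m * (2 + beta * V x + beta * Cv).
  rewrite lerBlDr -lee_fin EFinD -gE -cE -w_iter.
  rewrite -(@opE_cst _ mw w0 w1 (fm x))// -opED//; apply: opE_le => // y.
  by have [_ ?] := fmg y; lra.
have fin : t ^+ m * (2 + beta * V x + beta * Cv) <=
    t ^+ m * ((2 + beta * Cv + beta) * (1 + V x)).
  rewrite ler_wpM2l//; have := V0 x; have := mulr_ge0 (ltW b0) Cv0; nra.
apply: le_trans fin; rewrite ler_norml; lra.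
Qed.

End Harris.

(** * Linear algebra of the model *)

Section FiniteSums.
Variable R : realType.

Lemma sqr_sum_le (I : finType) (u : I -> R) :
  (\sum_i u i) ^+ 2 <= #|I|%:R * \sum_i u i ^+ 2.
Proof.
rewrite expr2 mulr_suml.
apply: (@le_trans _ _ (\sum_i \sum_j (u i ^+ 2 / 2 + u j ^+ 2 / 2))).
  apply: ler_sum => i _; rewrite mulr_sumr; apply: ler_sum => j _.
  have := sqr_ge0 (u i - u j); rewrite sqrrB; lra.
have -> : \sum_i \sum_j (u i ^+ 2 / 2 + u j ^+ 2 / 2) =
    \sum_i (u i ^+ 2 * (#|I|%:R / 2) + (\sum_j u j ^+ 2) / 2).
  apply: eq_bigr => i _; rewrite big_split/= sumr_const -mulr_suml -mulr_natr.
  by congr (_ + _); ring.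
rewrite big_split/= sumr_const -mulr_suml -mulr_natr.
by rewrite le_eqVlt; apply/orP; left; apply/eqP; rewrite cardT -cardE; field.
Qed.

Lemma sqr_lincomb_le (I : finType) (c u : I -> R) :
  (\sum_i c i * u i) ^+ 2 <= #|I|%:R * (\sum_i c i ^+ 2) * \sum_i u i ^+ 2.
Proof.
apply: le_trans (sqr_sum_le _) _; rewrite -mulrA ler_wpM2l//.
rewrite mulr_suml; apply: ler_sum => i _; rewrite exprMn ler_wpM2l ?sqr_ge0//.
by rewrite (bigD1 i)//= lerDl sumr_ge0// => j _; rewrite sqr_ge0.
Qed.

Lemma le_sum_term (I : finType) (F : I -> R) i : (forall i, 0 <= F i) -> F i <= \sum_i F i.
Proof. by move=> F0; rewrite (bigD1 i)//= lerDl sumr_ge0. Qed.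

(** A vanishing sum with positive weights balances the negative parts against the positive ones.
    Each single negative part is thus a bounded combination of the positive parts, and
    Cauchy-Schwarz passes to squares. *)
Lemma sum_neg_parts_le (n : nat) (e : 'I_n -> R) : (forall i, 0 < e i) ->
  exists2 kap : R, 0 <= kap & forall x : 'I_n -> R, \sum_i e i * x i = 0 ->
    \sum_i Num.max 0 (- x i) ^+ 2 <= kap * \sum_i Num.max 0 (x i) ^+ 2.
Proof.
move=> e0.
pose K : R := \sum_l n%:R * \sum_i (e i / e l) ^+ 2.
exists K; first by rewrite /K; nneg.
move=> x ex; rewrite mulr_suml; apply: ler_sum => l _.
have m0 (z : R) : 0 <= Num.max 0 z by rewrite le_max lexx.
have H : Num.max 0 (- x l) <= \sum_i e i / e l * Num.max 0 (x i).
  have h1 : \sum_i e i * Num.max 0 (- x i) = \sum_i e i * Num.max 0 (x i).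
    apply/esym/eqP; rewrite -subr_eq0 -sumrB; apply/eqP; rewrite -[RHS]ex.
    apply: eq_bigr => i _; rewrite -mulrBr; congr (_ * _).
    have [x0|x0] := leP 0 (x i).
      by rewrite max_l ?oppr_le0//; ring.
    by rewrite max_r ?oppr_ge0 ?ltW//; ring.
  have h2 : e l * Num.max 0 (- x l) <= \sum_i e i * Num.max 0 (- x i).
    by apply: (@le_sum_term _ (fun i => e i * Num.max 0 (- x i))) => i; rewrite mulr_ge0 ?(ltW (e0 _)).
  rewrite h1 in h2; rewrite -(ler_pM2l (e0 l)); apply: le_trans h2 _.
  rewrite mulr_sumr le_eqVlt; apply/orP; left; apply/eqP; apply: eq_bigr => i _.
  by field; rewrite gt_eqF.
have := sqr_lincomb_le (fun i => e i / e l) (fun i => Num.max 0 (x i)).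
rewrite card_ord; apply: le_trans.
by rewrite ler_sqr// nnegrE ?m0// (le_trans (m0 _) H).
Qed.

Lemma sqr_max_parts (x : R) : x ^+ 2 = Num.max 0 x ^+ 2 + Num.max 0 (- x) ^+ 2.
Proof.
have [x0|x0] := leP 0 x.
  by rewrite max_l ?oppr_le0//; ring.
by rewrite max_r ?oppr_ge0 ?ltW//; ring.
Qed.

End FiniteSums.

(** * Coordinate blocks of the random effects *)

Section Blocks.
Variables (r : nat) (qj : 'I_r -> nat).
Notation q := (qsum qj).

Let pre (j : 'I_r) := (\sum_(l < r | (l < j)%N) qj l)%N.

Let preS (j : 'I_r) : (\sum_(l < r | (l <= j)%N) qj l = pre j + qj j)%N.
Proof.
rewrite (bigD1 j)//= addnC; congr (_ + _)%N; apply: eq_bigl => l.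
by rewrite ltn_neqAle andbC.
Qed.

Let pre_mono (j l : 'I_r) : (j < l)%N -> (pre j + qj j <= pre l)%N.
Proof.
move=> jl; rewrite -preS /pre big_mkcond [leqRHS]big_mkcond /=; apply: leq_sum => i _.
by case: ifP => // ij; rewrite (leq_ltn_trans ij jl).
Qed.

Let pre_q (j : 'I_r) : (pre j + qj j <= q)%N.
Proof. by rewrite -preS /qsum big_mkcond; apply: leq_sum => i _; case: ifP. Qed.

Lemma inblk_uniq j l (k : 'I_q) : inblk j k -> inblk l k -> j = l.
Proof.
rewrite /inblk !preS => /andP[j1 j2] /andP[l1 l2]; apply/val_inj/eqP.
rewrite eqn_leq; apply/andP; split; rewrite leqNgt; apply/negP => /pre_mono H.
  by have := leq_trans l2 (leq_trans H j1); rewrite ltnn.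
by have := leq_trans j2 (leq_trans H l1); rewrite ltnn.
Qed.

Lemma card_inblk j : #|(fun k : 'I_q => inblk j k)| = qj j.
Proof.
rewrite -sum1_card.
transitivity (\sum_(k < q | (pre j <= k)%N && (k < pre j + qj j)%N) 1)%N.
  by apply: eq_bigl => k; rewrite unfold_in /inblk preS.
rewrite (big_ord_narrow_cond (pre_q j)).
by rewrite -(big_geq_mkord _ _ xpredT (fun _ => 1%N)) sum_nat_const_nat muln1 addKn.
Qed.

End Blocks.

Section ModelAlgebra.
Variables (R : realType) (n p r : nat) (qj : 'I_r -> nat).
Notation q := (qsum qj).
Notation d := (p + qsum qj)%N.
Variables (X : 'M[R]_(n, p)) (Z : 'M[R]_(n, q)) (y : 'I_n -> bool).
Notation W := (W X Z).
Notation lin := (lin X Z).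
Notation Sigma := (Sigma X Z).

(** The block [u_j] as a predicate on all coordinates of [eta], false on those of [beta], so that
    Gaussian bounds for [eta] apply without splitting the vector. *)
Definition uidx (j : 'I_r) (i : 'I_d) : bool :=
  match fintype.split i with inl _ => false | inr k => inblk j k end.

Lemma uidx_rshift j k : uidx j (rshift p k) = inblk j k.
Proof. by rewrite /uidx (unsplitK (inr k)). Qed.

Lemma uidx_lshift j k : uidx j (lshift q k) = false.
Proof. by rewrite /uidx (unsplitK (inl k)). Qed.

Lemma usqE (eta : d.-tuple R) j : usq eta j = \sum_(i | uidx j i) tnth eta i ^+ 2.
Proof.
rewrite big_split_ord/= big1 ?add0r => [|k]; last by rewrite uidx_lshift.
by apply: eq_bigl => k; rewrite uidx_rshift.
Qed.

Lemma card_uidx j : #|uidx j| = qj j.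
Proof.
rewrite -(card_inblk qj j) -!sum1_card big_split_ord/= big1 ?add0n => [|k].
  by apply: eq_bigl => k; rewrite -[LHS]/(uidx j (rshift p k)) uidx_rshift.
by rewrite -[X in is_true X -> _]/(uidx j (lshift q k)) uidx_lshift.
Qed.

Lemma usq_ge0 (eta : d.-tuple R) j : 0 <= usq eta j.
Proof. by apply: sumr_ge0 => k _; rewrite sqr_ge0. Qed.

Definition V1 (eta : d.-tuple R) : R := \sum_i lin eta i ^+ 2.

Lemma V1E eta : V1 eta = \sum_i lin eta i ^+ 2. Proof. by []. Qed.

Lemma V1_ge0 eta : 0 <= V1 eta. Proof. by apply: sumr_ge0 => k _; rewrite sqr_ge0. Qed.

Lemma qf_WW (eta : d.-tuple R) : qf (W^T *m W) (tcol eta) = V1 eta.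
Proof.
rewrite /qf mulmxA -mulmxA -trmx_mul mxE; apply: eq_bigr => i _.
by rewrite mxE expr2.
Qed.

Lemma qf_Sigma (tau : r.-tuple R) (eta : d.-tuple R) :
  qf (Sigma tau) (tcol eta) = V1 eta + \sum_j tnth tau j * usq eta j.
Proof.
rewrite qfDS qf_WW; congr (_ + _).
have -> : tcol eta = col_mx (\col_i tnth eta (lshift q i)) (\col_k ucoord eta k).
  apply/matrixP => i j; rewrite ord1; case: (split_ordP i) => l ->.
    by rewrite col_mxEu !mxE.
  by rewrite col_mxEd !mxE.
rewrite /qf tr_col_mx mul_row_block !mulmx0 !add0r mul_row_col mul0mx add0r.
rewrite mxE.
under eq_bigr => k _.
  rewrite mxE (bigD1 k)//= big1 => [|l lk]; last first.
    by rewrite [X in _ * X]mxE (negbTE lk) mul0r mulr0.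
  rewrite addr0 [X in _ * X * _]mxE eqxx mul1r !mxE mulrAC mulr_sumr.
  over.
rewrite /= (exchange_big_dep xpredT)//=.
apply: eq_bigr => j _; rewrite /usq mulr_sumr; apply: eq_bigr => k _.
by rewrite expr2 mulrC.
Qed.

Lemma tcol_ex (x : 'cV[R]_d) : exists eta : d.-tuple R, x = tcol eta.
Proof.
exists [tuple x i 0 | i < d]; apply/matrixP => i j.
by rewrite ord1 mxE tnth_mktuple.
Qed.

Section FullRank.
Hypothesis rkW : \rank W = d.

Lemma left_inverse : exists B : 'M[R]_(d, n), B *m W = 1%:M.
Proof.
have : row_full W by rewrite /row_full rkW.
by move=> /row_fullP[B HB]; exists B.
Qed.

Lemma sumsq_le_V1 : exists2 C : R, 0 < C &
  forall eta : d.-tuple R, \sum_i tnth eta i ^+ 2 <= C * V1 eta.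
Proof.
have [B BW] := left_inverse.
pose K := \sum_i n%:R * \sum_l B i l ^+ 2.
have K0 : 0 <= K by rewrite /K; nneg.
exists (K + 1); first by rewrite ltr_wpDl.
move=> eta; apply: (@le_trans _ _ (K * V1 eta)); last first.
  by rewrite ler_wpM2r ?V1_ge0// lerDl.
rewrite mulr_suml; apply: ler_sum => i _.
have -> : tnth eta i = \sum_l B i l * lin eta l.
  have : (B *m (W *m tcol eta)) i 0 = tnth eta i by rewrite mulmxA BW mul1mx mxE.
  by rewrite mxE.
have := sqr_lincomb_le (fun l => B i l) (fun l => lin eta l).
by rewrite card_ord.
Qed.

Lemma usq_le_V1 : exists2 C : R, 0 < C & forall (eta : d.-tuple R) j, usq eta j <= C * V1 eta.
Proof.
have [C C0 H] := sumsq_le_V1; exists C => // eta j.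
apply: le_trans (H eta); rewrite usqE [leLHS]big_mkcond; apply: ler_sum => i _.
by case: ifP => // _; rewrite sqr_ge0.
Qed.

Lemma Sigma_sym tau : (Sigma tau)^T = Sigma tau.
Proof.
rewrite /Defs.Sigma linearD/= trmx_mul trmxK tr_block_mx !trmx0; congr (_ + block_mx _ _ _ _).
apply/matrixP => k l; rewrite !mxE eq_sym; have [->//|kl] := eqVneq k l.
by rewrite !mul0r.
Qed.

Lemma Sigma_posdef (tau : r.-tuple R) : (forall j, 0 < tnth tau j) -> posdef (Sigma tau).
Proof.
move=> tau0; split; first exact: Sigma_sym.
move=> x; have [eta ->] := tcol_ex x => eta0.
have [C C0 H] := sumsq_le_V1.
rewrite qf_Sigma ltr_pwDl//; last first.
  by apply: sumr_ge0 => j _; rewrite mulr_ge0 ?usq_ge0 ?(ltW (tau0 _)).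
have : 0 < \sum_i tnth eta i ^+ 2.
  rewrite lt0r sumr_ge0 ?andbT => [|i _]; last by rewrite sqr_ge0.
  apply: contraNneq eta0 => /eqP; rewrite psumr_eq0 => [/allP E|i _]; last by rewrite sqr_ge0.
  apply/eqP/matrixP => i j; rewrite !mxE.
  by have := E i; rewrite mem_index_enum sqrf_eq0 => /(_ isT)/eqP.
by move=> /lt_le_trans/(_ (H eta)); rewrite pmulr_rgt0.
Qed.

(** For the conditional mean [m], [|W m|^2 <= m^T Sigma m = (W m)^T v], and this is at most half of
    [|W m|^2 + |v|^2]. No constant depends on [tau]. *)
Lemma WSigma_contract (tau : r.-tuple R) (v : n.-tuple R) : (forall j, 0 < tnth tau j) ->
  qf (W^T *m W) (invmx (Sigma tau) *m (W^T *m tcol v)) <= \sum_i tnth v i ^+ 2.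
Proof.
move=> tau0; set m := invmx _ *m _; have SP := Sigma_posdef tau0; have SU := posdef_unit SP.
have [eta mE] := tcol_ex m; rewrite mE qf_WW.
have h1 : V1 eta <= qf (Sigma tau) (tcol eta).
  rewrite qf_Sigma lerDl sumr_ge0// => j _.
  by rewrite mulr_ge0 ?usq_ge0 ?(ltW (tau0 _)).
have h2 : qf (Sigma tau) (tcol eta) = \sum_i lin eta i * tnth v i.
  have Sm : Sigma tau *m m = W^T *m tcol v by rewrite /m mulKVmx.
  rewrite -mE /qf -mulmxA Sm mulmxA -trmx_mul mE.
  by rewrite mxE; apply: eq_bigr => i _; rewrite [tcol v _ _]mxE [(_^T) _ _]mxE.
have h3 : \sum_i lin eta i * tnth v i <= V1 eta / 2 + (\sum_i tnth v i ^+ 2) / 2.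
  rewrite /V1 !mulr_suml -big_split; apply: ler_sum => i _ /=.
  by have := sqr_ge0 (lin eta i - tnth v i); rewrite sqrrB; lra.
lra.
Qed.

(** The blocks are disjoint, so an entry in block [j] is one of [W^T W], bounded through its trace,
    plus [tau_j]. The coefficient 1 of [tau_j] matters: it passes into the leading term of the drift
    of [V2]. *)
Lemma Sigma_diag_le : exists2 Lam : R, 0 < Lam & forall (tau : r.-tuple R) j i, uidx j i ->
  Sigma tau i i <= Lam + tnth tau j.
Proof.
exists (1 + \sum_i (W^T *m W) i i); last first.
  move=> tau j i; case: (split_ordP i) => k ->; first by rewrite uidx_lshift.
  rewrite uidx_rshift => jk; rewrite /Defs.Sigma mxE block_mxEdr [Dmx _ _ _ _]mxE eqxx mul1r.
  rewrite (big_pred1 j) => [|l]; last first.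
    by apply/idP/eqP => [lk|->//]; exact: inblk_uniq lk jk.
  rewrite lerD2r -[leLHS]add0r lerD//.
  apply: (@le_sum_term _ _ (fun i => (W^T *m W) i i)) => l.
  by rewrite mxE; apply: sumr_ge0 => h _; rewrite !mxE -expr2 sqr_ge0.
rewrite ltr_pwDl// sumr_ge0// => l _.
by rewrite mxE; apply: sumr_ge0 => h _; rewrite !mxE -expr2 sqr_ge0.
Qed.

End FullRank.

Section NegPart.
Hypothesis A2 : exists e : 'rV[R]_n, (forall i, 0 < e 0 i) /\ e *m Wstar X Z y = 0.

Lemma Wstar_parts : exists2 kap : R, 0 <= kap & forall eta : d.-tuple R,
  \sum_i Num.max 0 (- (cc R y i * lin eta i)) ^+ 2 <=
  kap * \sum_i Num.max 0 (cc R y i * lin eta i) ^+ 2.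
Proof.
have [e [e0 eW]] := A2.
have [kap k0 H] := @sum_neg_parts_le R n (fun i => e 0 i) e0.
exists kap => // eta; apply: H.
have : (e *m Wstar X Z y *m tcol eta) 0 0 = 0 by rewrite eW mul0mx mxE.
rewrite -mulmxA mxE => {2}<-; apply: eq_bigr => i _; congr (_ * _).
rewrite /Defs.lin !mxE mulr_sumr; apply: eq_bigr => k _.
by rewrite !mxE mulrA.
Qed.

Lemma V1_parts eta : V1 eta = \sum_i Num.max 0 (cc R y i * lin eta i) ^+ 2 +
  \sum_i Num.max 0 (- (cc R y i * lin eta i)) ^+ 2.
Proof.
rewrite -big_split; apply: eq_bigr => i _ /=; rewrite -sqr_max_parts exprMn.
by rewrite /cc; case: (y i) => /=; ring.
Qed.

(** Negative parts belong to correctly classified coordinates. They are at most [kap] times the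
    positive parts, hence at most the fraction [kap / (1 + kap)] of the total. *)
Lemma negpart_le : exists lam : R, [/\ 0 <= lam, lam < 1 & forall eta : d.-tuple R,
  \sum_i Num.max 0 (- (cc R y i * lin eta i)) ^+ 2 <= lam * V1 eta].
Proof.
have [kap k0 H] := Wstar_parts; have k1 : 0 < 1 + kap by rewrite ltr_pwDl.
exists (kap / (1 + kap)); split.
- by rewrite divr_ge0// ltW.
- by rewrite ltr_pdivrMr// mul1r; lra.
- move=> eta; have := H eta; rewrite V1_parts mulrAC ler_pdivlMr//; lra.
Qed.

(** The complementary share, on misclassified coordinates; it forces the likelihood to decay in
    every direction. *)
Lemma pospart_ge : exists2 c : R, 0 < c & forall eta : d.-tuple R,
  c * V1 eta <= \sum_i Num.max 0 (cc R y i * lin eta i) ^+ 2.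
Proof.
have [kap k0 H] := Wstar_parts; have k1 : 0 < 1 + kap by rewrite ltr_pwDl.
exists (1 + kap)^-1; first by rewrite invr_gt0.
by move=> eta; have Hk := H eta; rewrite V1_parts [leLHS]mulrC ler_pdivrMr//; lra.
Qed.

End NegPart.

End ModelAlgebra.

(** * Gamma densities *)

Section GammaDensity.
Variable R : realType.
Notation mu := (@lebesgue_measure R).

Ltac mfun_user ::= first [apply: mfun_phi|apply: mfun_tn_set|apply: mfun_tn_pdf|apply: measurable_gamma_un].

Lemma gamma_pdfE (al be x : R) : 0 < al -> 0 < be ->
  gamma_pdf al be x = gamma_un al be x * (be `^ al / Gam al).
Proof.
move=> al0 be0; rewrite /gamma_pdf integral_gamma_un//= powRN invfM invrK.
by rewrite [X in _ * X]mulrC.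
Qed.

Lemma gamma_pdf_ge0 (al be x : R) : 0 <= gamma_pdf al be x.
Proof.
rewrite mulr_ge0 ?gamma_un_ge0// invr_ge0 fine_ge0//.
by apply: integral_ge0 => t _; rewrite lee_fin gamma_un_ge0.
Qed.

Lemma gamma_pdf_le0 (al be x : R) : x <= 0 -> gamma_pdf al be x = 0.
Proof. by move=> x0; rewrite /gamma_pdf /gamma_un ltNge x0 /= mul0r. Qed.

Lemma mfun_gamma_pdf d (T : measurableType d) al (f g : T -> R) :
  measurable_fun setT f -> measurable_fun setT g ->
  measurable_fun setT (fun x => gamma_pdf al (f x) (g x)).
Proof.
move=> mf mg; rewrite /gamma_pdf; mfun.
apply: (@mfun_fine_integral _ _ _ (fun x t => gamma_un al (f x) t)).
  by mfun; apply: (measurableT_comp mf); mfun.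
by move=> x t; exact: gamma_un_ge0.
Qed.

Lemma integral_gamma_pdf_moment (al be c : R) : 0 < al -> 0 < be -> 0 < al + c ->
  (\int[mu]_x (gamma_pdf al be x * x `^ c)%:E = (Gam (al + c) / Gam al * be `^ (- c))%:E)%E.
Proof.
move=> al0 be0 ac0; have G0 := Gam_gt0 al0.
transitivity (\int[mu]_x ((be `^ al / Gam al)%:E * (gamma_un (al + c) be x)%:E))%E.
  apply: eq_integral => x _; rewrite -EFinM; congr _%:E.
  rewrite gamma_pdfE// /gamma_un; case: ifP => x0; last by rewrite !mul0r mulr0.
  have -> : x `^ (al + c - 1) = x `^ (al - 1) * x `^ c.
    by rewrite -powRD ?(gt_eqF x0) ?implybT//; congr powR; ring.
  by ring.
rewrite ge0_integralZl_EFin//; first last.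
- by rewrite divr_ge0 ?powR_ge0// ltW.
- by mfun.
- by move=> x _; rewrite lee_fin gamma_un_ge0.
rewrite integral_gamma_un// -EFinM; congr _%:E.
have -> : be `^ (- (al + c)) = be `^ (- al) * be `^ (- c).
  by rewrite -powRD ?(gt_eqF be0) ?implybT//; congr powR; ring.
have : be `^ al * be `^ (- al) = 1.
  by rewrite -powRD ?(gt_eqF be0) ?implybT// subrr powRr0.
set u := be `^ al; set v := be `^ (- al) => uv.
transitivity (u * v * (Gam (al + c) / Gam al * be `^ (- c))); first by ring.
by rewrite uv mul1r.
Qed.

Lemma integral_gamma_pdf (al be : R) : 0 < al -> 0 < be ->
  (\int[mu]_x (gamma_pdf al be x)%:E = 1)%E.
Proof.
move=> al0 be0; have /gt_eqF/negbT G0 := Gam_gt0 al0.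
have -> : (1 = (Gam (al + 0) / Gam al * be `^ (- 0))%:E)%E.
  by rewrite addr0 oppr0 powRr0 mulr1 mulfV.
rewrite -integral_gamma_pdf_moment ?addr0//.
by apply: eq_integral => x _; rewrite powRr0 mulr1.
Qed.

Lemma gamma_pdf_lb (al b0 b1 : R) : 0 < al -> 0 < b0 ->
  exists2 e : R, 0 < e & forall be x, b0 <= be -> be <= b1 -> 1 < x < 2 -> e <= gamma_pdf al be x.
Proof.
move=> al0 b00; have G0 := Gam_gt0 al0.
(* On []1, 2[] the power is [x ^ al / x >= 1 / 2]; the exponential is bounded at [x = 2] with rate
   [b1], the normalizing factor at rate [b0]. *)
exists (2^-1 * expR (- (b1 * 2)) * (b0 `^ al / Gam al)).
  by rewrite !mulr_gt0 ?expR_gt0 ?powR_gt0 ?invr_gt0.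
move=> be x b0be beb1 /andP[x1 x2].
have be0 : 0 < be by exact: lt_le_trans b0be.
have x0 : 0 < x by exact: lt_trans x1.
rewrite gamma_pdfE// /gamma_un x0; apply: ler_pM.
- by rewrite mulr_ge0 ?expR_ge0.
- by rewrite divr_ge0 ?powR_ge0// ltW.
- apply: ler_pM; [by rewrite invr_ge0|exact: expR_ge0| |].
    rewrite powRB ?(gt_eqF x0) ?implybT// powRr1 ?(ltW x0)// ler_pdivlMr//.
    have : 1 <= x `^ al by have := @ler_powR R x (ltW x1) 0 al (ltW al0); rewrite powRr0.
    by lra.
  by rewrite ler_expR lerN2; apply: ler_pM; rewrite ?(ltW be0) ?(ltW x0) ?(ltW x2).
- rewrite ler_pM2r ?invr_gt0//.
  by apply: ge0_ler_powR; rewrite ?nnegrE ?(ltW al0) ?(ltW b00) ?(ltW be0).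
Qed.

(** A rescaled Beta integral; with rate 0 [gamma_un] is the bare power. The factor of exponent [-h]
    is written as a Gamma integral over [y], and after Tonelli both integrations are Gamma
    integrals. *)
Lemma beta_integral (c h P : R) : 0 < c -> c < h -> 0 < P ->
  (\int[mu]_s (gamma_un c 0 s * (1 + 2 * s / P) `^ (- h))%:E =
   (Gam c * (Gam (h - c) / Gam h * (P / 2) `^ c))%:E)%E.
Proof.
move=> c0 ch P0; have h0 : 0 < h by exact: lt_trans ch.
have hc0 : 0 < h - c by rewrite subr_gt0.
have G0 := Gam_gt0 h0.
pose F (s y : R) : R := (Gam h)^-1 * (gamma_un c 0 s * gamma_un h (1 + 2 * s / P) y).
have F0 s y : (0 <= (F s y)%:E)%E.
  by rewrite lee_fin !mulr_ge0 ?gamma_un_ge0// invr_ge0 ltW.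
have mF : measurable_fun setT (fun z : R * R => (F z.1 z.2)%:E).
  by rewrite /F; mfun.
have L : (\int[mu]_s \int[mu]_y (F s y)%:E =
    \int[mu]_s (gamma_un c 0 s * (1 + 2 * s / P) `^ (- h))%:E)%E.
  apply: eq_integral => s _.
  have [s0|s0] := ltP 0 s; last first.
    have g0 : gamma_un c 0 s = 0 by rewrite /gamma_un ltNge s0.
    by rewrite g0 mul0r integral0_eq// => y _; rewrite /F g0 mul0r mulr0.
  have b0 : 0 < 1 + 2 * s / P by rewrite addr_gt0// divr_gt0// mulr_gt0.
  under eq_integral do rewrite /F mulrA EFinM.
  rewrite ge0_integralZl_EFin//; first last.
  - by rewrite mulr_ge0 ?gamma_un_ge0// invr_ge0 ltW.
  - by mfun.
  - by move=> x _; rewrite lee_fin gamma_un_ge0.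
  rewrite integral_gamma_un// -EFinM; congr _%:E.
  by field; rewrite gt_eqF.
rewrite -L (@fubini_tonelli _ _ _ _ _ mu mu (fun z => (F z.1 z.2)%:E))//=.
transitivity (\int[mu]_y ((Gam c * (P / 2) `^ c / Gam h)%:E * (gamma_un (h - c) 1 y)%:E))%E.
  apply: eq_integral => y _; have [y0|y0] := ltP 0 y; last first.
    have g0 t b' : gamma_un t b' y = 0 by rewrite /gamma_un ltNge y0.
    by rewrite g0 mule0 integral0_eq// => s _; rewrite /F g0 !mulr0.
  have b0 : 0 < 2 * y / P by rewrite divr_gt0// mulr_gt0.
  transitivity (\int[mu]_s (((Gam h)^-1 * gamma_un h 1 y)%:E * (gamma_un c (2 * y / P) s)%:E))%E.
    apply: eq_integral => s _; rewrite -EFinM; congr _%:E.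
    rewrite /F /gamma_un y0; case: ifP => s0; last by rewrite mul0r !mulr0.
    have -> : expR (- ((1 + 2 * s / P) * y)) = expR (- (1 * y)) * expR (- (2 * y / P * s)).
      by rewrite -expRD; congr expR; field; rewrite gt_eqF.
    by rewrite mul0r oppr0 expR0; ring.
  rewrite ge0_integralZl_EFin//; first last.
  - by rewrite mulr_ge0 ?gamma_un_ge0// invr_ge0 ltW.
  - by mfun.
  - by move=> x _; rewrite lee_fin gamma_un_ge0.
  rewrite integral_gamma_un// -!EFinM; congr _%:E.
  have -> : (2 * y / P) `^ (- c) = y `^ (- c) * (P / 2) `^ c.
    rewrite (_ : 2 * y / P = y * (P / 2)^-1); last by field; rewrite gt_eqF.
    rewrite powRM ?(ltW y0) ?invr_ge0 ?divr_ge0 ?(ltW P0)//; congr (_ * _).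
    rewrite -[(P / 2)^-1]powR_inv1 ?divr_ge0 ?(ltW P0)// -powRrM.
    by congr powR; ring.
  rewrite /gamma_un y0.
  have -> : y `^ (h - c - 1) = y `^ (h - 1) * y `^ (- c).
    by rewrite -powRD ?(gt_eqF y0) ?implybT//; congr powR; ring.
  by ring.
rewrite ge0_integralZl_EFin//; first last.
- by apply: divr_ge0; [apply: mulr_ge0; [exact: ltW (Gam_gt0 c0)|exact: powR_ge0]|exact: ltW G0].
- by mfun.
- by move=> x _; rewrite lee_fin gamma_un_ge0.
by rewrite (GamE hc0) -EFinM; congr _%:E; ring.
Qed.

(** With [(1 + k) ^ c = 1 + e], either [Lam <= k t] and the factor [1 + e] suffices, or [t] is
    bounded. Keeping the leading coefficient close to 1 preserves the strict drift inequality. *)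
Lemma powRD_le (Lam c e : R) : 0 < Lam -> 0 < c -> 0 < e ->
  exists2 C : R, 0 <= C & forall t, 0 < t -> (Lam + t) `^ c <= (1 + e) * t `^ c + C.
Proof.
move=> L0 c0 e0.
pose k := (1 + e) `^ c^-1 - 1.
have k1 : (1 + k) `^ c = 1 + e.
  by rewrite /k addrC subrK -powRrM mulVf ?gt_eqF// powRr1// addr_ge0// ltW.
have k0 : 0 < k.
  rewrite /k subr_gt0.
  have := @gt0_ltr_powR R c^-1; rewrite invr_gt0 => /(_ c0 1 (1 + e)).
  by rewrite powR1; apply; rewrite ?nnegrE ?addr_ge0 ?(ltW e0)// ltrDl.
exists ((Lam + Lam / k) `^ c); first exact: powR_ge0.
move=> t t0; have [Lt|Lt] := leP Lam (k * t).
  rewrite -[leLHS]addr0 lerD ?powR_ge0// -k1 -powRM ?(ltW t0)//; last first.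
    by rewrite addr_ge0// ltW.
  rewrite ge0_ler_powR ?(ltW c0)// ?nnegrE; last by lra.
    by rewrite addr_ge0// ltW.
  by rewrite mulr_ge0 ?(ltW t0)// addr_ge0// ltW.
rewrite -[leLHS]add0r lerD//; first by rewrite mulr_ge0 ?powR_ge0// addr_ge0// ltW.
rewrite ge0_ler_powR ?(ltW c0)// ?nnegrE.
- by rewrite addr_ge0// ltW.
- by rewrite addr_ge0 ?divr_ge0// ltW.
- by rewrite lerD2l ler_pdivlMr// mulrC ltW.
Qed.

Lemma lebint_prod1 k (g : 'I_k -> R -> R) :
  (forall i, measurable_fun setT (g i)) -> (forall i x, 0 <= g i x) ->
  (forall i, \int[mu]_x (g i x)%:E = 1)%E ->
  lebint (fun t : k.-tuple R => (\prod_i g i (tnth t i))%:E) = 1%E.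
Proof.
move=> mg g0 g1; rewrite (@lebint_prod R k g (fun=> 1))//.
by rewrite big1.
Qed.

Lemma lebint_prod_at k (g : 'I_k -> R -> R) i (h : R -> R) (c : R) :
  (forall i, measurable_fun setT (g i)) -> (forall i x, 0 <= g i x) ->
  (forall i, \int[mu]_x (g i x)%:E = 1)%E ->
  measurable_fun setT h -> (forall x, 0 <= h x) ->
  (\int[mu]_x (g i x * h x)%:E = c%:E)%E ->
  lebint (fun t : k.-tuple R => ((\prod_l g l (tnth t l)) * h (tnth t i))%:E) = c%:E.
Proof.
move=> mg g0 g1 mh h0 gh.
pose G l x := g l x * (if l == i then h x else 1).
transitivity (lebint (fun t : k.-tuple R => (\prod_l G l (tnth t l))%:E)).
  apply: eq_lebint => t; congr _%:E; rewrite big_split/=; congr (_ * _).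
  by rewrite -big_mkcond/= big_pred1_eq.
transitivity ((\prod_l (if l == i then c else 1))%:E : \bar R); last first.
  by rewrite -big_mkcond/= big_pred1_eq.
apply: lebint_prod.
- by move=> l; rewrite /G; case: eqP => _; mfun; exact: mg.
- by move=> l x; rewrite /G; case: eqP => _; rewrite ?mulr1 ?mulr_ge0.
- move=> l; rewrite /G; case: eqP => [->//|_]; rewrite -(g1 l).
  by apply: eq_integral => x _; rewrite mulr1.
Qed.

End GammaDensity.

(** * The transition kernel *)

Section OpSum.
Variables (R : realType) (D : nat) (w : D.-tuple R -> \bar R).
Hypothesis mw : measurable_fun setT w.
Hypothesis w0 : forall y, (0 <= w y)%E.

Lemma opE_sum I (s : seq I) (P : pred I) (F : I -> D.-tuple R -> R) :
  (forall i, measurable_fun setT (F i)) -> (forall i y, 0 <= F i y) ->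
  opE w (fun v => \sum_(i <- s | P i) F i v) = (\sum_(i <- s | P i) opE w (F i))%E.
Proof.
move=> mF F0; elim: s => [|i s IH].
  rewrite big_nil /opE (eq_lebint (g := fun _ => 0%:E * 0)%E); last first.
    by move=> t; rewrite big_nil !mule0.
  by rewrite lebintZl ?mul0e.
rewrite big_cons -IH; case: ifP => Pi; last first.
  by apply: eq_lebint => t; rewrite big_cons Pi.
rewrite -opED//; try by nneg.
  by apply: eq_lebint => t; rewrite big_cons Pi.
by mfun.
Qed.

End OpSum.

Section Kernel.
Variables (R : realType) (n p r : nat) (qj : 'I_r -> nat).
Notation mu := (@lebesgue_measure R).
Notation q := (qsum qj).
Notation d := (p + qsum qj)%N.
Variables (X : 'M[R]_(n, p)) (Z : 'M[R]_(n, q)) (y : 'I_n -> bool) (a b : 'I_r -> R).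
Notation W := (W X Z).
Notation lin := (lin X Z).
Notation Sigma := (Sigma X Z).
Notation V1 := (V1 X Z).
Notation tau_cond := (@Defs.tau_cond R p r qj a b).
Notation v_cond := (v_cond X Z y).
Notation kden := (kden X Z y a b).
Notation al j := (a j + (qj j)%:R / 2).
Hypothesis rkW : \rank W = d.
Hypothesis al_gt0 : forall j, 0 < al j.

Ltac mfun_user ::= first [apply: mfun_phi|apply: mfun_tn_set|apply: mfun_tn_pdf
  |apply: measurable_gamma_un|apply: mfun_gamma_pdf].
Ltac nneg_user ::= first [exact: phi_ge0|exact: tn_pdf_ge0|exact: gamma_un_ge0
  |exact: mvn_pdf_ge0|exact: gamma_pdf_ge0|exact: usq_ge0|exact: V1_ge0].

Definition rate (eta : d.-tuple R) j := b j + usq eta j / 2.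

Definition tau_fac (eta : d.-tuple R) j (t : R) :=
  if 0 < rate eta j then gamma_pdf (al j) (rate eta j) t else gamma_pdf 1 1 t.

Lemma tau_condE eta tau : tau_cond eta tau = \prod_j tau_fac eta j (tnth tau j).
Proof. by []. Qed.

Lemma tau_fac_ge0 eta j t : 0 <= tau_fac eta j t.
Proof. by rewrite /tau_fac; case: ifP => _; exact: gamma_pdf_ge0. Qed.

Lemma tau_fac_le0 eta j t : t <= 0 -> tau_fac eta j t = 0.
Proof. by move=> t0; rewrite /tau_fac !gamma_pdf_le0// if_same. Qed.

Lemma integral_tau_fac eta j : (\int[mu]_t (tau_fac eta j t)%:E = 1)%E.
Proof.
rewrite /tau_fac; case: (boolP (0 < rate eta j)) => r0; exact: integral_gamma_pdf.
Qed.

Section Meas.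
Context dd (T : measurableType dd).

Lemma mfun_ucoord k (f : T -> d.-tuple R) : measurable_fun setT f ->
  measurable_fun setT (fun x => ucoord (f x) k : R).
Proof. by move=> mf; rewrite /ucoord; mfun. Qed.

Lemma mfun_usq j (f : T -> d.-tuple R) : measurable_fun setT f ->
  measurable_fun setT (fun x => usq (f x) j).
Proof. by move=> mf; rewrite /usq; mfun; apply: mfun_ucoord. Qed.

Lemma mfun_lin i (f : T -> d.-tuple R) : measurable_fun setT f ->
  measurable_fun setT (fun x => lin (f x) i).
Proof.
by move=> mf; rewrite /Defs.lin; apply: mmx_mul; [exact: mmx_cst|exact: mmx_tcol].
Qed.

Lemma mfun_V1 (f : T -> d.-tuple R) : measurable_fun setT f ->
  measurable_fun setT (fun x => V1 (f x)).
Proof.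
move=> mf; apply: (mfun_eq (f := fun x => \sum_i lin (f x) i ^+ 2)) => [x|]; first by rewrite V1E.
by mfun; exact: mfun_lin.
Qed.

Lemma mfun_tau_cond (f : T -> d.-tuple R) (g : T -> r.-tuple R) :
  measurable_fun setT f -> measurable_fun setT g ->
  measurable_fun setT (fun x => tau_cond (f x) (g x)).
Proof.
move=> mf mg; have mr j : measurable_fun setT (fun x => rate (f x) j).
  by rewrite /rate; mfun; exact: mfun_usq.
apply: (mfun_eq (f := fun x => \prod_j tau_fac (f x) j (tnth (g x) j))) => //.
by rewrite /tau_fac; mfun; exact: mr.
Qed.

Lemma mfun_v_cond (f : T -> d.-tuple R) (g : T -> n.-tuple R) :
  measurable_fun setT f -> measurable_fun setT g ->
  measurable_fun setT (fun x => v_cond (f x) (g x)).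
Proof. by move=> mf mg; rewrite /Defs.v_cond; mfun; exact: mfun_lin. Qed.

Lemma mmx_Sigma (g : T -> r.-tuple R) : measurable_fun setT g ->
  mmx (fun x => Sigma (g x)).
Proof.
move=> mg; rewrite /Defs.Sigma; apply: mmx_D; first exact: mmx_cst.
move=> i j.
have [i1|i1] := split_ordP i => ->; have [j1|j1] := split_ordP j => ->.
- apply: (mfun_eq (f := fun=> 0 : R)) => [x|]; first by rewrite block_mxEul mxE.
  by mfun.
- apply: (mfun_eq (f := fun=> 0 : R)) => [x|]; first by rewrite block_mxEur mxE.
  by mfun.
- apply: (mfun_eq (f := fun=> 0 : R)) => [x|]; first by rewrite block_mxEdl mxE.
  by mfun.
- apply: (mfun_eq (f := fun x => (i1 == j1)%:R * \sum_(l < r | inblk l i1) tnth (g x) l)) => [x|].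
    by rewrite block_mxEdr mxE.
  by mfun.
Qed.

Definition kG (tau : r.-tuple R) (v : n.-tuple R) (eta' : d.-tuple R) : R :=
  mvn_pdf (Sigma tau) (invmx (Sigma tau) *m (W^T *m tcol v)) (tcol eta').

Lemma kGE tau v eta' :
  kG tau v eta' = mvn_pdf (Sigma tau) (invmx (Sigma tau) *m (W^T *m tcol v)) (tcol eta').
Proof. by []. Qed.

Lemma mfun_kG (f : T -> r.-tuple R) (g : T -> n.-tuple R) (h : T -> d.-tuple R) :
  measurable_fun setT f -> measurable_fun setT g -> measurable_fun setT h ->
  measurable_fun setT (fun x => kG (f x) (g x) (h x)).
Proof.
move=> mf mg mh; apply: measurable_mvn_pdf; [exact: mmx_Sigma| |exact: mmx_tcol].
apply: mmx_mul; first by apply: mmx_inv; exact: mmx_Sigma.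
by apply: mmx_mul; [exact: mmx_cst|exact: mmx_tcol].
Qed.

End Meas.

Lemma tau_cond_ge0 eta tau : 0 <= tau_cond eta tau.
Proof. by rewrite tau_condE prodr_ge0// => j _; exact: tau_fac_ge0. Qed.

Lemma v_cond_ge0 eta v : 0 <= v_cond eta v.
Proof. by rewrite prodr_ge0// => j _; exact: tn_pdf_ge0. Qed.

Lemma kG_ge0 tau v eta : 0 <= kG tau v eta.
Proof. exact: mvn_pdf_ge0. Qed.

Ltac mfun_user ::= first [apply: mfun_phi|apply: mfun_tn_set|apply: mfun_tn_pdf
  |apply: measurable_gamma_un|apply: mfun_gamma_pdf|apply: mfun_usq|apply: mfun_lin|apply: mfun_V1
  |apply: mfun_tau_cond|apply: mfun_v_cond|apply: mfun_kG].
Ltac nneg_user ::= first [exact: phi_ge0|exact: tn_pdf_ge0|exact: gamma_un_ge0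
  |exact: mvn_pdf_ge0|exact: gamma_pdf_ge0|exact: usq_ge0|exact: V1_ge0
  |exact: tau_cond_ge0|exact: v_cond_ge0|exact: kG_ge0].

Lemma tau_cond_eq0 eta tau : (exists j, tnth tau j <= 0) -> tau_cond eta tau = 0.
Proof. by move=> [j tj]; rewrite tau_condE (bigD1 j)//= tau_fac_le0// mul0r. Qed.

(** Positive definiteness of [Sigma tau] is available for positive [tau]; in the other case the
    weights in use vanish, so identities are checked case by case. *)
Lemma tau_dich (tau : r.-tuple R) : (forall j, 0 < tnth tau j) \/ (exists j, tnth tau j <= 0).
Proof.
have [/existsP[j tj]|/existsPn H] := boolP [exists j, tnth tau j <= 0].
  by right; exists j.
by left => j; rewrite ltNge; exact: H.
Qed.

Lemma lebint_tau_cond eta : lebint (fun tau => (tau_cond eta tau)%:E) = 1%E.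
Proof.
apply: (@lebint_prod1 R r (tau_fac eta)).
- move=> j; rewrite /tau_fac; mfun.
- exact: tau_fac_ge0.
- exact: integral_tau_fac.
Qed.

Lemma lebint_v_cond eta : lebint (fun v => (v_cond eta v)%:E) = 1%E.
Proof.
apply: (@lebint_prod1 R n (fun i => tn_pdf (lin eta i) (y i))).
- by move=> i; mfun.
- by move=> i x; exact: tn_pdf_ge0.
- by move=> i; exact: integral_tn_pdf.
Qed.

Lemma lebint_kG tau v : (forall j, 0 < tnth tau j) ->
  lebint (fun eta' => (kG tau v eta')%:E) = 1%E.
Proof. by move=> tau0; apply: lebint_mvn_pdf; exact: Sigma_posdef. Qed.

Lemma measurable_kden : measurable_fun setT (fun z : d.-tuple R * d.-tuple R => kden z.1 z.2).
Proof.
rewrite /Defs.kden.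
apply: (@measurable_lebint _ _ _ _ (fun (z : d.-tuple R * d.-tuple R) tau => lebint (fun v : n.-tuple R =>
  (tau_cond z.1 tau * v_cond z.1 v * kG tau v z.2)%:E))); last first.
  by move=> z tau; apply: lebint_ge0 => v; nneg.
apply: (@measurable_lebint _ _ _ _ (fun (z : (d.-tuple R * d.-tuple R) * r.-tuple R) v =>
  (tau_cond z.1.1 z.2 * v_cond z.1.1 v * kG z.2 v z.1.2)%:E)); last first.
  by nneg.
by mfun.
Qed.

Lemma kden_ge0 eta eta' : (0 <= kden eta eta')%E.
Proof. by apply: lebint_ge0 => tau; apply: lebint_ge0 => v; nneg. Qed.

Section Mixture.
Variable g : r.-tuple R -> n.-tuple R -> R.
Hypothesis mg : measurable_fun setT (fun z : r.-tuple R * n.-tuple R => g z.1 z.2).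
Hypothesis g0 : forall tau v, 0 <= g tau v.

(** A mixture of the conditional Gaussians with an arbitrary weight. The transition density, the
    minorizing density and the unnormalized posterior all have this form. *)
Definition mixK (eta' : d.-tuple R) : \bar R :=
  lebint (fun tau => lebint (fun v => (g tau v * kG tau v eta')%:E)).

Let mg' dd (T : measurableType dd) (u : T -> r.-tuple R) (u' : T -> n.-tuple R) :
  measurable_fun setT u -> measurable_fun setT u' ->
  measurable_fun setT (fun x => g (u x) (u' x)).
Proof. exact: mfun_comp2. Qed.

Ltac mfun_user ::= first [apply: mfun_kG|apply: mg'].

Lemma measurable_mixK : measurable_fun setT mixK.
Proof.
apply: (@measurable_lebint _ _ _ _ (fun (z : d.-tuple R) tau => lebint (fun v : n.-tuple R =>
  (g tau v * kG tau v z)%:E))); last first.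
  by move=> z tau; apply: lebint_ge0 => v; nneg.
apply: (@measurable_lebint _ _ _ _ (fun (z : d.-tuple R * r.-tuple R) v =>
  (g z.2 v * kG z.2 v z.1)%:E)); last first.
  by nneg.
by mfun.
Qed.

Lemma mixK_ge0 eta' : (0 <= mixK eta')%E.
Proof. by apply: lebint_ge0 => tau; apply: lebint_ge0 => v; nneg. Qed.

Lemma opE_mixK (f : d.-tuple R -> R) : measurable_fun setT f -> (forall x, 0 <= f x) ->
  opE mixK f = lebint (fun tau => lebint (fun v =>
    (g tau v)%:E * lebint (fun eta' => (kG tau v eta' * f eta')%:E))%E).
Proof.
move=> mf f0.
have mf' dd (T : measurableType dd) (u : T -> d.-tuple R) : measurable_fun setT u ->
    measurable_fun setT (fun x => f (u x)) by exact: measurableT_comp.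
pose F tau v eta' := g tau v * kG tau v eta' * f eta'.
have F0 tau v eta' : 0 <= F tau v eta' by rewrite /F; nneg.
transitivity (lebint (fun eta' => lebint (fun tau => lebint (fun v => (F tau v eta')%:E)))).
  apply: eq_lebint => eta'; rewrite /mixK -lebintZr; first last.
  - by move=> tau; apply: lebint_ge0 => v; nneg.
  - apply: (@measurable_lebint _ _ _ _ (fun (tau : r.-tuple R) v =>
      (g tau v * kG tau v eta')%:E)); last by nneg.
    by mfun.
  - by rewrite lee_fin.
  apply: eq_lebint => tau; rewrite -lebintZr.
  - by apply: eq_lebint => v; rewrite -EFinM.
  - by rewrite lee_fin.
  - by mfun.
  - by nneg.
rewrite (@lebint_swap R d r (fun eta' tau => lebint (fun v => (F tau v eta')%:E))); first last.
- by move=> eta' tau; apply: lebint_ge0 => v; nneg.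
- apply: (@measurable_lebint _ _ _ _ (fun (z : d.-tuple R * r.-tuple R) v => (F z.2 v z.1)%:E)); last by nneg.
  by rewrite /F; mfun; apply: mf'; mfun.
apply: eq_lebint => tau.
rewrite (@lebint_swap R d n (fun eta' v => (F tau v eta')%:E)); first last.
- by nneg.
- by rewrite /F; mfun; apply: mf'; mfun.
apply: eq_lebint => v; rewrite -lebintZl; first last.
- by nneg.
- by mfun; apply: mf'; mfun.
- by nneg.
by apply: eq_lebint => eta'; rewrite -EFinM mulrA.
Qed.

Lemma lebint_mixK : (forall tau v, (exists j, tnth tau j <= 0) -> g tau v = 0) ->
  lebint mixK = lebint (fun tau => lebint (fun v => (g tau v)%:E)).
Proof.
move=> gz; transitivity (opE mixK (fun=> 1)).
  by apply: eq_lebint => x; rewrite mule1.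
rewrite opE_mixK//; apply: eq_lebint => tau; apply: eq_lebint => v.
have [tau0|tau0] := tau_dich tau; last by rewrite gz// mul0e.
rewrite -[RHS]mule1; congr (_ * _)%E.
by rewrite -(lebint_kG v tau0); apply: eq_lebint => x; rewrite mulr1.
Qed.

Lemma lebint_mixK1 (G : r.-tuple R -> R) (H : n.-tuple R -> R) :
  (forall tau v, g tau v = G tau * H v) ->
  (forall tau, 0 <= G tau) -> (forall v, 0 <= H v) ->
  measurable_fun setT G -> measurable_fun setT H ->
  (forall tau, (exists j, tnth tau j <= 0) -> G tau = 0) ->
  lebint (fun tau => (G tau)%:E) = 1%E -> lebint (fun v => (H v)%:E) = 1%E ->
  lebint mixK = 1%E.
Proof.
move=> gE G0 H0 mG mH Gz G1 H1; rewrite lebint_mixK => [|tau v tau0]; last by rewrite gE Gz ?mul0r.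
rewrite -G1; apply: eq_lebint => tau; rewrite -[RHS]mule1 -H1 -lebintZl; first last.
- by nneg.
- by mfun.
- by nneg.
by apply: eq_lebint => v; rewrite gE EFinM.
Qed.

End Mixture.

Ltac mfun_user ::= first [apply: mfun_phi|apply: mfun_tn_set|apply: mfun_tn_pdf
  |apply: measurable_gamma_un|apply: mfun_gamma_pdf|apply: mfun_usq|apply: mfun_lin|apply: mfun_V1
  |apply: mfun_tau_cond|apply: mfun_v_cond|apply: mfun_kG].

Lemma opE_kden eta (f : d.-tuple R -> R) : measurable_fun setT f -> (forall x, 0 <= f x) ->
  opE (kden eta) f = lebint (fun tau => lebint (fun v =>
    (tau_cond eta tau * v_cond eta v)%:E * lebint (fun eta' => (kG tau v eta' * f eta')%:E))%E).
Proof.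
move=> mf f0; apply: (@opE_mixK (fun tau v => tau_cond eta tau * v_cond eta v)) => //.
  by mfun.
by nneg.
Qed.

(** When the Gaussian mean of [f] has a bound in [v] alone, [tau] integrates out with mass 1. The
    companion lemma does the same with [tau] and [v] exchanged. *)
Lemma opE_kden_le_v eta (f : d.-tuple R -> R) (h : n.-tuple R -> R) :
  measurable_fun setT f -> (forall x, 0 <= f x) ->
  measurable_fun setT h -> (forall x, 0 <= h x) ->
  (forall tau v, (forall j, 0 < tnth tau j) ->
     (lebint (fun eta' => (kG tau v eta' * f eta')%:E) <= (h v)%:E)%E) ->
  (opE (kden eta) f <= opE (fun v => (v_cond eta v)%:E) h)%E.
Proof.
move=> mf f0 mh h0 fh; rewrite opE_kden//.
apply: (@le_trans _ _ (lebint (fun tau => (tau_cond eta tau)%:E *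
    opE (fun v => (v_cond eta v)%:E) h))%E); last first.
  rewrite lebintZr ?lebint_tau_cond ?mul1e//.
  - by apply: opE_ge0 => //; nneg.
  - by mfun.
  - by nneg.
apply: lebint_le => tau.
  apply: lebint_ge0 => v; apply: mule_ge0; first by nneg.
  by apply: lebint_ge0; nneg.
rewrite -lebintZl; first last.
- by nneg.
- by mfun.
- by nneg.
apply: lebint_le => v.
  by apply: mule_ge0; [by nneg|apply: lebint_ge0; nneg].
have [tau0|tau0] := tau_dich tau; last by rewrite tau_cond_eq0// !mul0r !mul0e.
by rewrite [leRHS]muleA -(EFinM (tau_cond eta tau)) lee_wpmul2l ?lee_fin ?mulr_ge0 ?tau_cond_ge0 ?v_cond_ge0//; exact: fh.
Qed.

Lemma opE_kden_le_tau eta (f : d.-tuple R -> R) (h : r.-tuple R -> R) :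
  measurable_fun setT f -> (forall x, 0 <= f x) ->
  (forall x, 0 <= h x) ->
  (forall tau v, (forall j, 0 < tnth tau j) ->
     (lebint (fun eta' => (kG tau v eta' * f eta')%:E) <= (h tau)%:E)%E) ->
  (opE (kden eta) f <= opE (fun tau => (tau_cond eta tau)%:E) h)%E.
Proof.
move=> mf f0 h0 fh; rewrite opE_kden//.
apply: lebint_le => tau.
  apply: lebint_ge0 => v; apply: mule_ge0; first by nneg.
  by apply: lebint_ge0; nneg.
rewrite -[leRHS]mul1e -(lebint_v_cond eta) -lebintZr; first last.
- by nneg.
- by mfun.
- by nneg.
apply: lebint_le => v.
  by apply: mule_ge0; [by nneg|apply: lebint_ge0; nneg].
have [tau0|tau0] := tau_dich tau; last by rewrite tau_cond_eq0// !mul0r !mul0e mule0.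
rewrite -!EFinM mulrA [v_cond _ _ * _]mulrC EFinM.
by rewrite lee_wpmul2l ?lee_fin ?mulr_ge0 ?tau_cond_ge0 ?v_cond_ge0//; exact: fh.
Qed.

Lemma measurable_kden_eta eta : measurable_fun setT (kden eta).
Proof.
by apply: (@measurable_mixK (fun tau v => tau_cond eta tau * v_cond eta v)); [mfun|nneg].
Qed.

Lemma lebint_kden eta : lebint (kden eta) = 1%E.
Proof.
apply: (@lebint_mixK1 (fun tau v => tau_cond eta tau * v_cond eta v) _ _ (tau_cond eta) (v_cond eta)) => //.
- by mfun.
- by nneg.
- exact: tau_cond_ge0.
- exact: v_cond_ge0.
- by mfun.
- by mfun.
- by move=> tau; exact: tau_cond_eq0.
- exact: lebint_tau_cond.
- exact: lebint_v_cond.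
Qed.

End Kernel.

Ltac mfun_user ::= first [apply: mfun_phi|apply: mfun_tn_set|apply: mfun_tn_pdf
  |apply: measurable_gamma_un|apply: mfun_gamma_pdf|apply: mfun_usq|apply: mfun_lin|apply: mfun_V1
  |apply: mfun_tau_cond|apply: mfun_v_cond|apply: mfun_kG].
Ltac nneg_user ::= first [exact: phi_ge0|exact: tn_pdf_ge0|exact: gamma_un_ge0
  |exact: mvn_pdf_ge0|exact: gamma_pdf_ge0|exact: usq_ge0|exact: V1_ge0
  |exact: tau_cond_ge0|exact: v_cond_ge0|exact: kG_ge0].

(** * Drift *)

Section Drift.
Variables (R : realType) (n p r : nat) (qj : 'I_r -> nat).
Notation mu := (@lebesgue_measure R).
Notation q := (qsum qj).
Notation d := (p + qsum qj)%N.
Variables (X : 'M[R]_(n, p)) (Z : 'M[R]_(n, q)) (y : 'I_n -> bool) (a b : 'I_r -> R).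
Notation W := (W X Z).
Notation lin := (lin X Z).
Notation Sigma := (Sigma X Z).
Notation V1 := (V1 X Z).
Notation v_cond := (v_cond X Z y).
Notation kden := (kden X Z y a b).
Notation kG := (@kG R n p r qj X Z).
Notation al j := (a j + (qj j)%:R / 2).
Hypothesis rkW : \rank W = d.
Hypothesis al_gt0 : forall j, 0 < al j.

Lemma qf_WW_ge0 x : 0 <= qf (W^T *m W) x.
Proof. by have [eta ->] := tcol_ex x; rewrite qf_WW V1_ge0. Qed.

Lemma qf_WW_D (del : R) x z : 0 < del ->
  qf (W^T *m W) (x + z) <= (1 + del) * qf (W^T *m W) x + (1 + del^-1) * qf (W^T *m W) z.
Proof.
move=> d0; set M := W^T *m W.
have MT : M^T = M by rewrite trmx_mul trmxK.
have N1 (N : 'M[R]_1) : (- N) 0 0 = - N 0 0 by rewrite mxE.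
have Z1 (c : R) (N : 'M[R]_1) : (c *: N) 0 0 = c * N 0 0 by rewrite mxE.
have H := qf_WW_ge0 (del *: x - z).
rewrite -/M qfD// qfN qfZ mulmxN [(del *: x)^T]linearZ/= -!scalemxAl N1 Z1 in H.
rewrite qfD//.
set B := (x^T *m M *m z) 0 0 in H *; set qx := qf M x in H *; set qz := qf M z in H *.
have {}H : 0 <= del^-1 * (del ^+ 2 * qx + 2 * - (del * B) + qz) by rewrite mulr_ge0// invr_ge0 ltW.
have E : del^-1 * (del ^+ 2 * qx + 2 * - (del * B) + qz) = del * qx - 2 * B + del^-1 * qz.
  by field; rewrite gt_eqF.
lra.
Qed.

Lemma qf_WW_le_Sigma tau x : (forall j, 0 < tnth tau j) -> qf (W^T *m W) x <= qf (Sigma tau) x.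
Proof.
move=> tau0; have [eta ->] := tcol_ex x.
rewrite qf_WW qf_Sigma lerDl sumr_ge0// => j _.
by rewrite mulr_ge0 ?usq_ge0 ?(ltW (tau0 _)).
Qed.

(** The new [eta] is its mean plus noise. The mean contributes at most [|v|^2]; for the noise,
    [W^T W] lies below [Sigma tau], and the second moment in the precision form is bounded
    independently of [tau]. *)
Lemma kG_V1_le (del : R) tau v : 0 < del -> (forall j, 0 < tnth tau j) ->
  (lebint (fun eta' => (kG tau v eta' * V1 eta')%:E) <=
   ((1 + del) * (\sum_i tnth v i ^+ 2) + (1 + del^-1) * (4 * Num.sqrt (2 ^+ d)))%:E)%E.
Proof.
move=> d0 tau0; have SP := Sigma_posdef rkW tau0.
set m := invmx (Sigma tau) *m (W^T *m tcol v).
have dv0 : 0 < del^-1 by rewrite invr_gt0.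
pose c1 := (1 + del) * (\sum_i tnth v i ^+ 2); pose c2 := 1 + del^-1.
have c10 : 0 <= c1 by rewrite /c1; nneg.
have c20 : 0 <= c2 by rewrite /c2; nneg.
have mq : measurable_fun setT (fun eta' : d.-tuple R => qf (Sigma tau) (tcol eta' - m)).
  have mxm : mmx (fun t : d.-tuple R => tcol t - m).
    by apply: mmx_D; [apply: mmx_tcol; mfun|apply: mmx_N; exact: mmx_cst].
  by apply: mmx_mul => //; apply: mmx_mul; [exact: mmx_tr|exact: mmx_cst].
have q0 (eta' : d.-tuple R) : 0 <= qf (Sigma tau) (tcol eta' - m) by exact: qf_ge0.
have mk : measurable_fun setT (fun t => kG tau v t) by mfun.
apply: (@le_trans _ _ (lebint (fun eta' => c1%:E * (kG tau v eta')%:E +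
    c2%:E * (kG tau v eta' * qf (Sigma tau) (tcol eta' - m))%:E))%E).
  apply: lebint_le => eta'; first by nneg.
  rewrite -!EFinM -EFinD lee_fin.
  have H : V1 eta' <= c1 + c2 * qf (Sigma tau) (tcol eta' - m).
    rewrite -qf_WW -[tcol eta'](subrK m) addrC.
    apply: le_trans (qf_WW_D m (tcol eta' - m) d0) _; rewrite addrC subrK.
    apply: lerD; first by rewrite ler_wpM2l ?addr_ge0 ?(ltW d0)//; exact: WSigma_contract.
    by rewrite ler_wpM2l//; exact: qf_WW_le_Sigma.
  apply: le_trans (ler_wpM2l (kG_ge0 _ _ _ _ _) H) _.
  have e5 (u1 u2 u3 u4 : R) : u1 * (u2 + u3 * u4) = u2 * u1 + u3 * (u1 * u4) by ring.
  by rewrite e5.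
rewrite lebintD; [|by mfun|by nneg|by mfun|by nneg].
rewrite !lebintZl ?lee_fin//; [|by mfun|by nneg|by mfun|by nneg].
rewrite lebint_kG// mule1 [leRHS]EFinD leeD2l// [leRHS]EFinM lee_wpmul2l ?lee_fin//.
exact: lebint_mvn_pdf_qf.
Qed.

Lemma opE_vcond_sqr (del : R) : 0 < del -> exists2 C : R, 0 <= C & forall eta i,
  (opE (fun v => (v_cond eta v)%:E) (fun v => (tnth v i ^+ 2)%R) <=
    ((1 + del) * Num.max 0 (- (cc R y i * lin eta i)) ^+ 2 + C)%:E)%E.
Proof.
move=> d0; have [C C0 H] := tn_pdf_sqr_le d0; exists C => // eta i.
have := H (lin eta i) (y i) => Hi.
have I0 : (0 <= \int[mu]_x (tn_pdf (lin eta i) (y i) x * x ^+ 2)%:E)%E.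
  by apply: integral_ge0 => x _; nneg.
have fin : (\int[mu]_x (tn_pdf (lin eta i) (y i) x * x ^+ 2)%:E)%E \is a fin_num.
  by rewrite ge0_fin_numE//; apply: le_lt_trans Hi _; exact: ltry.
rewrite -(fineK fin) in Hi; apply: le_trans Hi.
rewrite -(@lebint_prod_at R n (fun i => tn_pdf (lin eta i) (y i)) i (fun x => x ^+ 2)%R).
- by apply: lebint_le => v; nneg; rewrite -EFinM.
- by move=> l; mfun.
- by move=> l x; nneg.
- by move=> l; exact: integral_tn_pdf.
- by mfun.
- by nneg.
- by rewrite fineK.
Qed.

Hypothesis A2 : exists e : 'rV[R]_n, (forall i, 0 < e 0 i) /\ e *m Wstar X Z y = 0.

Lemma drift_V1 : exists lam L : R, [/\ 0 <= lam, lam < 1, 0 <= L &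
  forall eta, (opE (kden eta) V1 <= (lam * V1 eta + L)%:E)%E].
Proof.
have [lam [l0 l1 Hl]] := negpart_le A2.
(* The factor [1 + del] is paid twice, for separating mean from noise and for the truncated second
   moment; with this [del], [(1 + del) ^+ 2 * lam <= (lam + 3) / 4 < 1]. *)
pose del := (1 - lam) / 4; have d0 : 0 < del by rewrite divr_gt0// subr_gt0.
have [C C0 HC] := opE_vcond_sqr d0.
pose K := (1 + del^-1) * (4 * Num.sqrt (2 ^+ d)).
have dv0 : 0 < del^-1 by rewrite invr_gt0.
have K0 : 0 <= K by rewrite /K; nneg.
have d10 : 0 <= 1 + del by nneg.
exists ((lam + 3) / 4), ((1 + del) * (n%:R * C) + K); split.
- by rewrite divr_ge0// addr_ge0.
- by rewrite ltr_pdivrMr//; lra.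
- by nneg.
move=> eta.
have mv : measurable_fun setT (fun v : n.-tuple R => (v_cond eta v)%:E) by mfun.
have v0 v : (0 <= (v_cond eta v)%:E)%E by nneg.
apply: le_trans (@opE_kden_le_v R n p r qj X Z y a b al_gt0 eta V1
  (fun v => (1 + del) * (\sum_i tnth v i ^+ 2) + K) _ _ _ _ _) _.
- by mfun.
- by nneg.
- by mfun.
- by nneg.
- by move=> tau v tau0; exact: kG_V1_le.
rewrite opED//; [|by mfun|by nneg].
rewrite opEZ//; [|by mfun|by nneg].
rewrite opE_cst//; last exact: lebint_v_cond.
rewrite opE_sum//; [|by move=> i; mfun|by nneg].
have S : (\sum_i opE (fun v => (v_cond eta v)%:E) (fun v => (tnth v i ^+ 2)%R) <=
    ((1 + del) * (lam * V1 eta) + n%:R * C)%:E)%E.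
  apply: (@le_trans _ _ (\sum_i ((1 + del) * Num.max 0 (- (cc R y i * lin eta i)) ^+ 2 + C)%:E)%E).
    by apply: lee_sum => i _; exact: HC.
  rewrite sumEFin lee_fin big_split/= sumr_const card_ord -mulr_sumr -[C *+ n]mulr_natl.
  by rewrite lerD2r ler_wpM2l.
apply: (@le_trans _ _ ((1 + del)%:E * ((1 + del) * (lam * V1 eta) + n%:R * C)%:E + K%:E)%E).
  by rewrite leeD2r// lee_wpmul2l// lee_fin.
rewrite -EFinM -EFinD lee_fin mulrDr addrA lerD2r lerD2r.
rewrite !mulrA; apply: ler_wpM2r; first exact: V1_ge0.
rewrite /del; nra.
Qed.

End Drift.

(** * Drift of the negative powers *)

Section Drift2.
Variables (R : realType) (n p r : nat) (qj : 'I_r -> nat).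
Notation mu := (@lebesgue_measure R).
Notation q := (qsum qj).
Notation d := (p + qsum qj)%N.
Variables (X : 'M[R]_(n, p)) (Z : 'M[R]_(n, q)) (y : 'I_n -> bool) (a b : 'I_r -> R).
Notation W := (W X Z).
Notation tau_cond := (@Defs.tau_cond R p r qj a b).
Notation kden := (kden X Z y a b).
Notation kG := (@kG R n p r qj X Z).
Notation al j := (a j + (qj j)%:R / 2).
Hypothesis rkW : \rank W = d.
Hypothesis al_gt0 : forall j, 0 < al j.

(* [0 `^ (- c) = 0] for [c <> 0], so [V2] vanishes, instead of being infinite, on
   the null set [usq eta j = 0]; the drift bound holds there too. *)
Definition V2 (c : R) (j : 'I_r) (eta : d.-tuple R) : R := usq eta j `^ (- c).

(** The Laplace transform of [|u_j|^2] at [s] is at most [(1 + 2 s / (Lam + tau_j)) ^ (- q_j / 2)]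
    whatever the mean, so [v] disappears. The condition [c < q_j / 2] makes the resulting Beta
    integral converge. *)
Lemma kG_V2_le : exists2 Lam : R, 0 < Lam & forall j c tau v, 0 < c -> c < (qj j)%:R / 2 ->
  (forall j, 0 < tnth tau j) ->
  (lebint (fun eta' => (kG tau v eta' * V2 c j eta')%:E) <=
   (Gam ((qj j)%:R / 2 - c) / Gam ((qj j)%:R / 2) * ((Lam + tnth tau j) / 2) `^ c)%:E)%E.
Proof.
have [Lam L0 HL] := Sigma_diag_le X Z (qj := qj).
exists Lam => // j c tau v c0 ch tau0; have SP := Sigma_posdef rkW tau0.
set h := (qj j)%:R / 2 in ch *; have h0 : 0 < h by exact: lt_trans ch.
have P0 : 0 < Lam + tnth tau j by rewrite addr_gt0.
have G0 := Gam_gt0 c0.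
have Gi0 : 0 <= (Gam c)^-1 by rewrite invr_ge0 ltW.
(* Here [usq eta' j] is the rate: for a positive rate the integral over [s] is [Gam c] times
   [V2 c j eta']. *)
pose F s (eta' : d.-tuple R) := kG tau v eta' * gamma_un c (usq eta' j) s.
have F0 s eta' : 0 <= F s eta' by rewrite /F; nneg.
have mF : measurable_fun setT (fun z : R * d.-tuple R => (F z.1 z.2)%:E).
  by rewrite /F; mfun.
apply: (@le_trans _ _ ((Gam c)^-1%:E * lebint (fun eta' => \int[mu]_s (F s eta')%:E))%E).
  rewrite -lebintZl ?lee_fin//; first last.
  - by move=> eta'; apply: integral_ge0 => s _; rewrite lee_fin.
  - apply: (@measurable_fun_fubini_tonelli_G _ _ _ _ _ mu (fun z => (F z.1 z.2)%:E)) => //.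
    by move=> z; rewrite lee_fin.
  apply: lebint_le => eta'; first by rewrite /V2; nneg.
  have [u0|u0] := ltP 0 (usq eta' j); last first.
    have u00 : usq eta' j = 0 by apply/eqP; rewrite eq_le u0 usq_ge0.
    rewrite /V2 u00 powR0 ?oppr_eq0 ?(gt_eqF c0)// mulr0.
    by rewrite mule_ge0 ?lee_fin//; apply: integral_ge0 => s _; rewrite lee_fin.
  rewrite /F; under eq_integral do rewrite EFinM.
  rewrite ge0_integralZl_EFin; first last.
  - exact: kG_ge0.
  - by mfun.
  - by nneg.
  - exact: measurableT.
  rewrite (integral_gamma_un c0 u0) -!EFinM lee_fin /V2 mulrCA.
  by rewrite [_^-1 * _]mulrA mulVf ?mul1r// gt_eqF.
rewrite -(@integral_lebint R _ _ mu d (fun s t => (F s t)%:E)) //.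
apply: (@le_trans _ _ ((Gam c)^-1%:E *
    \int[mu]_s (gamma_un c 0 s * (1 + 2 * s / (Lam + tnth tau j)) `^ (- h))%:E)%E); last first.
  rewrite (beta_integral c0 ch P0) -EFinM lee_fin -!mulrA mulKf// gt_eqF//.
rewrite lee_wpmul2l ?lee_fin//; apply: ge0_integral_mono => s.
  by apply: lebint_ge0 => eta'; rewrite lee_fin.
have [s0|s0] := ltP 0 s; last first.
  have g0 b' : gamma_un c b' s = 0 by rewrite /gamma_un ltNge s0.
  rewrite /F; rewrite (eq_lebint (g := fun _ => 0%:E * 0)%E); last first.
    by move=> t; rewrite g0 mulr0 mul0e.
  by rewrite lebintZl// mul0e lee_fin g0 mul0r.
rewrite EFinM.
apply: (@le_trans _ _ ((gamma_un c 0 s)%:E * lebint (fun eta' =>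
   (kG tau v eta' * expR (- (s * \sum_(i | uidx j i) tnth eta' i ^+ 2)))%:E))%E).
  rewrite -lebintZl; [|by nneg|by mfun|by nneg].
  apply: lebint_le => eta'; first by rewrite lee_fin.
  rewrite -EFinM lee_fin /F mulrCA ler_wpM2l ?kG_ge0// /gamma_un s0 -usqE.
  by rewrite mul0r oppr0 expR0 mulr1 [s * _]mulrC.
rewrite lee_wpmul2l ?lee_fin ?gamma_un_ge0// /h -(card_uidx p qj j).
by apply: lebint_mvn_pdf_laplace => //; [exact: ltW|move=> i; exact: HL].
Qed.

(** The [c]-th moment of the Gamma law with rate [usq / 2] carries [(usq / 2) ^ (-c)], and the 2
    cancels against the one under [Lam + tau_j]. What remains is exactly [V2] with the ratio of
    Gamma values. *)
Lemma opE_tau_powR (Lam c : R) j : 0 < Lam -> 0 < c -> b j = 0 -> 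
  forall e : R, 0 < e -> exists2 C : R, 0 <= C & forall eta,
  (opE (fun tau => (tau_cond eta tau)%:E) (fun tau => (((Lam + tnth tau j) / 2) `^ c)%R) <=
   ((1 + e) * (Gam (al j + c) / Gam (al j)) * V2 c j eta + C)%:E)%E.
Proof.
move=> L0 c0 bj e e0; have [C C0 HC] := powRD_le L0 c0 e0.
have ac0 : 0 < al j + c by rewrite addr_gt0.
have c10 : 0 < 1 + c by rewrite addr_gt0.
pose K1 := Gam (1 + c) / Gam 1.
have K10 : 0 <= K1 by rewrite divr_ge0// ltW// Gam_gt0.
pose K := Gam (al j + c) / Gam (al j).
have K0 : 0 <= K by rewrite divr_ge0// ltW// Gam_gt0.
have t0 : 0 <= 2^-1 `^ c :> R by exact: powR_ge0.
have e10 : 0 <= 1 + e by rewrite addr_ge0// ltW.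
(* [K1] is the moment of the default Gamma(1,1), so the constant also covers the states of rate 0,
   where [V2] vanishes. *)
exists (2^-1 `^ c * ((1 + e) * K1 + C)).
  exact: (mulr_ge0 t0 (addr_ge0 (mulr_ge0 e10 K10) C0)).
move=> eta.
have I : exists2 m, (\int[mu]_t (tau_fac a b eta j t * t `^ c)%:E = m%:E)%E &
    2^-1 `^ c * m <= K * V2 c j eta + 2^-1 `^ c * K1.
  have [r0|r0] := ltP 0 (rate b eta j).
    exists (K * rate b eta j `^ (- c)).
      by rewrite -(integral_gamma_pdf_moment (al_gt0 j) r0 ac0) /tau_fac r0.
    apply: ler_wpDr; first exact: mulr_ge0 t0 K10.
    rewrite [leLHS]mulrCA; apply: (ler_wpM2l K0).
    rewrite /rate bj add0r /V2 (powRM _ (usq_ge0 _ _)) ?invr_ge0//.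
    rewrite [leLHS]mulrCA -powRD; last by rewrite invr_eq0 pnatr_eq0 implybT.
    by rewrite subrr powRr0 mulr1.
  exists K1.
    have := integral_gamma_pdf_moment (ltr01 : 0 < 1 :> R) (ltr01 : 0 < 1 :> R) c10.
    by rewrite powR1 mulr1 => <-; rewrite /tau_fac ltNge r0.
  by apply: ler_wpDl => //; exact: mulr_ge0 K0 (powR_ge0 _ _).
have [m mE mle] := I.
have P : (opE (fun tau => (tau_cond eta tau)%:E)
    (fun tau => (2^-1 `^ c * ((1 + e) * tnth tau j `^ c + C))%R) =
    (2^-1 `^ c * ((1 + e) * m + C))%:E)%E.
  have mt : measurable_fun setT (fun tau : r.-tuple R => (tau_cond eta tau)%:E) by mfun.
  have w0 tau : (0 <= (tau_cond eta tau)%:E)%E by nneg.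
  rewrite opEZ//; [|by mfun|by nneg].
  rewrite opED//; [|by mfun|by nneg].
  rewrite opEZ//; [|by mfun|by nneg].
  rewrite opE_cst//; last exact: lebint_tau_cond.
  have -> : opE (fun tau => (tau_cond eta tau)%:E) (fun tau => (tnth tau j `^ c)%R) = m%:E.
    have mtf' l : measurable_fun setT (tau_fac a b eta l) by rewrite /tau_fac; mfun.
    have mpow : measurable_fun setT (fun t : R => t `^ c) by mfun.
    by apply: (lebint_prod_at mtf' (tau_fac_ge0 a b eta) _ mpow _ mE) => [l|t]; [exact: integral_tau_fac|exact: powR_ge0].
  by rewrite !(EFinM, EFinD).
apply: (@le_trans _ _ (2^-1 `^ c * ((1 + e) * m + C))%:E); last first.
  rewrite lee_fin.
  have -> : 2^-1 `^ c * ((1 + e) * m + C) = (1 + e) * (2^-1 `^ c * m) + 2^-1 `^ c * C by ring.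
  have := ler_wpM2l e10 mle; rewrite -/K; lra.
rewrite -P; apply: lebint_le => tau; first by nneg.
have [tau0|tau0] := tau_dich tau; last by rewrite tau_cond_eq0// !mul0e.
rewrite lee_wpmul2l// ?lee_fin ?tau_cond_ge0//.
rewrite mulrC powRM ?invr_ge0//; last by rewrite addr_ge0// ltW.
by rewrite ler_wpM2l//; exact: HC.
Qed.

(** The ratio [rho] is below 1 by the midpoint inequality, and [e] is chosen to make
    [(1 + e) * rho = (1 + rho) / 2]. *)
Lemma slack_ratio (gM gh ga : R) : 0 < gM -> 0 < gh -> 0 < ga -> gM ^+ 2 < ga * gh ->
  exists2 e : R, 0 < e & 0 <= (1 + e) * (gM / gh * (gM / ga)) /\
    (1 + e) * (gM / gh * (gM / ga)) < 1.
Proof.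
move=> M0 h0 a0 mid; set rho := _ * (gM / ga).
have rho0 : 0 < rho by rewrite /rho !mulr_gt0 ?invr_gt0.
have rho1 : rho < 1.
  rewrite (_ : rho = gM ^+ 2 / (ga * gh)).
    by rewrite ltr_pdivrMr ?mulr_gt0// mul1r.
  by rewrite /rho invfM expr2; ring.
have e0 : 0 < (1 - rho) / (2 * rho) by apply: divr_gt0; [rewrite subr_gt0|rewrite mulr_gt0].
exists ((1 - rho) / (2 * rho)) => //; split; first by rewrite mulr_ge0 ?addr_ge0 ?ltW.
have -> : (1 + (1 - rho) / (2 * rho)) * rho = (1 + rho) / 2 by field; rewrite gt_eqF.
lra.
Qed.

Lemma drift_V2 j : a j < 0 -> b j = 0 -> exists lam L : R, [/\ 0 <= lam, lam < 1, 0 <= L &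
  forall eta, (opE (kden eta) (V2 (- a j / 2) j) <= (lam * V2 (- a j / 2) j eta + L)%:E)%E].
Proof.
move=> aj bj; have [Lam L0 HL] := kG_V2_le.
(* This [c] makes [h - c] and [al j + c] coincide with the midpoint [M] of [al j] and [h];
   [0 < al j] and [a j < 0] give [c < h]. *)
set c := - a j / 2; have c0 : 0 < c by rewrite /c; lra.
have alj := al_gt0 j.
pose h := (qj j)%:R / 2 : R; have h0 : 0 < h by rewrite /h; lra.
have ch : c < h by rewrite /c /h; lra.
have hc0 : 0 < h - c by lra.
pose M := (al j + h) / 2.
have mid : Gam M ^+ 2 < Gam (al j) * Gam h by apply: Gam_midpoint => //; rewrite /h; lra.
have E1 : h - c = M by rewrite /M /h /c; field.
have E2 : al j + c = M by rewrite /M /h /c; field.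
have M0 : 0 < M by rewrite -E1.
have [e e0 [rho0 rho1]] := slack_ratio (Gam_gt0 M0) (Gam_gt0 h0) (Gam_gt0 alj) mid.
have [C C0 HC] := @opE_tau_powR Lam c j L0 c0 bj e e0.
pose B := Gam M / Gam h; have B0 : 0 <= B := divr_ge0 (ltW (Gam_gt0 M0)) (ltW (Gam_gt0 h0)).
exists ((1 + e) * (Gam M / Gam h * (Gam M / Gam (al j)))), (B * C); split => //.
  exact: mulr_ge0.
move=> eta.
apply: le_trans (@opE_kden_le_tau R n p r qj X Z y a b eta (V2 c j)
  (fun tau => B * ((Lam + tnth tau j) / 2) `^ c) _ _ _ _) _.
- by rewrite /V2; mfun.
- by move=> x; exact: powR_ge0.
- by nneg.
- by move=> tau v tau0; have := HL j c tau v c0 ch tau0; rewrite E1.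
rewrite opEZ//; [|by mfun|by nneg|by mfun|by nneg].
apply: le_trans (lee_wpmul2l _ (HC eta)) _; first by rewrite lee_fin.
rewrite E2 -EFinM lee_fin mulrDr lerD2r.
have eqn (u v w x : R) : u * (v * w * x) = v * (u * w) * x by ring.
by rewrite [leLHS]eqn.
Qed.

End Drift2.

(** * The combined Lyapunov function *)

Section Lyapunov.
Variables (R : realType) (n p r : nat) (qj : 'I_r -> nat).
Notation q := (qsum qj).
Notation d := (p + qsum qj)%N.
Variables (X : 'M[R]_(n, p)) (Z : 'M[R]_(n, q)) (y : 'I_n -> bool) (a b : 'I_r -> R).
Notation W := (W X Z).
Notation V1 := (V1 X Z).
Notation kden := (kden X Z y a b).
Notation al j := (a j + (qj j)%:R / 2).
Hypothesis ab : forall j, (a j < 0 /\ b j = 0) \/ 0 < b j.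
Hypothesis rkW : \rank W = d.
Hypothesis al_gt0 : forall j, 0 < al j.
Hypothesis A2 : exists e : 'rV[R]_n, (forall i, 0 < e 0 i) /\ e *m Wstar X Z y = 0.

Definition lyap (eta : d.-tuple R) : R :=
  V1 eta + \sum_(j < r | b j == 0) V2 (- a j / 2) j eta.

Lemma lyapE eta : lyap eta = V1 eta + \sum_(j < r | b j == 0) V2 (- a j / 2) j eta.
Proof. by []. Qed.

Lemma lyap_ge0 eta : 0 <= lyap eta.
Proof. by rewrite /lyap /V2; nneg. Qed.

Lemma measurable_lyap : measurable_fun setT lyap.
Proof. by rewrite /lyap /V2; mfun. Qed.

Lemma b0_a_lt0 j : b j == 0 -> a j < 0.
Proof.
by move=> /eqP bj; have [[//]|] := ab j; rewrite bj ltxx.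
Qed.

Lemma V1_le_lyap eta : V1 eta <= lyap eta.
Proof. by rewrite lerDl /V2; nneg. Qed.

Lemma V2_le_lyap eta j : b j == 0 -> V2 (- a j / 2) j eta <= lyap eta.
Proof.
move=> bj; apply: ler_wpDl; first exact: V1_ge0.
by rewrite (bigD1 j)//= lerDl /V2; nneg.
Qed.

Lemma drift_lyap : exists lam L : R, [/\ 0 <= lam, lam < 1, 0 <= L &
  forall eta, (opE (kden eta) lyap <= (lam * lyap eta + L)%:E)%E].
Proof.
have [lam1 [L1 [lam10 lam11 L10 H1]]] := drift_V1 b rkW al_gt0 A2.
have /choice[F HF] : forall j, exists lL : R * R, b j == 0 ->
    [/\ 0 <= lL.1, lL.1 < 1, 0 <= lL.2 & forall eta : d.-tuple R,
      (opE (kden eta) (V2 (- a j / 2) j) <= (lL.1 * V2 (- a j / 2) j eta + lL.2)%:E)%E].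
  move=> j; have [bj|] := eqVneq (b j) 0; last by exists (0, 0).
  have [lam [L [? ? ? H]]] := drift_V2 y rkW al_gt0 (b0_a_lt0 (introT eqP bj)) bj.
  by exists (lam, L).
(* All terms are nonnegative, so the largest of finitely many factors below 1 serves for the sum. *)
pose lam := \big[Num.max/lam1]_(j < r | b j == 0) (F j).1.
have l1 : lam1 <= lam by exact: bigmax_ge_id.
have lF j : b j == 0 -> (F j).1 <= lam by move=> bj; exact: (le_bigmax_cond _ (fun j => (F j).1)).
exists lam, (L1 + \sum_(j < r | b j == 0) (F j).2); split.
- exact: le_trans l1.
- by apply: bigmax_lt => // j /HF[].
- by rewrite addr_ge0// sumr_ge0// => j /HF[].
move=> eta; have mk : measurable_fun setT (kden eta).
  exact: measurable_kden_eta.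
have mV2 j : measurable_fun setT (V2 (- a j / 2) j : d.-tuple R -> R).
  by rewrite /V2; mfun.
rewrite opED//; first last.
- by rewrite /V2; nneg.
- by nneg.
- by apply: measurable_sumT => j; exact: mV2.
- by mfun.
- exact: kden_ge0.
rewrite (@opE_sum _ _ _ mk (kden_ge0 _ _ _ _ _ eta) _ _ _ (fun j => V2 (- a j / 2) j) mV2); last first.
  by move=> j z; rewrite /V2 powR_ge0.
pose B j : R := lam * V2 (- a j / 2) j eta + (F j).2.
pose A : R := lam * V1 eta + L1.
apply: (@le_trans _ _ (A%:E + \sum_(j < r | (b j == 0)%R) (B j)%:E)%E).
  apply: leeD.
    by apply: le_trans (H1 eta) _; rewrite lee_fin lerD2r ler_wpM2r// V1_ge0.
  apply: lee_sum => j bj; have [_ _ _ H] := HF j bj.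
  by apply: le_trans (H eta) _; rewrite lee_fin lerD2r ler_wpM2r// ?powR_ge0// lF.
rewrite sumEFin -EFinD lee_fin /A /B big_split/= -mulr_sumr /lyap mulrDr.
by rewrite le_eqVlt; apply/orP; left; apply/eqP; ring.
Qed.

End Lyapunov.

(** * Minorization *)

Section Minorization.
Variables (R : realType) (n p r : nat) (qj : 'I_r -> nat).
Notation mu := (@lebesgue_measure R).
Notation q := (qsum qj).
Notation d := (p + qsum qj)%N.
Variables (X : 'M[R]_(n, p)) (Z : 'M[R]_(n, q)) (y : 'I_n -> bool) (a b : 'I_r -> R).
Notation W := (W X Z).
Notation lin := (lin X Z).
Notation V1 := (V1 X Z).
Notation tau_cond := (@Defs.tau_cond R p r qj a b).
Notation v_cond := (v_cond X Z y).
Notation kden := (kden X Z y a b).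
Notation kG := (@kG R n p r qj X Z).
Notation lyap := (lyap X Z a b).
Notation al j := (a j + (qj j)%:R / 2).
Hypothesis ab : forall j, (a j < 0 /\ b j = 0) \/ 0 < b j.
Hypothesis rkW : \rank W = d.
Hypothesis al_gt0 : forall j, 0 < al j.

(** On a sublevel set [V1] bounds the rate above. Below it is bounded by [b j] or, if [b j = 0],
    through [V2]. At [usq eta j = 0] [V2] gives no information, but the law is then the fixed
    Gamma(1,1), whence the minimum of two constants. *)
Lemma tau_fac_lb (M : R) j : exists2 e : R, 0 < e & forall eta : d.-tuple R, lyap eta <= M ->
  forall t, 1 < t < 2 -> e <= tau_fac a b eta j t.
Proof.
have [C C0 HC] := usq_le_V1 (X := X) (Z := Z) rkW.
pose M1 := `|M| + 1; have M10 : 0 < M1 by rewrite ltr_pwDr.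
have MM1 : M <= M1 by rewrite /M1; have := ler_norm M; lra.
have usqM (eta : d.-tuple R) : lyap eta <= M -> usq eta j <= C * M1.
  move=> VM; apply: le_trans (HC eta j) _; rewrite ler_pM2l//.
  by apply: le_trans (V1_le_lyap _ _ _ _ eta) _; exact: le_trans VM MM1.
have [[aj bj]|bj] := ab j.
  have [e1 e10 H1] := gamma_pdf_lb 1 (ltr01 : 0 < 1 :> R) (ltr01 : 0 < 1 :> R).
  pose c := - a j / 2; have c0 : 0 < c by rewrite /c; lra.
  (* For positive [usq], [V2 <= M1] says that [usq] is at least [M1 ^ (- 1 / c)], and the rate is
     half of [usq]. *)
  pose u0 := M1^-1 `^ c^-1 / 2.
  have u00 : 0 < u0 by rewrite divr_gt0// powR_gt0// invr_gt0.
  have [e2 e20 H2] := gamma_pdf_lb (C * M1 / 2) (al_gt0 j) u00.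
  exists (Num.min e1 e2); first by rewrite lt_min e10.
  move=> eta VM t t12; rewrite /tau_fac; case: ifPn => [r0|_].
    apply: (@le_trans _ _ e2); first by rewrite ge_min lexx orbT.
    rewrite /rate bj add0r in r0 *.
    have us0 : 0 < usq eta j by move: r0; rewrite pmulr_lgt0.
    apply: H2 => //; last by rewrite ler_pM2r//; exact: usqM.
    rewrite ler_pM2r//.
    have := le_trans (V2_le_lyap X Z a eta (introT eqP bj)) (le_trans VM MM1).
    rewrite /V2 -/c powRN => h.
    have h1 : M1^-1 <= usq eta j `^ c.
      by rewrite -[leRHS]invrK lef_pV2// posrE invr_gt0 powR_gt0.
    have -> : usq eta j = (usq eta j `^ c) `^ c^-1.
      by rewrite -powRrM mulfV ?gt_eqF// powRr1// ltW.
    by apply: ge0_ler_powR; rewrite ?nnegrE ?powR_ge0 ?invr_ge0 ?(ltW c0) ?(ltW M10).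
  apply: (@le_trans _ _ e1); first by rewrite ge_min lexx.
  exact: H1.
have [e e0 H] := gamma_pdf_lb (b j + C * M1 / 2) (al_gt0 j) bj.
exists e => // eta VM t t12.
have us0 := usq_ge0 eta j.
have r0 : 0 < rate b eta j by rewrite ltr_pwDl// divr_ge0.
rewrite /tau_fac r0; apply: H => //; rewrite /rate; first by rewrite lerDl divr_ge0.
by rewrite lerD2l ler_pM2r//; exact: usqM.
Qed.

Definition ubox (s x : R) : R := \1_(`]s, s + 1[%classic) x.

Lemma ubox_ge0 s x : 0 <= ubox s x. Proof. by rewrite /ubox indicE. Qed.

Lemma ubox_cases s x : (ubox s x = 1 /\ s < x < s + 1) \/ ubox s x = 0.
Proof.
rewrite /ubox indicE; have [|_] := boolP (x \in _); last by right.
by rewrite inE/= in_itv/=; left.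
Qed.

Lemma mfun_ubox dd (T : measurableType dd) s (f : T -> R) :
  measurable_fun setT f -> measurable_fun setT (fun x => ubox s (f x)).
Proof. by move=> mf; apply: (measurableT_comp _ mf); exact: measurable_indic. Qed.

Lemma integral_ubox s : (\int[mu]_x (ubox s x)%:E = 1)%E.
Proof.
rewrite integral_indic//= setIT lebesgue_measure_itv/= lte_fin ltrDl ltr01.
by rewrite -EFinB addrAC subrr add0r.
Qed.

(** Left end of a unit interval, []1, 2[] or []-2, -1[], inside the truncation set of [y i]. *)
Definition vlow (i : 'I_n) : R := if y i then 1 else -2.

Definition tau_box (tau : r.-tuple R) : R := \prod_j ubox 1 (tnth tau j).
Definition v_box (v : n.-tuple R) : R := \prod_i ubox (vlow i) (tnth v i).

Lemma prod_lb k (e g h : 'I_k -> R) :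
  (forall i, 0 <= e i) -> (forall i, 0 <= g i) -> (forall i, e i * g i <= h i) ->
  (\prod_i e i) * \prod_i g i <= \prod_i h i.
Proof.
move=> e0 g0 egh; rewrite -big_split; apply: ler_prod => i _ /=.
by rewrite egh mulr_ge0.
Qed.

Lemma tau_cond_lb (M : R) : exists2 e : R, 0 < e & forall eta : d.-tuple R, lyap eta <= M ->
  forall tau, e * tau_box tau <= tau_cond eta tau.
Proof.
have /choice[e He] : forall j, exists e : R, 0 < e /\ forall eta : d.-tuple R, lyap eta <= M ->
    forall t, 1 < t < 2 -> e <= tau_fac a b eta j t.
  by move=> j; have [e] := tau_fac_lb M j; exists e.
exists (\prod_j e j); first by apply: prodr_gt0 => j _; have [] := He j.
move=> eta VM tau; rewrite tau_condE; apply: prod_lb => j.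
- by have [/ltW] := He j.
- exact: ubox_ge0.
- have [_ H] := He j.
  have [[-> t12]|->] := ubox_cases 1 (tnth tau j); last by rewrite mulr0 tau_fac_ge0.
  by rewrite mulr1; apply: H.
Qed.

Lemma v_cond_lb (M : R) : exists2 e : R, 0 < e & forall eta : d.-tuple R, V1 eta <= M ->
  forall v, e * v_box v <= v_cond eta v.
Proof.
pose M1 := `|M| + 1; have M10 : 0 <= `|M| by [].
(* Box coordinates are at most 2 in absolute value, [lin eta i] at most [M1] because its square is
   at most [|M|], and truncation only raises the density. *)
exists (\prod_(i < n) phi (2 + M1)); first by apply: prodr_gt0 => i _; exact: phi_gt0.
move=> eta VM v; apply: prod_lb => i; [exact: phi_ge0|exact: ubox_ge0|].
have [[-> t12]|->] := ubox_cases (vlow i) (tnth v i); last by rewrite mulr0 tn_pdf_ge0.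
rewrite mulr1; apply: le_trans (tn_pdf_lb _ _ _).
have h : lin eta i ^+ 2 <= `|M|.
  apply: le_trans (ler_norm M); apply: le_trans VM.
  by rewrite V1E (bigD1 i)//= lerDl sumr_ge0// => l _; rewrite sqr_ge0.
have {h} h : - M1 <= lin eta i <= M1 by rewrite /M1; apply/andP; split; nra.
have [ts tb] : tn_set (y i) (tnth v i) /\ -2 <= tnth v i <= 2.
  move: t12; rewrite /vlow; case: (y i) => /= /andP[? ?]; split; lra.
rewrite ts mul1r; apply: ler_phi.
move: h tb => /andP[? ?] /andP[? ?].
have M11 : 0 <= M1 by rewrite addr_ge0.
nra.
Qed.

(** [N] is the density of the new [eta] when [(tau, v)] is uniform on the box; its mass is 1 because
    all sides have length 1. *)
Lemma minorization_lyap (M : R) : exists eps : R, exists N : d.-tuple R -> \bar R,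
  [/\ 0 < eps, measurable_fun setT N, (forall y, 0 <= N y)%E, lebint N = 1%E &
    forall x, lyap x <= M -> forall y, (eps%:E * N y <= kden x y)%E].
Proof.
have [e1 e10 H1] := tau_cond_lb M; have [e2 e20 H2] := v_cond_lb M.
have mt : measurable_fun setT tau_box by rewrite /tau_box; mfun; apply: mfun_ubox; mfun.
have mv : measurable_fun setT v_box by rewrite /v_box; mfun; apply: mfun_ubox; mfun.
have t0 tau : 0 <= tau_box tau by apply: prodr_ge0 => *; exact: ubox_ge0.
have v0 v : 0 <= v_box v by apply: prodr_ge0 => *; exact: ubox_ge0.
have mu1 s : measurable_fun setT (ubox s) by apply: mfun_ubox; mfun.
have mG : measurable_fun setT (fun z : r.-tuple R * n.-tuple R => tau_box z.1 * v_box z.2).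
  by mfun; [apply: (measurableT_comp mt)|apply: (measurableT_comp mv)]; mfun.
exists (e1 * e2), (mixK X Z (fun tau v => tau_box tau * v_box v)); split.
- by rewrite mulr_gt0.
- by apply: measurable_mixK => // *; exact: mulr_ge0.
- by move=> z; apply: mixK_ge0 => *; exact: mulr_ge0.
- apply: (lebint_mixK1 rkW mG _ (G := tau_box) (H := v_box)) => //.
  + by move=> *; exact: mulr_ge0.
  + move=> tau [j tj]; rewrite /tau_box (bigD1 j)//=.
    have [[_ /andP[h _]]|->] := ubox_cases 1 (tnth tau j); last by rewrite mul0r.
    by have := lt_le_trans h tj; rewrite ltNge ler01.
  + exact: (@lebint_prod1 R r (fun=> ubox 1) (fun=> mu1 _) (fun=> ubox_ge0 _) (fun=> integral_ubox _)).
  + exact: (@lebint_prod1 R n (fun i => ubox (vlow i)) (fun=> mu1 _) (fun=> ubox_ge0 _) (fun=> integral_ubox _)).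
move=> eta VM eta'; have V1M := le_trans (V1_le_lyap _ _ _ _ eta) VM.
have F0 tau v : 0 <= tau_box tau * v_box v * kG tau v eta' by nneg.
rewrite /mixK -lebintZl; first last.
- by move=> tau; apply: lebint_ge0 => v; rewrite lee_fin.
- apply: (@measurable_lebint _ _ _ _ (fun (tau : r.-tuple R) v =>
    (tau_box tau * v_box v * kG tau v eta')%:E)); last by move=> *; rewrite lee_fin.
  by mfun; [apply: (measurableT_comp mt)|apply: (measurableT_comp mv)]; mfun.
- by rewrite lee_fin mulr_ge0 ?ltW.
apply: lebint_le => tau.
  by apply: mule_ge0; [rewrite lee_fin mulr_ge0 ?ltW|apply: lebint_ge0 => v; rewrite lee_fin].
rewrite -lebintZl; first last.
- by move=> v; rewrite lee_fin.
- by mfun.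
- by rewrite lee_fin mulr_ge0 ?ltW.
apply: lebint_le => v; rewrite -EFinM lee_fin.
  by apply: mulr_ge0 => //; rewrite mulr_ge0 ?ltW.
rewrite [leLHS]mulrA ler_wpM2r ?kG_ge0//.
have e (g h k l : R) : g * h * (k * l) = (g * k) * (h * l) by ring.
rewrite [leLHS]e; apply: ler_pM; [| |exact: H1|exact: H2].
  by rewrite mulr_ge0// ltW.
by rewrite mulr_ge0// ltW.
Qed.

End Minorization.

(** * The posterior density *)

Section TruncatedMass.
Variable R : realType.

(** The substitution [t |-> m - t] carries []-oo, m[] to the positive half-line, and [phi] is even;
    the end point [m] is null. *)
Lemma Phi_tnZ (m : R) : Phi m = tnZ m true.
Proof.
rewrite /Phi /tnZ; congr fine.
rewrite -integral_itv_bndo_bndc; last first.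
  by apply: measurable_funS measurableT _ _ => //; mfun.
rewrite [LHS]integral_mkcond.
rewrite -[RHS](integral_sub_left m); first last.
- by move=> x; rewrite lee_fin tn_dens_ge0.
- by mfun.
apply: eq_integral => x _; rewrite patchE /= subr_gt0.
have -> : (x \in `]-oo, m[%classic) = (x < m) by apply/idP/idP; rewrite inE/= in_itv.
have -> : m - x - m = - x by ring.
by rewrite /phi sqrrN; case: (x < m); rewrite ?mul1r ?mul0r.
Qed.

Lemma tnZ_add (m : R) : tnZ m true + tnZ m false = 1.
Proof.
apply: EFin_inj; rewrite EFinD -!tnZE -(integral_phi m) -ge0_integralD//; try by nneg.
- apply: eq_integral => x _; rewrite -EFinD; congr _%:E => /=.
  by rewrite ltNge; case: (x <= 0) => /=; ring.
- by mfun.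
- by mfun.
Qed.

(** On the truncation set of a misclassified coordinate [t * m <= 0], so [phi (t - m) <= expR (- m
    ^+ 2 / 2) * phi t]. *)
Lemma tnZ_le_expR (m : R) (y : bool) :
  tnZ m y <= expR (- Num.max 0 ((1 - 2 * y%:R) * m) ^+ 2 / 2).
Proof.
have [h|h] := leP 0 ((1 - 2 * y%:R) * m); last first.
  by rewrite expr0n/= oppr0 mul0r expR0 tnZ_le1.
rewrite -lee_fin -tnZE -[leRHS]mule1 -(integral_phi 0) -ge0_integralZl_EFin//; first last.
- by mfun.
- by move=> x _; nneg.
apply: ge0_integral_mono => t; rewrite lee_fin ?tn_dens_ge0//.
have [ts|] := boolP (tn_set y t); last by rewrite mul0r; nneg.
rewrite mul1r /phi subr0 mulrA ler_wpM2r ?invr_ge0 ?sqrtr_ge0//.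
rewrite -expRD ler_expR.
have h2 : ((1 - 2 * y%:R) * m) ^+ 2 = m ^+ 2 by clear; case: y => /=; ring.
have tm : t * m <= 0.
  case: y {h2} ts h => /= ts h.
    by rewrite mulr_ge0_le0 ?(ltW ts)//; lra.
  by rewrite mulr_le0_ge0//; lra.
by rewrite h2; lra.
Qed.

End TruncatedMass.

Section Posterior.
Variables (R : realType) (n p r : nat) (qj : 'I_r -> nat).
Notation q := (qsum qj).
Notation d := (p + qsum qj)%N.
Variables (X : 'M[R]_(n, p)) (Z : 'M[R]_(n, q)) (y : 'I_n -> bool) (a b : 'I_r -> R).
Notation W := (W X Z).
Notation lin := (lin X Z).
Notation Sigma := (Sigma X Z).
Notation tau_cond := (@Defs.tau_cond R p r qj a b).
Notation v_cond := (v_cond X Z y).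
Notation kG := (@kG R n p r qj X Z).
Notation lik := (lik X Z y).
Notation prior_u_tau := (@Defs.prior_u_tau R p r qj a b).
Notation post_un := (post_un X Z y a b).
Notation al j := (a j + (qj j)%:R / 2).
Hypothesis rkW : \rank W = d.
Hypothesis al_gt0 : forall j, 0 < al j.

Lemma lik_tnZ (eta : d.-tuple R) : lik eta = \prod_i tnZ (lin eta i) (y i).
Proof.
apply: eq_bigr => i _; rewrite Phi_tnZ; case: (y i) => //.
by have := tnZ_add (lin eta i); lra.
Qed.

Lemma lik_gt0 (eta : d.-tuple R) : 0 < lik eta.
Proof. by rewrite lik_tnZ prodr_gt0// => i _; exact: tnZ_gt0. Qed.

Definition pcst j : R := (2 * pi) `^ (- ((qj j)%:R / 2)).

Lemma pcst_gt0 j : 0 < pcst j.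
Proof. by rewrite powR_gt0// mulr_gt0// pi_gt0. Qed.

(** Conjugacy: the normal factor raises the shape by [q_j / 2] and the rate by [|u_j|^2 / 2], and
    leaves the constant [pcst j]. *)
Lemma prior_gamma (eta : d.-tuple R) tau : prior_u_tau eta tau =
  \prod_j (pcst j * gamma_un (al j) (rate b eta j) (tnth tau j)).
Proof.
apply: eq_bigr => j _ /=; rewrite /gamma_un; case: ifP => t0; last by rewrite mulr0.
set t := tnth tau j in t0 *; have p2 : 0 < 2 * pi :> R by rewrite mulr_gt0// pi_gt0.
rewrite powRM ?invr_ge0 ?ltW// -[(2 * pi)^-1]powR_inv1 ?ltW// -powRrM mulN1r -/(pcst j).
have -> : t `^ (al j - 1) = t `^ (a j - 1) * t `^ ((qj j)%:R / 2).
  by rewrite -powRD ?(gt_eqF t0) ?implybT//; congr powR; ring.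
have -> : expR (- (rate b eta j * t)) = expR (- (b j * t)) * expR (- (t * usq eta j) / 2).
  by rewrite -expRD /rate; congr expR; field.
by ring.
Qed.

Lemma prior_ge0 (eta : d.-tuple R) tau : 0 <= prior_u_tau eta tau.
Proof. by rewrite prior_gamma; apply: prodr_ge0 => j _; rewrite mulr_ge0 ?gamma_un_ge0 ?(ltW (pcst_gt0 _)). Qed.

Lemma prior_eq0 (eta : d.-tuple R) tau : (exists j, tnth tau j <= 0) -> prior_u_tau eta tau = 0.
Proof. by move=> [j tj]; rewrite /Defs.prior_u_tau (bigD1 j)//= ltNge tj mul0r. Qed.

Lemma mfun_prior dd (T : measurableType dd) (f : T -> d.-tuple R) (g : T -> r.-tuple R) :
  measurable_fun setT f -> measurable_fun setT g ->
  measurable_fun setT (fun x => prior_u_tau (f x) (g x)).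
Proof.
move=> mf mg.
apply: (mfun_eq (f := fun x => \prod_j (pcst j * gamma_un (al j) (rate b (f x) j) (tnth (g x) j)))).
  by move=> x; rewrite prior_gamma.
have mr j : measurable_fun setT (fun x => rate b (f x) j) by rewrite /rate; mfun.
by mfun; exact: mr.
Qed.

(** The latent-variable likelihood: integrating out [v] returns [lik], and dividing by [lik] gives
    [v_cond]. *)
Definition vdens (eta : d.-tuple R) (v : n.-tuple R) : R :=
  \prod_i ((tn_set (y i) (tnth v i))%:R * phi (tnth v i - lin eta i)).

Lemma vdens_ge0 eta v : 0 <= vdens eta v.
Proof. by apply: prodr_ge0 => i _; exact: tn_dens_ge0. Qed.

Lemma mfun_vdens dd (T : measurableType dd) (f : T -> d.-tuple R) (g : T -> n.-tuple R) :
  measurable_fun setT f -> measurable_fun setT g ->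
  measurable_fun setT (fun x => vdens (f x) (g x)).
Proof. by move=> mf mg; rewrite /vdens; mfun. Qed.

Lemma lebint_vdens eta : lebint (fun v => (vdens eta v)%:E) = (lik eta)%:E.
Proof.
rewrite lik_tnZ; apply: (@lebint_prod R n
  (fun i t => (tn_set (y i) t)%:R * phi (t - lin eta i)) (fun i => tnZ (lin eta i) (y i))).
- by move=> i; mfun.
- by move=> i x; exact: tn_dens_ge0.
- by move=> i; exact: tnZE.
Qed.

Lemma vdens_v_cond eta v : vdens eta v = lik eta * v_cond eta v.
Proof.
rewrite lik_tnZ /Defs.v_cond -big_split; apply: eq_bigr => i _ /=.
by rewrite tn_pdfE [RHS]mulrC divfK // gt_eqF // tnZ_gt0.
Qed.

Definition eta00 : d.-tuple R := [tuple 0 | i < d].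

(* The weight of [(tau, v)] such that prior times latent likelihood is this weight
   times [kG]; not depending on [eta], it can be read off at [eta = 0]. *)
Definition joint0 (tau : r.-tuple R) (v : n.-tuple R) : R :=
  prior_u_tau eta00 tau * vdens eta00 v / kG tau v eta00.

Lemma tcol_eta00 : tcol eta00 = 0.
Proof. by apply/matrixP => i j; rewrite !mxE tnth_mktuple. Qed.

Lemma usq_eta00 j : usq eta00 j = 0.
Proof. by apply: big1 => k _; rewrite /ucoord tnth_mktuple expr0n. Qed.

Lemma lin_eta00 i : lin eta00 i = 0.
Proof. by rewrite /Defs.lin tcol_eta00 mulmx0 mxE. Qed.

Lemma joint0_ge0 tau v : 0 <= joint0 tau v.
Proof. by rewrite /joint0 divr_ge0 ?kG_ge0// mulr_ge0 ?prior_ge0 ?vdens_ge0. Qed.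

Lemma joint0_eq0 tau v : (exists j, tnth tau j <= 0) -> joint0 tau v = 0.
Proof. by move=> tau0; rewrite /joint0 prior_eq0// !mul0r. Qed.

Lemma measurable_joint0 :
  measurable_fun setT (fun z : r.-tuple R * n.-tuple R => joint0 z.1 z.2).
Proof.
rewrite /joint0; mfun; first by apply: mfun_prior; mfun.
by apply: mfun_vdens; mfun.
Qed.

(** Passing from 0 to [eta] multiplies both sides by the same exponential, of
    [- eta^T Sigma eta / 2 + v^T W eta]: on the left the prior and the latent normals supply its
    pieces, on the right it comes from completing the square. *)
Lemma joint_factor eta tau v :
  prior_u_tau eta tau * vdens eta v = joint0 tau v * kG tau v eta.
Proof.
have [tau0|tau0] := tau_dich tau; last by rewrite /joint0 !prior_eq0// !mul0r.
have SP := Sigma_posdef rkW tau0.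
have E1 : prior_u_tau eta tau =
    prior_u_tau eta00 tau * expR (\sum_j - (tnth tau j * usq eta j) / 2).
  rewrite expR_sum -big_split; apply: eq_bigr => j _ /=; rewrite tau0 usq_eta00.
  by rewrite mulr0 oppr0 mul0r expR0 mulr1 !mulrA.
have E2 : vdens eta v = vdens eta00 v *
    expR (\sum_i (tnth v i * lin eta i - lin eta i ^+ 2 / 2)).
  rewrite expR_sum -big_split; apply: eq_bigr => i _ /=; rewrite lin_eta00 subr0.
  rewrite -mulrA; congr (_ * _); rewrite /phi mulrAC -expRD; congr (expR _ / _); by field.
pose h := W^T *m tcol v.
have E3 : kG tau v eta = kG tau v eta00 *
    expR (- (qf (Sigma tau) (tcol eta) - 2 * ((tcol eta)^T *m h) 0 0) / 2).
  rewrite (complete_square _ _ SP) !kGE !mvn_pdfE -[RHS]mulrA; congr (_ * _).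
  rewrite -expRD tcol_eta00 sub0r qfN -/h; congr expR; by field.
have E4 : ((tcol eta)^T *m h) 0 0 = \sum_i tnth v i * lin eta i.
  rewrite /h mulmxA -trmx_mul mxE; apply: eq_bigr => l _.
  by rewrite mulrC /tcol mxE; congr (_ * _); rewrite mxE.
have k0 : kG tau v eta00 != 0 by rewrite gt_eqF// mvn_pdf_gt0.
rewrite E1 E2 E3 /joint0.
have e (A B k x w z : R) : k != 0 -> x * w = z -> A * x * (B * w) = A * B / k * (k * z).
  by move=> k1 <-; field.
apply: e => //; rewrite -expRD; congr expR.
rewrite qf_Sigma E4 big_split/= sumrN -!mulr_suml sumrN V1E.
by field.
Qed.

Definition Lpost (eta : d.-tuple R) : \bar R := lebint (fun tau => (post_un eta tau)%:E).

Lemma Lpost_mixK eta : Lpost eta = mixK X Z joint0 eta.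
Proof.
apply: eq_lebint => tau.
rewrite (eq_lebint (g := fun v => (prior_u_tau eta tau)%:E * (vdens eta v)%:E)%E); last first.
  by move=> v; rewrite -EFinM joint_factor.
rewrite lebintZl ?lee_fin ?prior_ge0//.
- by rewrite lebint_vdens -EFinM mulrC.
- by apply: mfun_EFin; apply: mfun_vdens; mfun.
- by move=> v; rewrite lee_fin vdens_ge0.
Qed.

Lemma measurable_Lpost : measurable_fun setT Lpost.
Proof.
apply: (mfun_eq (f := mixK X Z joint0)); first by move=> eta; rewrite Lpost_mixK.
by apply: measurable_mixK; [exact: measurable_joint0|exact: joint0_ge0].
Qed.

Lemma post_un_ge0 eta tau : 0 <= post_un eta tau.
Proof. by rewrite mulr_ge0 ?prior_ge0// ltW// lik_gt0. Qed.

Lemma Lpost_ge0 eta : (0 <= Lpost eta)%E.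
Proof. by apply: lebint_ge0 => tau; rewrite lee_fin post_un_ge0. Qed.

Definition pmass (eta : d.-tuple R) : R :=
  \prod_j (pcst j * (Gam (al j) * rate b eta j `^ (- al j))).

Lemma LpostE eta : (forall j, 0 < rate b eta j) -> Lpost eta = (lik eta * pmass eta)%:E.
Proof.
move=> r0; rewrite EFinM.
rewrite -(@lebint_prod R r (fun j t => pcst j * gamma_un (al j) (rate b eta j) t)
   (fun j => pcst j * (Gam (al j) * rate b eta j `^ (- al j)))).
- rewrite -lebintZl ?lee_fin ?(ltW (lik_gt0 _))//.
  + by apply: eq_lebint => tau; rewrite -EFinM -prior_gamma.
  + by mfun.
  + by move=> tau; rewrite lee_fin -prior_gamma prior_ge0.
- by move=> j; mfun.
- by move=> j t; rewrite mulr_ge0 ?gamma_un_ge0 ?(ltW (pcst_gt0 _)).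
- move=> j; rewrite EFinM -(integral_gamma_un (al_gt0 j) (r0 j)).
  rewrite -ge0_integralZl_EFin//.
  + by move=> t _; rewrite lee_fin gamma_un_ge0.
  + by mfun.
  + exact: ltW (pcst_gt0 _).
Qed.

Lemma Lpost_gt0 eta : (forall j, 0 < rate b eta j) -> (0 < Lpost eta)%E.
Proof.
move=> r0; rewrite LpostE// lte_fin mulr_gt0 ?lik_gt0// prodr_gt0// => j _.
by rewrite !mulr_gt0 ?pcst_gt0 ?Gam_gt0 ?powR_gt0.
Qed.

Lemma tau_cond_pmass eta tau : (forall j, 0 < rate b eta j) ->
  pmass eta * tau_cond eta tau = prior_u_tau eta tau.
Proof.
move=> r0; rewrite prior_gamma tau_condE -big_split; apply: eq_bigr => j _ /=.
rewrite /tau_fac r0 gamma_pdfE// powRN.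
have G0 : Gam (al j) != 0 by rewrite gt_eqF// Gam_gt0.
have P0 : rate b eta j `^ al j != 0 by rewrite gt_eqF// powR_gt0.
by field; rewrite G0.
Qed.

End Posterior.

(** * Elementary inequalities for dominating the posterior *)

Section RealBounds.
Variable R : realType.

(** Replaces the sum in [lyap] by a product, so that the bound factors over the blocks. *)
Lemma one_add_sum_le_prod (I : Type) (s : seq I) (P : pred I) (x : I -> R) :
  (forall i, 0 <= x i) -> 1 + \sum_(i <- s | P i) x i <= \prod_(i <- s | P i) (1 + x i).
Proof.
move=> x0; elim: s => [|i s IH]; first by rewrite !big_nil addr0.
rewrite !big_cons; case: ifP => // _.
have S0 : 0 <= \sum_(j <- s | P j) x j by apply: sumr_ge0.
apply: (@le_trans _ _ ((1 + x i) * (1 + \sum_(j <- s | P j) x j))).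
  have := mulr_ge0 (x0 i) S0; lra.
by rewrite ler_wpM2l// addr_ge0.
Qed.

Lemma powRN_le_add1 (u s t : R) : 0 < u -> 0 <= s -> s <= t -> u `^ (- s) <= 1 + u `^ (- t).
Proof.
move=> u0 s0 st; have [u1|u1] := leP 1 u.
  apply: ler_wpDr; first exact: powR_ge0.
  by rewrite -(powRr0 u) ler_powR// oppr_le0.
apply: ler_wpDl => //.
have e z : u `^ (- z) = u^-1 `^ z by rewrite -powR_inv1 ?ltW// -powRrM mulN1r.
by rewrite !e ler_powR// invf_ge1// ltW.
Qed.

(** Half of the exponential decay absorbs the linear factor. *)
Lemma add1_le_expR (k x : R) : 0 < k -> 0 <= x ->
  expR (- (k * x)) * (1 + x) <= (1 + 2 / k) * expR (- (k / 2 * x)).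
Proof.
move=> k0 x0; have -> : expR (- (k * x)) = expR (- (k / 2 * x)) * expR (- (k / 2 * x)).
  by rewrite -expRD; congr expR; field.
rewrite [leRHS]mulrC -mulrA ler_wpM2l ?expR_ge0//.
rewrite expRN mulrC ler_pdivrMr ?expR_gt0//.
have h : 1 + k / 2 * x <= expR (k / 2 * x) by exact: expR_ge1Dx.
have k2 : 0 < 2 / k by rewrite divr_gt0.
apply: (@le_trans _ _ ((1 + 2 / k) * (1 + k / 2 * x))); last by rewrite ler_wpM2l// addr_ge0// ltW.
have e : (1 + 2 / k) * (1 + k / 2 * x) = 1 + x + 2 / k + k / 2 * x.
  by field; rewrite gt_eqF.
rewrite e -[leRHS]addrA lerDl; apply: addr_ge0; first exact: ltW.
by apply: mulr_ge0 => //; rewrite ltW// divr_gt0.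
Qed.

(** The power of [s] splits into [#|P|] factors of exponent [- g / 2], and [x i ^+ 2 <= s] bounds
    one of them by each coordinate. *)
Lemma powRN_sum_sqr_le (I : finType) (P : pred I) (x : I -> R) (g : R) : 0 <= g ->
  (forall i, x i != 0) ->
  (\sum_(i | P i) x i ^+ 2) `^ (- (#|P|%:R * g / 2)) <= \prod_(i | P i) `|x i| `^ (- g).
Proof.
move=> g0 xn; set s := \sum_(i | P i) _.
have -> : s `^ (- (#|P|%:R * g / 2)) = \prod_(i | P i) s `^ (- (g / 2)).
  transitivity ((s `^ (- (g / 2))) ^+ #|P|); last by rewrite -prodr_const; apply: eq_bigl.
  by rewrite -powR_mulrn ?powR_ge0// -powRrM; congr powR; field.
apply: ler_prod => i Pi; rewrite powR_ge0/=.
have xi : 0 < `|x i| by rewrite normr_gt0.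
have x2E : x i ^+ 2 = `|x i| ^+ 2 by rewrite real_normK// num_real.
have -> : `|x i| `^ (- g) = (x i ^+ 2) `^ (- (g / 2)).
  by rewrite x2E -powR_mulrn// -powRrM; congr powR; field.
have x2 : 0 < x i ^+ 2 by rewrite x2E exprn_gt0.
have xs : x i ^+ 2 <= s.
  by rewrite /s (bigD1 i)//= lerDl sumr_ge0// => l _; rewrite sqr_ge0.
rewrite !powRN lef_pV2 ?posrE ?powR_gt0//; last exact: lt_le_trans xs.
by apply: ge0_ler_powR; rewrite ?nnegrE ?divr_ge0 ?(ltW x2)// (le_trans _ xs)// ltW.
Qed.

End RealBounds.

(** * Domination by products of one-variable functions *)

Section PosteriorBound.
Variables (R : realType) (n p r : nat) (qj : 'I_r -> nat).
Notation q := (qsum qj).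
Notation d := (p + qsum qj)%N.
Variables (X : 'M[R]_(n, p)) (Z : 'M[R]_(n, q)) (y : 'I_n -> bool) (a b : 'I_r -> R).
Notation W := (W X Z).
Notation lin := (lin X Z).
Notation V1 := (V1 X Z).
Notation lik := (lik X Z y).
Notation al j := (a j + (qj j)%:R / 2).
Hypothesis qj_gt0 : forall j, (0 < qj j)%N.
Hypothesis ab : forall j, (a j < 0 /\ b j = 0) \/ 0 < b j.
Hypothesis rkW : \rank W = d.
Hypothesis al_gt0 : forall j, 0 < al j.
Hypothesis A2 : exists e : 'rV[R]_n, (forall i, 0 < e 0 i) /\ e *m Wstar X Z y = 0.

(** Each misclassified coordinate contributes a Gaussian factor, and together they carry a fixed
    share of [V1]. *)
Lemma lik_le : exists2 k : R, 0 < k & forall eta : d.-tuple R, lik eta <= expR (- (k * V1 eta)).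
Proof.
have [c c0 H] := pospart_ge A2; exists (c / 2); first by rewrite divr_gt0.
move=> eta; rewrite lik_tnZ.
apply: (@le_trans _ _ (\prod_i expR (- Num.max 0 (cc R y i * lin eta i) ^+ 2 / 2))).
  by apply: ler_prod => i _; rewrite (ltW (tnZ_gt0 _ _)) tnZ_le_expR.
rewrite -expR_sum ler_expR -mulr_suml sumrN.
have := H eta; lra.
Qed.

Lemma lik_V1_le : exists C k : R, [/\ 0 <= C, 0 < k & forall eta : d.-tuple R,
  lik eta * (1 + V1 eta) <= C * \prod_i expR (- (k * tnth eta i ^+ 2))].
Proof.
have [k k0 H] := lik_le; have [D D0 HD] := sumsq_le_V1 rkW.
exists (1 + 2 / k), (k / 2 / D); split.
- by rewrite addr_ge0// divr_ge0// ltW.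
- by rewrite !divr_gt0.
move=> eta; have V0 := V1_ge0 X Z eta.
apply: (@le_trans _ _ (expR (- (k * V1 eta)) * (1 + V1 eta))).
  by rewrite ler_wpM2r// addr_ge0.
apply: le_trans (add1_le_expR k0 V0) _; rewrite ler_wpM2l//.
  by rewrite addr_ge0// divr_ge0// ltW.
rewrite -expR_sum ler_expR sumrN lerN2 -mulr_sumr.
rewrite -[leLHS]mulrA ler_pM2l ?divr_gt0// mulrC ler_pdivrMr// mulrC.
exact: HD.
Qed.

(* The singularity [|u_j|^(- (q_j + a_j))] is spread over the [q_j] coordinates of
   [u_j], leaving the integrable exponent [1 + a_j / q_j < 1] on each of them. *)
Definition gexp : R := \big[Num.max/0]_(j < r | b j == 0) (1 + a j / (qj j)%:R).

Lemma gexp_ge0 : 0 <= gexp. Proof. exact: bigmax_ge_id. Qed.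

Lemma gexp_lt1 : gexp < 1.
Proof.
apply: bigmax_lt => // j bj; have aj := b0_a_lt0 ab bj.
by rewrite gtrDl pmulr_llt0// invr_gt0 ltr0n.
Qed.

(** [al j - a j / 2] is the exponent of [usq] in the posterior density times [V2], [usq ^ (- al j)]
    coming from the [tau]-integral and [usq ^ (a j / 2)] from [V2]. *)
Lemma gexp_ge j : b j == 0 -> al j - a j / 2 <= (qj j)%:R * gexp / 2.
Proof.
move=> bj; have qp : 0 < (qj j)%:R :> R by rewrite ltr0n.
have h : 1 + a j / (qj j)%:R <= gexp.
  exact: (le_bigmax_cond _ (fun j => 1 + a j / (qj j)%:R)).
have : (qj j)%:R * (1 + a j / (qj j)%:R) <= (qj j)%:R * gexp by rewrite ler_wpM2l// ltW.
have -> : (qj j)%:R * (1 + a j / (qj j)%:R) = (qj j)%:R + a j by field; rewrite gt_eqF.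
lra.
Qed.

Definition wgt (x : R) : R := 1 + `|x| `^ (- gexp).

Lemma measurable_wgt : measurable_fun setT wgt.
Proof. by rewrite /wgt; mfun; apply: (measurableT_comp (@normr_measurable _ _)); mfun. Qed.

Lemma wgt_ge1 x : 1 <= wgt x.
Proof. by rewrite lerDl powR_ge0. Qed.

Lemma uidx_ex j : exists i : 'I_d, uidx j i.
Proof.
have /card_gt0P[i ji] : (0 < #|[pred i : 'I_d | uidx j i]|)%N by rewrite (card_uidx p qj j).
by exists i.
Qed.

Lemma usq_gt0 (eta : d.-tuple R) j : (forall i, tnth eta i != 0) -> 0 < usq eta j.
Proof.
move=> en; rewrite usqE.
have [i ji] := uidx_ex j; rewrite (bigD1 i)//= ltr_pwDl//.
  by rewrite exprn_even_gt0//= en.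
by apply: sumr_ge0 => l _; rewrite sqr_ge0.
Qed.

Lemma rate_gt0 (eta : d.-tuple R) j : (forall i, tnth eta i != 0) -> 0 < rate b eta j.
Proof.
move=> /usq_gt0 - /(_ j) u0; rewrite /rate ltr_wpDl ?divr_gt0//.
by have [[_ ->//]|/ltW] := ab j.
Qed.

Lemma rate_fac_le j : exists2 K : R, 0 <= K & forall eta : d.-tuple R,
  (forall i, tnth eta i != 0) ->
  rate b eta j `^ (- al j) * (if b j == 0 then 1 + V2 (- a j / 2) j eta else 1) <=
  K * \prod_(i | uidx j i) wgt (tnth eta i).
Proof.
have P1 (eta : d.-tuple R) : 1 <= \prod_(i | uidx j i) wgt (tnth eta i).
  by apply: (big_ind (fun x => 1 <= x)) => [//|g h|i _]; [exact: mulr_ege1|exact: wgt_ge1].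
have aj := al_gt0 j.
have [bj|bj] := boolP (b j == 0); last first.
  have b0 : 0 < b j by have [[_ b0]|//] := ab j; rewrite b0 eqxx in bj.
  exists (b j `^ (- al j)); first exact: powR_ge0.
  move=> eta en; apply: ler_pM => //; first exact: powR_ge0.
  have r0 := rate_gt0 j en.
  rewrite !powRN lef_pV2 ?posrE ?powR_gt0//; apply: ge0_ler_powR.
  - exact: ltW.
  - by rewrite nnegrE ltW.
  - by rewrite nnegrE ltW.
  - by rewrite /rate lerDl divr_ge0// usq_ge0.
pose c := - a j / 2; have c0 : 0 < c by rewrite /c; have := b0_a_lt0 ab bj; lra.
(* The power of 1/2 comes from the rate [usq / 2]; the factor 2 counts the two terms of [1 + V2],
   each bounded by the product of weights. *)
exists (2^-1 `^ (- al j) * 2); first by rewrite mulr_ge0// powR_ge0.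
move=> eta en; have u0 := usq_gt0 j en; set u := usq eta j in u0.
rewrite /rate (eqP bj) add0r -/u powRM ?invr_ge0 ?(ltW u0)// /V2 -/c -/u.
set P := \prod_(i | _) _.
have h1 : u `^ (- ((qj j)%:R * gexp / 2)) <= \prod_(i | uidx j i) `|tnth eta i| `^ (- gexp).
  by rewrite /u usqE -{1}(card_uidx p qj j); apply: powRN_sum_sqr_le => //; exact: gexp_ge0.
have h2 : 1 + u `^ (- ((qj j)%:R * gexp / 2)) <= P.
  apply: le_trans (_ : 1 + \prod_(i | uidx j i) `|tnth eta i| `^ (- gexp) <= _).
    by rewrite lerD2l.
  have [i ji] := uidx_ex j; rewrite /P (bigD1 i)//= [leRHS](bigD1 i)//= /wgt mulrDl mul1r.
  apply: lerD.
    by apply: (big_ind (fun x => 1 <= x)) => [//|g h|l _]; [exact: mulr_ege1|exact: wgt_ge1].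
  rewrite ler_wpM2l ?powR_ge0//; apply: ler_prod => l _.
  by rewrite powR_ge0/= lerDr ler01.
have g := gexp_ge bj.
have h3 : u `^ (- al j) <= 1 + u `^ (- ((qj j)%:R * gexp / 2)).
  apply: powRN_le_add1 => //; first exact: ltW.
  by have := c0; rewrite /c; lra.
have h4 : u `^ (- al j) * u `^ (- c) <= 1 + u `^ (- ((qj j)%:R * gexp / 2)).
  rewrite -powRD ?(gt_eqF u0) ?implybT// -opprD; apply: powRN_le_add1 => //.
    by rewrite addr_ge0// ltW.
  by rewrite /c; lra.
have e (s t v : R) : s * t * (1 + v) = t * (s + s * v) by ring.
rewrite [leLHS]e -[leRHS]mulrA ler_wpM2l ?powR_ge0//; lra.
Qed.

(** The blocks are disjoint, and the coordinates of [beta] outside them only add factors at least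
    1. *)
Lemma prod_blocks_le (w : 'I_d -> R) : (forall i, 1 <= w i) ->
  \prod_(j < r) \prod_(i | uidx j i) w i <= \prod_i w i.
Proof.
move=> w1; rewrite (exchange_big_dep xpredT)//=.
apply: ler_prod => i _; have w0 : 0 <= w i by apply: le_trans (w1 i).
rewrite prodr_ge0//=.
have [/existsP[j ji]|/existsPn H] := boolP [exists j, uidx j i]; last first.
  by rewrite big_pred0// => j; apply/negbTE.
rewrite (big_pred1 j)// => l /=; apply/idP/eqP => [li|->//].
move: ji li; case: (split_ordP i) => k ->; first by rewrite !uidx_lshift.
by rewrite !uidx_rshift => ji li; exact: inblk_uniq li ji.
Qed.

End PosteriorBound.

(** * Propriety and invariance of the posterior *)

Section Finiteness.
Variables (R : realType) (n p r : nat) (qj : 'I_r -> nat).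
Notation mu := (@lebesgue_measure R).
Notation q := (qsum qj).
Notation d := (p + qsum qj)%N.
Variables (X : 'M[R]_(n, p)) (Z : 'M[R]_(n, q)) (y : 'I_n -> bool) (a b : 'I_r -> R).
Notation W := (W X Z).
Notation V1 := (V1 X Z).
Notation lyap := (lyap X Z a b).
Notation lik := (lik X Z y).
Notation Lpost := (Lpost X Z y a b).
Notation wgt := (wgt qj a b).
Notation tau_cond := (@Defs.tau_cond R p r qj a b).
Notation v_cond := (v_cond X Z y).
Notation kden := (kden X Z y a b).
Notation kG := (@kG R n p r qj X Z).
Notation joint0 := (@joint0 R n p r qj X Z y a b).
Notation al j := (a j + (qj j)%:R / 2).
Hypothesis qj_gt0 : forall j, (0 < qj j)%N.
Hypothesis ab : forall j, (a j < 0 /\ b j = 0) \/ 0 < b j.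
Hypothesis rkW : \rank W = d.
Hypothesis al_gt0 : forall j, 0 < al j.

Section Proper.
Hypothesis A2 : exists e : 'rV[R]_n, (forall i, 0 < e 0 i) /\ e *m Wstar X Z y = 0.

Lemma pmass_le : exists2 B : R, 0 <= B & forall eta : d.-tuple R, (forall i, tnth eta i != 0) ->
  pmass a b eta * \prod_(j | b j == 0) (1 + V2 (- a j / 2) j eta) <= B * \prod_i wgt (tnth eta i).
Proof.
have /choice[K HK] : forall j, exists K : R, 0 <= K /\ forall eta : d.-tuple R,
    (forall i, tnth eta i != 0) ->
    rate b eta j `^ (- al j) * (if b j == 0 then 1 + V2 (- a j / 2) j eta else 1) <=
    K * \prod_(i | uidx j i) wgt (tnth eta i).
  by move=> j; have [K] := rate_fac_le p qj_gt0 ab al_gt0 j; exists K.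
have G0 j : 0 <= pcst R qj j * Gam (al j).
  by rewrite mulr_ge0// ltW ?pcst_gt0 ?Gam_gt0.
exists (\prod_j (pcst R qj j * Gam (al j) * K j)).
  by apply: prodr_ge0 => j _; rewrite mulr_ge0//; have [] := HK j.
move=> eta en; rewrite big_mkcond /pmass -big_split/=.
apply: (@le_trans _ _ (\prod_j (pcst R qj j * Gam (al j) * K j *
    \prod_(i | uidx j i) wgt (tnth eta i)))).
  apply: ler_prod => j _; have [_ H] := HK j.
  rewrite -!mulrA; apply/andP; split.
    rewrite mulrA; apply: mulr_ge0 => //; apply: mulr_ge0; first exact: powR_ge0.
    by case: ifP => // _; rewrite addr_ge0// powR_ge0.
  by rewrite mulrA [leRHS]mulrA; apply: ler_wpM2l => //; exact: H.
rewrite big_split/= ler_wpM2l//.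
  by apply: prodr_ge0 => j _; rewrite mulr_ge0//; have [] := HK j.
by apply: prod_blocks_le => i; exact: wgt_ge1.
Qed.

Lemma Lpost_lyap_le : exists C k : R, [/\ 0 <= C, 0 < k & forall eta : d.-tuple R,
  (forall i, tnth eta i != 0) ->
  (Lpost eta * (1 + lyap eta)%:E <=
   (C * \prod_i (wgt (tnth eta i) * expR (- (k * tnth eta i ^+ 2))))%:E)%E].
Proof.
have [B B0 HB] := pmass_le; have [C [k [C0 k0 H]]] := lik_V1_le rkW A2.
exists (C * B), k; split => //; first exact: mulr_ge0.
move=> eta en; rewrite LpostE//; last by move=> j; exact: rate_gt0.
rewrite -EFinM lee_fin.
have V0 := V1_ge0 X Z eta; have l0 := ltW (lik_gt0 X Z y eta).
have S0 : 0 <= \sum_(j | b j == 0) V2 (- a j / 2) j eta.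
  by apply: sumr_ge0 => j _; exact: powR_ge0.
have pm0 : 0 <= pmass a b eta.
  apply: prodr_ge0 => j _; apply: mulr_ge0; first exact: ltW (pcst_gt0 _ _ _).
  by rewrite mulr_ge0 ?powR_ge0// ltW// Gam_gt0.
have W0 : 0 <= \prod_i wgt (tnth eta i).
  by apply: prodr_ge0 => i _; apply: le_trans (wgt_ge1 _ _ _ _).
apply: (@le_trans _ _ ((lik eta * (1 + V1 eta)) *
    (pmass a b eta * \prod_(j | b j == 0) (1 + V2 (- a j / 2) j eta)))).
  have e (s t u v : R) : s * t * (u * v) = s * u * (t * v) by ring.
  rewrite [leRHS]e; apply: ler_wpM2l; first exact: mulr_ge0.
  have h : 1 + \sum_(j | b j == 0) V2 (- a j / 2) j eta <= \prod_(j | b j == 0) (1 + V2 (- a j / 2) j eta).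
    by apply: one_add_sum_le_prod => j; exact: powR_ge0.
  apply: (@le_trans _ _ ((1 + V1 eta) * (1 + \sum_(j | b j == 0) V2 (- a j / 2) j eta))).
    by rewrite lyapE; have := mulr_ge0 V0 S0; lra.
  by rewrite ler_wpM2l// addr_ge0.
have e (s t u v : R) : s * t * (u * v) = s * v * (t * u) by ring.
rewrite big_split/= [leRHS]e; apply: ler_pM; [| |exact: H|exact: HB].
- by rewrite mulr_ge0// addr_ge0.
- rewrite mulr_ge0// prodr_ge0// => j _.
  by rewrite addr_ge0// powR_ge0.
Qed.

(** The weight [1 + lyap] yields two facts at once: propriety of the posterior and the finite mean
    of [lyap] that [harris] asks for. *)
Lemma Lpost_lyap_lty : (lebint (fun eta => Lpost eta * (1 + lyap eta)%:E) < +oo)%E.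
Proof.
have [C [k [C0 k0 H]]] := Lpost_lyap_le.
pose f (x : R) := wgt x * expR (- (k * x ^+ 2)).
have f0 x : 0 <= f x by rewrite mulr_ge0 ?expR_ge0// (le_trans _ (wgt_ge1 _ _ _ _)).
have mf : measurable_fun setT f.
  by apply: mfun_M; [exact: measurable_wgt|mfun].
have If : (\int[mu]_x (f x)%:E < +oo)%E.
  exact: integral_powN_gauss_lty (gexp_ge0 _ _ _) (gexp_lt1 qj_gt0 ab) k0.
have Ifn : (\int[mu]_x (f x)%:E)%E \is a fin_num.
  by rewrite ge0_fin_numE// integral_ge0// => x _; rewrite lee_fin.
apply: (@le_lt_trans _ _ (lebint (fun eta : d.-tuple R => (C * \prod_i f (tnth eta i))%:E))).
  apply: lebint_le_nz.
  - apply: mfun_eM; first exact: measurable_Lpost.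
    by mfun; exact: measurable_lyap.
  - move=> t; rewrite mule_ge0 ?Lpost_ge0// lee_fin addr_ge0//; exact: lyap_ge0.
  - by mfun; apply: (measurableT_comp mf); mfun.
  - by move=> t; rewrite lee_fin mulr_ge0// prodr_ge0.
  - exact: H.
rewrite (eq_lebint (g := fun eta : d.-tuple R => C%:E * (\prod_i f (tnth eta i))%:E)%E); last first.
  by move=> eta; rewrite EFinM.
rewrite lebintZl ?lee_fin//; first last.
- by move=> t; rewrite lee_fin prodr_ge0.
- by mfun; apply: (measurableT_comp mf); mfun.
rewrite (@lebint_prod R d (fun=> f) (fun=> fine (\int[mu]_x (f x)%:E)%E)) ?fineK//.
by rewrite -EFinM ltry.
Qed.

Lemma lebint_Lpost_lty : (lebint Lpost < +oo)%E.
Proof.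
apply: le_lt_trans Lpost_lyap_lty; apply: lebint_le => eta; first exact: Lpost_ge0.
by rewrite -[leLHS]mule1 lee_wpmul2l ?Lpost_ge0// lee_fin lerDl lyap_ge0.
Qed.

Lemma opE_Lpost_lyap_lty : (opE Lpost lyap < +oo)%E.
Proof.
apply: le_lt_trans Lpost_lyap_lty; apply: lebint_le => eta.
  by rewrite mule_ge0 ?Lpost_ge0// lee_fin lyap_ge0.
by rewrite lee_wpmul2l ?Lpost_ge0// lee_fin lerDr.
Qed.

Lemma lebint_Lpost_gt0 : (0 < lebint Lpost)%E.
Proof.
apply: lebint_gt0; [exact: measurable_Lpost|exact: Lpost_ge0|].
move=> eta e0; apply: Lpost_gt0 => // j; apply: rate_gt0 => // i.
by rewrite gt_eqF.
Qed.

End Proper.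

Section Invariance.
Variable f : d.-tuple R -> R.
Hypothesis mf : measurable_fun setT f.
Hypothesis f01 : forall eta, 0 <= f eta <= 1.

Let f0 eta : 0 <= f eta. Proof. by have /andP[] := f01 eta. Qed.

Definition cmean (tau : r.-tuple R) (v : n.-tuple R) : R :=
  fine (lebint (fun eta' => (kG tau v eta' * f eta')%:E)).

Lemma cmeanE tau v : (forall j, 0 < tnth tau j) ->
  lebint (fun eta' => (kG tau v eta' * f eta')%:E) = (cmean tau v)%:E.
Proof.
move=> tau0; rewrite fineK// ge0_fin_numE; last first.
  by apply: lebint_ge0 => eta; rewrite lee_fin mulr_ge0 ?kG_ge0.
apply: (@le_lt_trans _ _ 1%E); last exact: ltry.
rewrite -(lebint_kG rkW v tau0); apply: lebint_le => eta; rewrite lee_fin.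
  by rewrite mulr_ge0 ?kG_ge0.
by rewrite ler_piMr ?kG_ge0//; have /andP[] := f01 eta.
Qed.

Lemma cmean_ge0 tau v : 0 <= cmean tau v.
Proof. by apply: fine_ge0; apply: lebint_ge0 => eta; rewrite lee_fin mulr_ge0 ?kG_ge0. Qed.

Lemma measurable_cmean : measurable_fun setT (fun z : r.-tuple R * n.-tuple R => cmean z.1 z.2).
Proof.
apply: (measurableT_comp (@fine_measurable R _ measurableT)).
apply: (@measurable_lebint _ _ _ _ (fun (z : r.-tuple R * n.-tuple R) eta' =>
  (kG z.1 z.2 eta' * f eta')%:E)).
  by mfun; apply: (measurableT_comp mf); mfun.
by move=> z eta; rewrite lee_fin mulr_ge0 ?kG_ge0.
Qed.

Lemma cmean_mul (c : R) tau v : ((exists j, tnth tau j <= 0) -> c = 0) ->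
  (c%:E * lebint (fun eta' => (kG tau v eta' * f eta')%:E) = (c * cmean tau v)%:E)%E.
Proof.
move=> c0; have [tau0|tau0] := tau_dich tau; first by rewrite cmeanE.
by rewrite c0// mul0e mul0r.
Qed.

Let J tau v := joint0 tau v * cmean tau v.

Let J0 tau v : 0 <= J tau v.
Proof. by rewrite mulr_ge0 ?joint0_ge0 ?cmean_ge0. Qed.

Let mJ : measurable_fun setT (fun z : r.-tuple R * n.-tuple R => J z.1 z.2).
Proof. by apply: mfun_M; [exact: measurable_joint0|exact: measurable_cmean]. Qed.

Lemma opE_Lpost : opE Lpost f = lebint (fun tau => lebint (fun v => (J tau v)%:E)).
Proof.
transitivity (opE (mixK X Z joint0) f).
  by apply: eq_lebint => eta; rewrite Lpost_mixK.
rewrite opE_mixK//; [|exact: measurable_joint0|exact: joint0_ge0].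
apply: eq_lebint => tau; apply: eq_lebint => v.
by rewrite cmean_mul//; exact: joint0_eq0.
Qed.

Let mk : measurable_fun setT (fun z : d.-tuple R * d.-tuple R => kden z.1 z.2).
Proof. exact: measurable_kden. Qed.

Let k0 x z : (0 <= kden x z)%E. Proof. exact: kden_ge0. Qed.

Let k1 x : lebint (kden x) = 1%E. Proof. exact: lebint_kden. Qed.

(** For positive rates [Lpost eta] is [lik eta * pmass eta], and multiplying it by the conditional
    densities of [tau] and [v] restores prior times latent likelihood, that is [joint0] times
    [kG]. *)
Lemma Lpost_opP eta : (forall i, tnth eta i != 0) ->
  (Lpost eta * (opP kden f eta)%:E = mixK X Z J eta)%E.
Proof.
move=> en; have r0 j : 0 < rate b eta j by exact: rate_gt0.
have [c cE _] := opE_bnd (measurable_kden_eta X Z y a b eta) (k0 eta) (k1 eta) f01.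
rewrite /opP cE/= -cE opE_kden// LpostE//.
set c0 := lik eta * _; have c00 : 0 <= c0.
  by rewrite -lee_fin /c0 -LpostE// Lpost_ge0.
pose G tau v := tau_cond eta tau * v_cond eta v * cmean tau v.
have G0 tau v : 0 <= G tau v by rewrite /G mulr_ge0 ?cmean_ge0//; nneg.
have mG : measurable_fun setT (fun z : r.-tuple R * n.-tuple R => G z.1 z.2).
  by apply: mfun_M; [mfun|exact: measurable_cmean].
have -> : lebint (fun tau => lebint (fun v =>
    (tau_cond eta tau * v_cond eta v)%:E * lebint (fun eta' => (kG tau v eta' * f eta')%:E))%E)
    = lebint (fun tau => lebint (fun v => (G tau v)%:E)).
  apply: eq_lebint => tau; apply: eq_lebint => v; rewrite cmean_mul// => tau0.
  by rewrite tau_cond_eq0// mul0r.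
rewrite -lebintZl ?lee_fin//; first last.
- by move=> tau; apply: lebint_ge0 => v; rewrite lee_fin.
- apply: (@measurable_lebint _ _ _ _ (fun tau v => (G tau v)%:E)); first exact: mfun_EFin.
  by move=> tau v; rewrite lee_fin.
apply: eq_lebint => tau; rewrite -lebintZl ?lee_fin//; first last.
- by move=> v; rewrite lee_fin.
- by apply: mfun_EFin; apply: (mfun_comp2 mG); mfun.
apply: eq_lebint => v; rewrite -EFinM; congr _%:E.
rewrite /J [RHS]mulrAC -joint_factor// -(tau_cond_pmass al_gt0 tau r0) vdens_v_cond /G /c0.
by ring.
Qed.

(** In the formula of [Lpost_opP] the state [eta] occurs only in [kG], which integrates to 1,
    leaving the integral of [J]. Averaging [f] over the posterior gives the same integral, with [kG]
    used up in [cmean]. *)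
Lemma Lpost_invariant : opE Lpost (opP kden f) = opE Lpost f.
Proof.
rewrite opE_Lpost -(lebint_mixK rkW mJ J0); last first.
  by move=> tau v tau0; rewrite /J joint0_eq0// mul0r.
have of01 := opP_bnd mk k0 k1 f01.
apply: lebint_eq_nz.
- apply: mfun_eM; first exact: measurable_Lpost.
  by apply: mfun_EFin; exact: measurable_opP.
- move=> eta; rewrite mule_ge0 ?Lpost_ge0// lee_fin.
  by have /andP[] := of01 eta.
- exact: measurable_mixK.
- by move=> eta; exact: mixK_ge0.
- exact: Lpost_opP.
Qed.

End Invariance.

End Finiteness.

Theorem theorem2 (R : realType) (n p r : nat) (qj : 'I_r -> nat)
    (X : 'M[R]_(n, p)) (Z : 'M[R]_(n, qsum qj)) (y : 'I_n -> bool) (a b : 'I_r -> R) :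
  (forall j, (0 < qj j)%N) ->
  (forall j, (a j < 0 /\ b j = 0) \/ 0 < b j) ->
  (* (A1) *) \rank (W X Z) = (p + qsum qj)%N ->
  (* (A2) *) (exists e : 'rV[R]_n, (forall i, 0 < e 0 i) /\ e *m Wstar X Z y = 0) ->
  (* (A3) *) (forall j, 0 < 2 * a j + (qj j)%:R) ->
  (* the posterior is proper *)
  ((0 < post_norm X Z y a b)%E /\ (post_norm X Z y a b < +oo)%E) /\
  (* geometric ergodicity of the eta-marginal Gibbs chain w.r.t. the posterior *)
  exists t : R, 0 < t < 1 /\
  exists J : (p + qsum qj).-tuple R -> R, (forall x, 0 < J x) /\
  forall (x : (p + qsum qj).-tuple R) (m : nat) (O : set ((p + qsum qj).-tuple R)),
    measurable O ->
    (`| Kpow X Z y a b m x O - posterior X Z y a b O | <= (J x * t ^+ m)%:E)%E.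
Proof.
move=> qj0 ab rkW A2 A3.
have al0 j : 0 < a j + (qj j)%:R / 2 by have := A3 j; lra.
pose L := Lpost X Z y a b; pose N := fine (lebint L).
have L0 := Lpost_ge0 X Z y a b; have mL := measurable_Lpost y a b rkW.
have Lgt : (0 < lebint L)%E by exact: lebint_Lpost_gt0.
have Llt : (lebint L < +oo)%E by exact: lebint_Lpost_lty.
split; first by split.
have NE : lebint L = N%:E by rewrite fineK// ge0_fin_numE// ltW.
have N0 : 0 < N by rewrite -lte_fin -NE.
have Ni0 : 0 <= N^-1 by rewrite invr_ge0 ltW.
pose w eta := (L eta * (N^-1)%:E)%E.
have mw : measurable_fun setT w by apply: mfun_eM => //; exact: measurable_cst.
have w0 eta : (0 <= w eta)%E by rewrite mule_ge0// lee_fin.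
have opw (f : (p + qsum qj).-tuple R -> R) : measurable_fun setT f -> (forall eta, 0 <= f eta) ->
    opE w f = (opE L f * (N^-1)%:E)%E.
  move=> mf f0; rewrite /opE -lebintZr ?lee_fin//; first last.
  - by move=> eta; rewrite mule_ge0// lee_fin.
  - by apply: mfun_eM => //; exact: mfun_EFin.
  by apply: eq_lebint => eta; rewrite muleAC.
have w1 : lebint w = 1%E.
  by rewrite lebintZr ?lee_fin// NE -EFinM mulfV// gt_eqF.
have mk := measurable_kden X Z y a b; have k0 := kden_ge0 X Z y a b.
have k1 := lebint_kden y b rkW al0.
have [lam [l [lam0 lam1 l0 drift]]] := drift_lyap ab rkW al0 A2.
have mV := measurable_lyap X Z a b; have V0 := lyap_ge0 X Z a b.
have w_inv (f : (p + qsum qj).-tuple R -> R) : measurable_fun setT f -> (forall eta, 0 <= f eta <= 1) ->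
    opE w (opP (kden X Z y a b) f) = opE w f.
  move=> mf f01; have f0 eta : 0 <= f eta by have /andP[] := f01 eta.
  have of01 := opP_bnd mk k0 k1 f01.
  rewrite !opw ?Lpost_invariant//; first exact: measurable_opP.
  by move=> eta; have /andP[] := of01 eta.
have wV : (opE w (lyap X Z a b) < +oo)%E.
  rewrite opw//; apply: lte_mul_pinfty; rewrite ?lee_fin ?opE_ge0 ?ltry//.
  rewrite ge0_fin_numE ?opE_ge0//; exact: opE_Lpost_lyap_lty.
have [t [C [t01 C0 H]]] := harris mk k0 k1 mV V0 lam0 lam1 l0 drift
  (minorization_lyap y ab rkW al0) mw w0 w1 w_inv wV.
exists t; split=> //.
(* The final 1 makes the bound strictly positive even if [C = 0]. *)
exists (fun x => C * (1 + lyap X Z a b x) + 1); split=> [x|x m O mO].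
  by rewrite ltr_wpDl// mulr_ge0// addr_ge0.
pose f : (p + qsum qj).-tuple R -> R := \1_O.
have mf : measurable_fun setT f by exact: measurable_indic.
have f01 eta : 0 <= f eta <= 1 by rewrite /f indicE; case: (_ \in _); rewrite ?lexx ?ler01.
(* The iterates stay in [[0, 1]], so taking [fine] in [opP] loses nothing and the extended-real
   recursion of [Kpow] is the real one. *)
have KE : forall i eta, Kpow X Z y a b i eta O = (iter i (opP (kden X Z y a b)) f eta)%:E.
  elim=> [//|i IH] eta; have [g01 _] := H f mf f01 i eta.
  have [c cE _] := opE_bnd (measurable_kden_eta X Z y a b eta) (k0 eta) (k1 eta) g01.
  rewrite iterS /opP cE/= -cE; apply: eq_lebint => eta'.
  by rewrite IH.
have [c cE _] := opE_bnd mw w0 w1 f01.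
have PE : posterior X Z y a b O = c%:E.
  rewrite -cE (opw f mf) => [|eta]; last by have /andP[] := f01 eta.
  congr (_ * _)%E; apply: eq_lebint => eta; exact: muleC.
rewrite KE PE -EFinB lee_fin; have [_] := H f mf f01 m x; rewrite cE/= => h.
apply: le_trans h _; rewrite mulrC ler_wpM2r ?lerDl//.
by rewrite exprn_ge0// ltW//; case/andP: t01.
Qed.
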